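(* Let $G$ be a simple graph with $m$ edges and $\Gamma$ a straight-line drawing of $G$. If the intersection graph $C$ of $\Gamma$ is a tree with maximum degree $k\in\mathbb{N}$, then the problem MaxPED on input $\Gamma$ can be solved (i.e., a partial edge drawing of $\Gamma$ with maximum ink can be computed) in $O(mk^2+m\log m)$ time and space.
   Context: A straight-line drawing $\Gamma$ of a simple graph $G$ maps vertices to distinct points of the plane and each edge $s=uv$ to the straight-line segment between its endpoints (of length $|s|$), no vertex lying in the interior of an edge not incident to it; edges and their segments are identified. Two edges cross (intersect) if their segments meet in a point other than a common end-vertex. The intersection graph $C$ of $\Gamma$ has one vertex for each edge of $G$, and two vertices of $C$ are adjacent if and only if the corresponding segments intersect. A partial edge drawing (PED) $D$ of $\Gamma$ replaces every edge $s=uv$ by two stubs of positive length contained in the segment of $s$: one of length $f_u|s|$ starting at $u$ and one of length $f_v|s|$ starting at $v$, where $f_u+f_v=f_s$ and $0<f_s\le 1$, such that no stubs of different edges cross. Stubs are regarded as not containing their inner endpoints (the endpoint that is not a vertex), so a stub may end exactly at a crossing point of $\Gamma$ and gaps of infinitesimal size are not charged. The ink of $D$ is the total stub length $I(D)=\sum_{s\in E(G)} f_s|s|$. MaxPED: given $\Gamma$, find a PED $D^*$ of $\Gamma$ such that $I(D^* )$ is maximum over all PEDs of $\Gamma$. Running times count elementary operations, with arithmetic and comparisons on coordinates and lengths at unit cost, as usual in computational geometry. *)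

(* Defs.v *)
From HB Require Import structures.
From mathcomp Require Import all_boot all_order all_algebra.
From mathcomp Require Import boolp classical_sets reals.

Set Implicit Arguments.
Unset Strict Implicit.
Unset Printing Implicit Defensive.

Import Order.TTheory GRing.Theory Num.Theory.

Local Open Scope ring_scope.
Local Open Scope classical_set_scope.

(** * Finite graphs *)

(* A simple graph with vertices 0, ..., n-1 and edges numbered 0, ..., m-1.
   Edges are undirected: [src]/[dst] only names the two ends of an edge. *)
Record sgraph (n m : nat) := SGraph {
  src : 'I_m -> 'I_n;
  dst : 'I_m -> 'I_n;
  sgraph_loopless : forall s, src s != dst s;
  sgraph_simple : injective (fun s => [set src s; dst s]%SET)
}.

Definition ends n m (G : sgraph n m) (s : 'I_m) : {set 'I_n} :=
  [set src G s; dst G s]%SET.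

(* For symmetric irreflexive e. A [ucycle] of size at least 3 is a cycle in the
   graph-theoretic sense; those of size 2 are edges traversed back and forth. *)
Definition is_tree (T : finType) (e : rel T) : Prop :=
  [/\ (0 < #|T|)%N,
      forall x y : T, connect e x y
    & forall c : seq T, ucycle e c -> (size c < 3)%N].

Definition max_degree (T : finType) (e : rel T) : nat :=
  \max_(x : T) #|[set y | e x y]%SET|.

(** * Straight-line drawings and partial edge drawings *)

Section Drawings.
Variable R : realType.
Local Notation point := (R * R)%type.

Definition along (p q : point) (t : R) : point :=
  (p.1 + t * (q.1 - p.1), p.2 + t * (q.2 - p.2)).

Definition dist (p q : point) : R :=
  Num.sqrt ((q.1 - p.1) ^+ 2 + (q.2 - p.2) ^+ 2).

Variables (n m : nat) (G : sgraph n m) (pos : 'I_n -> point).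

Definition segment (s : 'I_m) : set point :=
  [set p | exists2 t : R, 0 <= t <= 1
                        & p = along (pos (src G s)) (pos (dst G s)) t].

Definition segment_interior (s : 'I_m) : set point :=
  [set p | exists2 t : R, 0 < t < 1
                        & p = along (pos (src G s)) (pos (dst G s)) t].

Definition edge_length (s : 'I_m) : R := dist (pos (src G s)) (pos (dst G s)).

Definition is_drawing : Prop :=
  injective pos /\
  forall (v : 'I_n) (s : 'I_m), v \notin ends G s -> ~ segment_interior s (pos v).

(* A and B are subsets of the segments of s and t respectively. *)
Definition meet_off_common_end (s t : 'I_m) (A B : set point) : Prop :=
  exists p, [/\ A p, B p
    & ~ exists v, [/\ v \in ends G s, v \in ends G t & pos v = p]].

Definition intersection_graph : rel 'I_m :=
  fun s t => (s != t) && `[< meet_off_common_end s t (segment s) (segment t) >].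

(* A choice of stubs assigns to each edge the pair of its two length fractions,
   the first at [src], the second at [dst]. Stubs are half-open: the inner
   endpoint does not belong to the stub. *)
Definition stub_src (f : 'I_m -> R * R) (s : 'I_m) : set point :=
  [set p | exists2 t : R, 0 <= t < (f s).1
                        & p = along (pos (src G s)) (pos (dst G s)) t].

Definition stub_dst (f : 'I_m -> R * R) (s : 'I_m) : set point :=
  [set p | exists2 t : R, 0 <= t < (f s).2
                        & p = along (pos (dst G s)) (pos (src G s)) t].

Definition is_PED (f : 'I_m -> R * R) : Prop :=
  (forall s, [/\ 0 < (f s).1, 0 < (f s).2 & (f s).1 + (f s).2 <= 1]) /\
  (forall s t, s != t ->
     ~ meet_off_common_end s t (stub_src f s `|` stub_dst f s)
                               (stub_src f t `|` stub_dst f t)).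

Definition ink (f : 'I_m -> R * R) : R :=
  \sum_s ((f s).1 + (f s).2) * edge_length s.

Definition is_MaxPED (f : 'I_m -> R * R) : Prop :=
  is_PED f /\ forall g, is_PED g -> ink g <= ink f.

End Drawings.

Local Close Scope ring_scope.

(** * Real RAM

   A program is a finite piece of code over
   - natural-number variables and real variables,
   - arrays of naturals and arrays of reals (working memory, initially 0),
   - a read-only input,
   all named by numerals. Naturals serve as counters and addresses and support
   only addition, truncated subtraction and comparison; reals support field
   operations, square root and comparison. There is no conversion between reals
   and naturals (in particular no floor), and the only literals are natural
   numbers, so that programs do not depend on the field of reals. *)

Inductive iexp :=
| IConst of nat
| IVar of nat
| IAdd of iexp & iexp
| ISub of iexp & iexp
| IGet of nat & iexp              (* array name, index *)
| InVerts
| InEdges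
| InSrc of iexp
| InDst of iexp.

Inductive rexp :=
| RConst of nat
| RVar of nat
| RAdd of rexp & rexp
| RSub of rexp & rexp
| RMul of rexp & rexp
| RDiv of rexp & rexp
| RSqrt of rexp
| RGet of nat & iexp              (* array name, index *)
| InX of iexp
| InY of iexp.

Inductive bexp :=
| BILt of iexp & iexp
| BRLt of rexp & rexp
| BNot of bexp
| BAnd of bexp & bexp.

Inductive cmd :=
| Skip
| ISet of nat & iexp
| RSet of nat & rexp
| IPut of nat & iexp & iexp       (* array name, index, value *)
| RPut of nat & iexp & rexp       (* array name, index, value *)
| Seq of cmd & cmd
| If of bexp & cmd & cmd
| While of bexp & cmd.

(* The cost of an expression is the number of its operations and operands. *)
Fixpoint icost (e : iexp) : nat :=
  match e with
  | IConst _ | IVar _ | InVerts | InEdges => 1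
  | IAdd a b | ISub a b => (icost a + icost b).+1
  | IGet _ a | InSrc a | InDst a => (icost a).+1
  end.

Fixpoint rcost (e : rexp) : nat :=
  match e with
  | RConst _ | RVar _ => 1
  | RAdd a b | RSub a b | RMul a b | RDiv a b => (rcost a + rcost b).+1
  | RSqrt a => (rcost a).+1
  | RGet _ a | InX a | InY a => (icost a).+1
  end.

Fixpoint bcost (e : bexp) : nat :=
  match e with
  | BILt a b => (icost a + icost b).+1
  | BRLt a b => (rcost a + rcost b).+1
  | BNot a => (bcost a).+1
  | BAnd a b => (bcost a + bcost b).+1
  end.

Definition upd (T : Type) (f : nat -> T) (x : nat) (v : T) : nat -> T :=
  fun y => if y == x then v else f y.

Section Machine.
Variable R : realType.

Record input := Input {
  in_verts : nat;
  in_edges : nat;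
  in_src : nat -> nat;
  in_dst : nat -> nat;
  in_x : nat -> R;
  in_y : nat -> R
}.

Record state := State {
  ivar : nat -> nat;
  rvar : nat -> R;
  iarr : nat -> nat -> nat;       (* array name, index *)
  rarr : nat -> nat -> R
}.

Definition init_state : state :=
  State (fun=> 0) (fun=> 0%R) (fun _ _ => 0) (fun _ _ => 0%R).

Section Semantics.
Variable inp : input.

Fixpoint ieval (st : state) (e : iexp) : nat :=
  match e with
  | IConst n => n
  | IVar x => ivar st x
  | IAdd a b => ieval st a + ieval st b
  | ISub a b => ieval st a - ieval st b
  | IGet A a => iarr st A (ieval st a)
  | InVerts => in_verts inp
  | InEdges => in_edges inp
  | InSrc a => in_src inp (ieval st a)
  | InDst a => in_dst inp (ieval st a)
  end.

(* As usual in MathComp, x / 0 = 0 and the square root of a negative number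
   is 0; both cases can be detected by a comparison with 0 anyway. *)
Fixpoint reval (st : state) (e : rexp) : R :=
  match e with
  | RConst n => n%:R%R
  | RVar x => rvar st x
  | RAdd a b => (reval st a + reval st b)%R
  | RSub a b => (reval st a - reval st b)%R
  | RMul a b => (reval st a * reval st b)%R
  | RDiv a b => (reval st a / reval st b)%R
  | RSqrt a => Num.sqrt (reval st a)
  | RGet A a => rarr st A (ieval st a)
  | InX a => in_x inp (ieval st a)
  | InY a => in_y inp (ieval st a)
  end.

Fixpoint beval (st : state) (e : bexp) : bool :=
  match e with
  | BILt a b => ieval st a < ieval st b
  | BRLt a b => (reval st a < reval st b)%R
  | BNot a => ~~ beval st a
  | BAnd a b => beval st a && beval st b
  end.

(* [exec S P st t st']: started in st, P halts in st' after t elementary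
   operations, every array having S cells. A write outside the S cells has no
   rule, so the run is stuck; cells that were never written need no storage and
   read as 0. As a fixed program names only finitely many arrays and variables,
   it uses at most (number of arrays) * S + (number of variables) memory cells,
   i.e. O(S) for S > 0. The read-only input is not counted. *)
Inductive exec (S : nat) : cmd -> state -> nat -> state -> Prop :=
| ExecSkip st : exec S Skip st 1 st
| ExecISet st x e :
    exec S (ISet x e) st (icost e).+1
      (State (upd (ivar st) x (ieval st e)) (rvar st) (iarr st) (rarr st))
| ExecRSet st x e :
    exec S (RSet x e) st (rcost e).+1
      (State (ivar st) (upd (rvar st) x (reval st e)) (iarr st) (rarr st))
| ExecIPut st A a e : ieval st a < S ->
    exec S (IPut A a e) st (icost a + icost e).+1
      (State (ivar st) (rvar st)
        (upd (iarr st) A (upd (iarr st A) (ieval st a) (ieval st e)))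
        (rarr st))
| ExecRPut st A a e : ieval st a < S ->
    exec S (RPut A a e) st (icost a + rcost e).+1
      (State (ivar st) (rvar st) (iarr st)
        (upd (rarr st) A (upd (rarr st A) (ieval st a) (reval st e))))
| ExecSeq P Q st t st' t' st'' :
    exec S P st t st' -> exec S Q st' t' st'' ->
    exec S (Seq P Q) st (t + t') st''
| ExecIf b P Q st t st' :
    exec S (if beval st b then P else Q) st t st' ->
    exec S (If b P Q) st (bcost b + t).+1 st'
| ExecWhileTrue b P st t st' t' st'' : beval st b ->
    exec S P st t st' -> exec S (While b P) st' t' st'' ->
    exec S (While b P) st ((bcost b).+1 + t + t') st''
| ExecWhileFalse b P st : ~~ beval st b ->
    exec S (While b P) st (bcost b).+1 st.

End Semantics.

(* Coordinates indexed by vertices, end-vertices indexed by edges, 0 outside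
   the range of indices. *)
Definition encode n m (G : sgraph n m) (pos : 'I_n -> R * R) : input :=
  Input n m
    (fun i => oapp (fun s : 'I_m => nat_of_ord (src G s)) 0 (insub i))
    (fun i => oapp (fun s : 'I_m => nat_of_ord (dst G s)) 0 (insub i))
    (fun i => oapp (fun v : 'I_n => (pos v).1) 0%R (insub i))
    (fun i => oapp (fun v : 'I_n => (pos v).2) 0%R (insub i)).

(* The stub fractions of edge s are left in cell s of the real arrays 0
   (at [src]) and 1 (at [dst]). *)
Definition output m (st : state) : 'I_m -> R * R :=
  fun s => (rarr st 0 s, rarr st 1 s).

End Machine.

(* The successor only matters for m = 1 and k = 0, where m k^2 + m log m = 0;
   for a tree on m >= 2 vertices it is absorbed by the constant factor of O. *)
Definition cost_bound (m k : nat) : nat :=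
  (m * k ^ 2 + m * trunc_log 2 m).+1.

(* Main.v *)
Require Import Defs.
From mathcomp Require Import all_boot all_order all_algebra.
From mathcomp Require Import boolp classical_sets reals.
From mathcomp Require Import zify ring lra.

Set Implicit Arguments.
Unset Strict Implicit.
Unset Printing Implicit Defensive.
Import Order.TTheory GRing.Theory Num.Theory.

(* If the intersection graph is a tree, the drawing has only m - 1 crossings,
   and no three edges cross in the same point, as they would form a triangle.
   Hence a plane sweep with a balanced tree as status finds all crossings in
   time O(m log m), and sorting lists them in order along each edge.

   Root the tree of crossings at edge 0. For the part of the tree below an edge t
   two numbers matter: the maximum ink F, and the maximum ink U if the stubs of t
   must not contain the crossing of t with its parent. As stubs do not contain
   their inner end-points, the stubs of an edge s contain an initial and a final
   part of its crossings, and for given parts it is best to put the ends of the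
   gap at the first and the last uncovered crossing. If s covers the crossing
   with t, the part below t contributes U, and otherwise F. So a scan of the
   crossings of s that remembers the best ink before, inside and after the gap
   computes F and U of s in constant time per crossing. In total this takes time
   O(m log m), independently of the maximum degree.

   The program is not written down. [Cost f T] says that some program computes f
   in time O(T), with immutable data in a heap that only grows, and is closed
   under the operations from which the algorithm is built. *)

(** Heap cells are never overwritten, so a compound value is passed by its address, the solutions
    for [F] and [U] share their parts, and two solutions are concatenated in constant time as an
    unbalanced tree. The price is that no mutable array is at hand: the adjacency lists live in a
    search tree over edge numbers, at a logarithmic cost per access, which m log m affords.

    The drawing may be degenerate, with vertical edges and many edges at one vertex. The program
    compares points lexicographically; the proof replaces this order by the coordinate x + eps y,
    with eps > 0 so small that the order of the finitely many end-points and crossings is kept. Each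
    edge is then the graph of an affine function of that coordinate. Overlaps along a line do not
    occur: no vertex lies inside an edge and the graph is simple, so two edges that meet off a
    common end cross properly in one point.

    The machine has no recursion: descent in search trees and recursion on the tree of crossings
    become loops on explicit stacks. *)

Section Values.
Variable R : realType.

(** * Programs on immutable values in the heap *)

Inductive value := VN of nat | VR of R | VP of value & value.

(* A value occupies immutable heap cells: cell i keeps a natural in integer
   array 0, a real in real array 2, or two addresses in integer arrays 1 and 2. *)
Fixpoint rep (ia : nat -> nat -> nat) (ra : nat -> nat -> R) (h : nat)
    (v : value) (i : nat) : Prop :=
  i < h /\ match v with
           | VN n => ia 0 i = n
           | VR r => ra 2 i = r
           | VP a b => rep ia ra h a (ia 1 i) /\ rep ia ra h b (ia 2 i)
           end.

(* Integer variables: 0 is the address of the current value, 1 the first free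
   heap cell, 2 the size of the stack kept in integer array 3. *)
Definition holds (st : state R) (v : value) : Prop :=
  rep (iarr st) (rarr st) (ivar st 1) v (ivar st 0).

(** The frame condition of every program piece. Integer variable 3 is scratch and not protected.
    Real arrays 0 and 1, which hold the output, are not touched at all. *)
Definition extends (st st' : state R) : Prop :=
  [/\ ivar st 1 <= ivar st' 1, ivar st' 2 = ivar st 2,
      forall A i, A < 3 -> i < ivar st 1 -> iarr st' A i = iarr st A i,
      forall i, i < ivar st 2 -> iarr st' 3 i = iarr st 3 i
    & forall A i, (A < 2) || (i < ivar st 1) -> rarr st' A i = rarr st A i].

Lemma rep_mono ia ra h v i ia' ra' h' :
  h <= h' -> (forall A i, A < 3 -> i < h -> ia' A i = ia A i) ->
  (forall i, i < h -> ra' 2 i = ra 2 i) ->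
  rep ia ra h v i -> rep ia' ra' h' v i.
Proof.
move=> hh Hi Hr; elim: v i => [n|r|a IHa b IHb] i /= [ih].
- by rewrite Hi //; split=> //; apply: leq_trans hh.
- by rewrite Hr //; split=> //; apply: leq_trans hh.
- rewrite !Hi // => -[ra1 rb1]; split; first exact: leq_trans hh.
  by split; [apply: IHa | apply: IHb].
Qed.

Ltac cells := repeat (case: eqP => [?|?] //=; try (exfalso; lia); try subst); try by [].

Lemma rep_extends st st' v i : extends st st' ->
  rep (iarr st) (rarr st) (ivar st 1) v i ->
  rep (iarr st') (rarr st') (ivar st' 1) v i.
Proof.
case=> h1 _ h3 _ h5; apply: rep_mono => // j jh; apply: h5; by rewrite jh orbT.
Qed.

Lemma extends_refl st : extends st st. Proof. by split. Qed.

Lemma extends_trans st1 st2 st3 :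
  extends st1 st2 -> extends st2 st3 -> extends st1 st3.
Proof.
case=> a1 a2 a3 a4 a5 [b1 b2 b3 b4 b5]; split.
- exact: leq_trans b1.
- by rewrite b2.
- by move=> A i hA hi; rewrite b3 ?a3 //; lia.
- by move=> i hi; rewrite b4 ?a4 // a2.
- by move=> A i h; rewrite b5 ?a5 //; lia.
Qed.

(** The number t bounds the time, the growth of the heap and the room needed on the stack at once,
    so that a space bound comes with every time bound. *)
Definition runs (inp : input R) (c : cmd) (v w : value) (t : nat) : Prop :=
  forall S st, holds st v -> ivar st 1 + t <= S -> ivar st 2 + t <= S ->
  exists t' st', [/\ exec inp S c st t' st', t' <= t, holds st' w,
                     extends st st' & ivar st' 1 <= ivar st 1 + t].

Lemma runs_le inp c v w t1 t2 : runs inp c v w t1 -> t1 <= t2 -> runs inp c v w t2.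
Proof.
move=> H le12 S st hv h1 h2.
have [||t' [st' [e1 e2 e3 e4 e5]]] := H S st hv; try lia.
by exists t', st'; split=> //; lia.
Qed.

Lemma runs_skip inp v : runs inp Skip v v 1.
Proof.
move=> S st hv h1 h2; exists 1, st; split=> //; rewrite ?leq_addr //; exact: ExecSkip.
Qed.

Lemma runs_seq inp c1 c2 v w u t1 t2 :
  runs inp c1 v w t1 -> runs inp c2 w u t2 -> runs inp (Seq c1 c2) v u (t1 + t2).
Proof.
move=> H1 H2 S st hv h1 h2.
have [||t1' [st1 [a1 a2 a3 a4 a5]]] := H1 S st hv; try lia.
have [_ a6 _ _ _] := a4.
have [||t2' [st2 [b1 b2 b3 b4 b5]]] := H2 S st1 a3; try lia.
exists (t1' + t2'), st2; split=> //; try lia.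
- exact: ExecSeq a1 b1.
- exact: extends_trans b4.
Qed.

Lemma runs_acc inp e v w :
  (forall st, holds st v ->
     rep (iarr st) (rarr st) (ivar st 1) w (ieval inp st e)) ->
  runs inp (ISet 0 e) v w (icost e).+1.
Proof.
move=> H S st hv h1 h2.
exists (icost e).+1, (State (upd (ivar st) 0 (ieval inp st e)) (rvar st) (iarr st) (rarr st)).
split=> //; first exact: ExecISet.
- exact: H.
- rewrite /= /upd /=; lia.
Qed.

Definition new_cell (body : cmd) : cmd :=
  Seq body (Seq (ISet 0 (IVar 1)) (ISet 1 (IAdd (IVar 1) (IConst 1)))).

Definition alloc_nat (e : iexp) : cmd := new_cell (IPut 0 (IVar 1) e).
Definition alloc_real (e : rexp) : cmd := new_cell (RPut 2 (IVar 1) e).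

Lemma runs_alloc_nat inp e v n :
  (forall st, holds st v -> ieval inp st e = n) ->
  runs inp (alloc_nat e) v (VN n) (icost e + 8).
Proof.
move=> H S st hv h1 h2; do 2!eexists; split.
- apply: ExecSeq; first by apply: ExecIPut => /=; lia.
  by apply: ExecSeq; apply: ExecISet.
- rewrite /=; lia.
- by rewrite /holds /= /upd /= eqxx H //; split=> //; lia.
- split; rewrite /= /upd /= //; try lia.
    by move=> A i hA hi; case: eqP => // ->; case: eqP => //; lia.
- rewrite /= /upd /=; lia.
Qed.

Lemma runs_alloc_real inp e v r :
  (forall st, holds st v -> reval inp st e = r) ->
  runs inp (alloc_real e) v (VR r) (rcost e + 8).
Proof.
move=> H S st hv h1 h2; do 2!eexists; split.
- apply: ExecSeq; first by apply: ExecRPut => /=; lia.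
  by apply: ExecSeq; apply: ExecISet.
- rewrite /=; lia.
- by rewrite /holds /= /upd /= eqxx H //; split=> //; lia.
- split; rewrite /= /upd /= //; try lia.
  by move=> A i hA; case: eqP => // eA; subst A; case: eqP => // ei; lia.
- rewrite /= /upd /=; lia.
Qed.

Definition push : cmd :=
  Seq (IPut 3 (IVar 2) (IVar 0)) (ISet 2 (IAdd (IVar 2) (IConst 1))).
Definition top := IGet 3 (ISub (IVar 2) (IConst 1)).
Definition pop := ISet 2 (ISub (IVar 2) (IConst 1)).

(* [saving c] runs c and then pushes its result in exchange for the value that
   was current before c. *)
Definition saving (c : cmd) : cmd :=
  Seq push (Seq c (Seq (ISet 3 top)
    (Seq (IPut 3 (ISub (IVar 2) (IConst 1)) (IVar 0)) (ISet 0 (IVar 3))))).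

(** The last clause quantifies over all extensions [st''] in order to cover whatever runs between
    this push and the matching pop; resetting integer variable 2 to its old value models the pop. *)
Lemma run_saving inp c v w t S st : runs inp c v w t ->
  holds st v -> ivar st 1 + t + 1 <= S -> ivar st 2 + t + 1 <= S ->
  exists t' st', [/\ exec inp S (saving c) st t' st', t' <= t + 20,
    ivar st' 0 = ivar st 0, ivar st' 2 = (ivar st 2).+1 &
    rep (iarr st') (rarr st') (ivar st' 1) w (iarr st' 3 (ivar st 2)) /\
    forall st'', extends st' st'' ->
      extends st (State (upd (ivar st'') 2 (ivar st 2)) (rvar st'') (iarr st'') (rarr st''))
      /\ ivar st' 1 <= ivar st 1 + t].
Proof.
move=> H hv h1 h2.
set st1 := State (upd (ivar st) 2 (ivar st 2).+1) (rvar st)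
  (upd (iarr st) 3 (upd (iarr st 3) (ivar st 2) (ivar st 0))) (rarr st).
have hv1 : holds st1 v.
  apply: rep_mono hv => //= A i hA hi; rewrite /upd; case: eqP => // ?; lia.
have [||t' [st2 [a1 a2 a3 [b1 b2 b3 b4 b5] a5]]] := H S st1 hv1;
  try by rewrite /st1 /upd /=; lia.
rewrite /st1 /upd /= in b1 b2 b3 b4 b5 a5.
have b6 := b4 (ivar st 2) (ltnSn _); rewrite /= eqxx in b6.
do 2!eexists; split.
- apply: ExecSeq; first apply: ExecSeq; [apply: ExecIPut => /=; lia | exact: ExecISet |].
  rewrite /= addn1; apply: ExecSeq; first exact: a1.
  apply: ExecSeq; first exact: ExecISet.
  apply: ExecSeq; last exact: ExecISet.
  apply: ExecIPut; rewrite /= /upd /= b2; lia.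
- rewrite /=; lia.
- by rewrite /= /upd /= b2 subn1 /= b6.
- by rewrite /= /upd /= b2.
split.
  rewrite /= /upd /= b2 subn1 /= eqxx; apply: rep_mono a3 => //= A i hA hi.
  by case: eqP => // ?; lia.
- move=> st''; rewrite /extends /= /upd /= b2 subn1 /= => -[c1 c2 c3 c4 c5].
  split; last by lia.
  split=> //=; try lia.
  + move=> A i hA hi; rewrite c3 //; last lia.
    by have := b3 A i hA hi; cells.
  + move=> i hi; rewrite c4; last lia.
    by have := b4 i ltac:(lia); cells.
  + by move=> A i hA; rewrite c5 ?b5 //; lia.
Qed.

Definition pair_cmd (p q : cmd) : cmd :=
  Seq (saving p) (Seq q
  (Seq (IPut 1 (IVar 1) top) (Seq (IPut 2 (IVar 1) (IVar 0))
     (Seq (ISet 0 (IVar 1)) (Seq (ISet 1 (IAdd (IVar 1) (IConst 1))) pop))))).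

Lemma runs_pair inp p q v a b t1 t2 : runs inp p v a t1 -> runs inp q v b t2 ->
  runs inp (pair_cmd p q) v (VP a b) (t1 + t2 + 50).
Proof.
move=> H1 H2 S st hv h1 h2.
have [||t1' [st1 [a1 a2 a3 a4 [a5 a6]]]] := run_saving (S := S) H1 hv; try lia.
have [[c1 c2 c3 c4 c5] c6] := a6 _ (extends_refl st1).
rewrite /= /upd /= in c1 c2 c3 c4 c5.
have hv1 : holds st1 v.
  rewrite /holds a3; apply: rep_mono hv => // i hi.
  by rewrite c5 // hi orbT.
have [||t2' [st2 [b1 b2 b3 b4 b5]]] := H2 S st1 hv1; try lia.
have [_ _ d3 _ _] := b4.
have [d1 d2] := a6 _ b4.
have e1 := rep_extends b4 a5.
have [_ f2 _ f4 _] := b4.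
have f5 : iarr st2 3 (ivar st 2) = iarr st1 3 (ivar st 2) by apply: f4; lia.
do 2!eexists; split.
- apply: ExecSeq; first exact: a1.
  apply: ExecSeq; first exact: b1.
  apply: ExecSeq; first by apply: ExecIPut => /=; lia.
  apply: ExecSeq; first by apply: ExecIPut; rewrite /= /upd /=; lia.
  apply: ExecSeq; first exact: ExecISet.
  by apply: ExecSeq; [exact: ExecISet | exact: ExecISet].
- rewrite /=; lia.
- rewrite /holds /= /upd /= !eqxx f2 a4 subn1 /= f5; split; first by lia.
  split; [apply: rep_mono e1 | apply: rep_mono b3] => //=; try lia.
    by move=> A i hA hi; cells.
  by move=> A i hA hi; cells.
- case: d1; rewrite /= /upd /= => g1 g2 g3 g4 g5; split=> //=; rewrite /upd /=; try lia.
  + move=> A i hA hi; rewrite -g3 //; cells.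
- rewrite /= /upd /=; lia.
Qed.

(** The machine branches on expressions only. Hence the truth value computed by [p] is copied to
    integer variable 3, and the value that was current before becomes current again. *)
Definition test_cmd (p : cmd) : cmd :=
  Seq (saving p) (Seq (ISet 3 (IGet 0 top)) pop).
Definition test_exp := BILt (IConst 0) (IVar 3).
Definition if_cmd (p q r : cmd) : cmd := Seq (test_cmd p) (If test_exp q r).
Definition while_cmd (p q : cmd) : cmd :=
  Seq (test_cmd p) (While test_exp (Seq q (test_cmd p))).

Lemma run_test inp p v b t S st : runs inp p v (VN b) t ->
  holds st v -> ivar st 1 + t + 1 <= S -> ivar st 2 + t + 1 <= S ->
  exists t' st', [/\ exec inp S (test_cmd p) st t' st',
    t' <= t + 40, holds st' v, extends st st' &
    ivar st' 3 = b /\ ivar st' 1 <= ivar st 1 + t].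
Proof.
move=> H hv h1 h2.
have [||t1' [st1 [a1 a2 a3 a4 [a5 a6]]]] := run_saving (S := S) H hv; try lia.
have [[c1 c2 c3 c4 c5] c6] := a6 _ (extends_refl st1).
rewrite /= /upd /= in c1 c2 c3 c4 c5.
do 2!eexists; split.
- apply: ExecSeq; first exact: a1.
  by apply: ExecSeq; exact: ExecISet.
- rewrite /=; lia.
- rewrite /holds /= /upd /= a3; apply: rep_mono hv => // i hi.
  by rewrite c5 // hi orbT.
- by split=> //=; rewrite /upd /= a4 subn1.
- split; last by rewrite /= /upd /=; lia.
  by rewrite /= /upd /= a4 subn1 /=; case: a5.
Qed.

Lemma runs_if inp p q r v w (b : bool) t1 t2 :
  runs inp p v (VN b) t1 -> runs inp (if b then q else r) v w t2 ->
  runs inp (if_cmd p q r) v w (t1 + t2 + 50).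
Proof.
move=> H1 H2 S st hv h1 h2.
have [||t1' [st1 [a1 a2 a3 a4 [a5 a6]]]] := run_test (S := S) H1 hv; try lia.
have [_ a7 _ _ _] := a4.
have [||t2' [st2 [b1 b2 b3 b4 b5]]] := H2 S st1 a3; try lia.
exists (t1' + (bcost test_exp + t2').+1), st2; split=> //=; try lia.
- apply: ExecSeq; first exact: a1.
  by apply: ExecIf; rewrite /= a5; case: b {H1 H2 a5} b1.
- exact: extends_trans b4.
Qed.

(** A trace of the loop in which every round has its own costs, so that the total may be an
    amortised bound; 50 covers the overhead of a round. *)
Fixpoint iter_while (n : nat) (inp : input R) (p q : cmd) (v w : value) (t : nat) : Prop :=
  exists tp, match n with
  | 0 => [/\ w = v, runs inp p v (VN 0) tp & tp + 50 <= t]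
  | n'.+1 => exists u tq t', [/\ runs inp p v (VN 1) tp, runs inp q v u tq,
               iter_while n' inp p q u w t' & tp + tq + t' + 50 <= t]
  end.

Lemma runs_while inp p q n v w t :
  iter_while n inp p q v w t -> runs inp (while_cmd p q) v w t.
Proof.
move=> H S st hv h1 h2.
(* The body of the loop ends with the test for the next round. The run is split after the first
   test, so that the induction can attach that test to the end of the body. *)
suff [t' [t'' [st' [st'' [a1 a2 a3 [a4 a5 a6]]]]]] : exists t' t'' st' st'',
  [/\ exec inp S (test_cmd p) st t' st',
      exec inp S (While test_exp (Seq q (test_cmd p))) st' t'' st'', t' + t'' <= t &
   [/\ holds st'' w, extends st st'' & ivar st'' 1 <= ivar st 1 + t]].
  by exists (t' + t''), st''; split=> //; exact: ExecSeq a1 a2.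
elim: n v t st hv H h1 h2 => [|n IH] v t st hv [tp].
  case=> -> hp ht h1 h2.
  have [||t1' [st1 [a1 a2 a3 a4 [a5 a6]]]] := run_test (b := 0) (S := S) hp hv; try lia.
  exists t1', (bcost test_exp).+1, st1, st1; split=> //=; try lia.
    by apply: ExecWhileFalse; rewrite /= a5.
  by split=> //; lia.
case=> u [tq [t' [hp hq IHt ht]]] h1 h2.
have [||t1' [st1 [a1 a2 a3 a4 [a5 a6]]]] := run_test (b := 1) (S := S) hp hv; try lia.
have [_ a7 _ _ _] := a4.
have [||t2' [st2 [b1 b2 b3 b4 b5]]] := hq S st1 a3; try lia.
have [_ b7 _ _ _] := b4.
have [||x [x' [st3 [st4 [c1 c2 c3 [c4 c5 c6]]]]]] := IH u t' st2 b3 IHt; try lia.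
exists t1', ((bcost test_exp).+1 + (t2' + x) + x'), st1, st4; split=> //=; try lia.
  apply: ExecWhileTrue; first by rewrite /= a5.
    by apply: ExecSeq; [exact: b1 | exact: c1].
  exact: c2.
split=> //; last lia.
by apply: extends_trans c5; apply: extends_trans b4.
Qed.

End Values.

(** * Computable functions and their cost *)

Class Enc (R : realType) (A : Type) := enc : A -> value R.
Arguments enc {R A _} a : simpl never.

Section Enc.
Variable R : realType.
Local Notation Enc := (Enc R).

#[global] Instance Enc_nat : Enc nat := fun n => VN R n.
#[global] Instance Enc_bool : Enc bool := fun b => VN R b.
#[global] Instance Enc_real : Enc R := fun r => VR r.
#[global] Instance Enc_prod A B `{Enc A} `{Enc B} : Enc (A * B)%type :=
  fun p => VP (enc p.1) (enc p.2).
#[global] Instance Enc_option A `{Enc A} : Enc (option A) :=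
  fun o => if o is Some a then VP (VN R 1) (enc a) else VP (VN R 0) (VN R 0).
#[global] Instance Enc_unit : Enc unit := fun=> VN R 0.
#[global] Instance Enc_seq A `{Enc A} : Enc (seq A) :=
  fix e s := if s is a :: s' then VP (VN R 1) (VP (enc a) (e s')) else VP (VN R 0) (VN R 0).

(** Program and constant are chosen before the input. Owing to the successor, [T = 0] stands for
    constant time. *)
Definition Cost A B `{Enc A} `{Enc B} (f : input R -> A -> B)
    (T : input R -> A -> nat) : Prop :=
  exists c K, forall inp a, runs inp c (enc a) (enc (f inp a)) (K * (T inp a).+1).

(** [Cost] becomes opaque below to guide the tactics; this is the way back to a program. *)
Lemma Cost_runs A B `{Enc A} `{Enc B} (f : input R -> A -> B) T : Cost f T ->
  exists c K, forall inp a, runs inp c (enc a) (enc (f inp a)) (K * (T inp a).+1).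
Proof. by []. Qed.

Lemma Cost_le A B `{Enc A} `{Enc B} (f : input R -> A -> B) C T T' :
  (forall inp a, T inp a <= C * (T' inp a).+1) -> Cost f T -> Cost f T'.
Proof.
move=> HT [c [K Hc]]; exists c, (K * C.+1) => inp a; apply: (runs_le (Hc inp a)).
rewrite -mulnA leq_mul2l; apply/orP; right.
by have := HT inp a; rewrite mulSn; lia.
Qed.

Lemma Cost_ext A B `{Enc A} `{Enc B} (f g : input R -> A -> B) T :
  (forall inp a, f inp a = g inp a) -> Cost f T -> Cost g T.
Proof.
by move=> fg [c [K Hc]]; exists c, K => inp a; rewrite -fg.
Qed.

(* All components of a straight-line expression share one cost function, since
   constant factors are absorbed. *)
Section Closure.
Context {A : Type} `{EA : Enc A} (T : input R -> A -> nat).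

Lemma Cost_id : Cost (fun _ (a : A) => a) T.
Proof.
exists Skip, 1 => inp a; apply: (runs_le (@runs_skip R inp (enc a))); lia.
Qed.

Lemma Cost_comp B C `{Enc B} `{Enc C} (g : input R -> B -> C) (f : input R -> A -> B) Tg :
  Cost g Tg -> Cost f T -> (exists K, forall inp a, Tg inp (f inp a) <= K * (T inp a).+1) ->
  Cost (fun i x => g i (f i x)) T.
Proof.
move=> [c1 [K1 H1]] [c2 [K2 H2]] [K HK]; exists (Seq c2 c1), (K1 * K.+1 + K2) => inp a.
apply: (runs_le (runs_seq (H2 inp a) (H1 inp (f inp a)))).
have : K1 * (Tg inp (f inp a)).+1 <= K1 * (K.+1 * (T inp a).+1).
  rewrite leq_mul2l; apply/orP; right; have := HK inp a; lia.
rewrite mulnDl -mulnA; lia.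
Qed.

Lemma Cost_pair B C `{Enc B} `{Enc C} (f : input R -> A -> B) (g : input R -> A -> C) :
  Cost f T -> Cost g T -> Cost (fun i x => (f i x, g i x)) T.
Proof.
move=> [c1 [K1 H1]] [c2 [K2 H2]]; exists (pair_cmd c1 c2), (K1 + K2 + 50) => inp a.
apply: (runs_le (runs_pair (H1 inp a) (H2 inp a))); lia.
Qed.

Lemma Cost_if B `{Enc B} (c : input R -> A -> bool) (f g : input R -> A -> B) :
  Cost c T -> Cost f T -> Cost g T -> Cost (fun i x => if c i x then f i x else g i x) T.
Proof.
move=> [c0 [K0 H0]] [c1 [K1 H1]] [c2 [K2 H2]].
exists (if_cmd c0 c1 c2), (K0 + K1 + K2 + 50) => inp a.
have H3 : runs inp (if c inp a then c1 else c2) (enc a)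
    (enc (if c inp a then f inp a else g inp a)) ((K1 + K2) * (T inp a).+1).
  case: (c inp a); first by apply: (runs_le (H1 inp a)); lia.
  by apply: (runs_le (H2 inp a)); lia.
apply: (runs_le (runs_if (H0 inp a) H3)); lia.
Qed.

End Closure.

Lemma Cost_prim_acc A B `{Enc A} `{Enc B} (f : input R -> A -> B) e T :
  (forall inp a st, holds st (enc a) ->
     rep (iarr st) (rarr st) (ivar st 1) (enc (f inp a)) (ieval inp st e)) ->
  Cost f T.
Proof.
move=> H1; exists (ISet 0 e), (icost e).+1 => inp a.
apply: (runs_le (runs_acc (H1 inp a))); lia.
Qed.

Lemma Cost_prim_nat A `{Enc A} (f : input R -> A -> nat) e T :
  (forall inp a st, holds st (enc a) -> ieval inp st e = f inp a) -> Cost f T.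
Proof.
move=> H1; exists (alloc_nat e), (icost e + 8) => inp a.
apply: (runs_le (runs_alloc_nat (H1 inp a))); lia.
Qed.

Lemma Cost_prim_real A `{Enc A} (f : input R -> A -> R) e T :
  (forall inp a st, holds st (enc a) -> reval inp st e = f inp a) -> Cost f T.
Proof.
move=> H1; exists (alloc_real e), (rcost e + 8) => inp a.
apply: (runs_le (runs_alloc_real (H1 inp a))); lia.
Qed.

Lemma Cost_prim_bool A `{Enc A} (f : input R -> A -> bool) e T :
  (forall inp a st, holds st (enc a) -> beval inp st e = f inp a) -> Cost f T.
Proof.
move=> H1; exists (If e (alloc_nat (IConst 1)) (alloc_nat (IConst 0))), (bcost e + 20) => inp a.
move=> S st hv h1 h2.
have H3 : runs inp (if f inp a then alloc_nat (IConst 1) else alloc_nat (IConst 0))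
    (enc a) (enc (f inp a)) 9.
  by case: (f inp a); apply: (@runs_alloc_nat _ inp (IConst _)).
have [||t' [st' [a1 a2 a3 a4 a5]]] := H3 S st hv; try lia.
exists (bcost e + t').+1, st'; split=> //; try lia.
by apply: ExecIf; rewrite (H1 inp a).
Qed.

End Enc.

(** * Costs of expressions, case distinctions and while loops *)

Section Expressions.
Variable R : realType.
Local Notation Enc := (Enc R).
Local Notation Cost := (@Cost R _ _ _ _).

(** The machine sees encodings only. Booleans are obtained from numbers in this way, and the
    constructors of options, lists and trees from tagged pairs. *)
Lemma Cost_recode A B C `{Enc A} `{Enc B} `{Enc C} (f : input R -> A -> B)
    (g : input R -> A -> C) T :
  (forall inp a, enc (f inp a) = enc (g inp a) :> value R) -> Cost f T -> Cost g T.
Proof. by move=> fg [c [K Hc]]; exists c, K => inp a; rewrite -fg. Qed.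

Section Fixed.
Context {A : Type} `{EA : Enc A} (T : input R -> A -> nat).

Lemma Cost_app B C `{Enc B} `{Enc C} (g : input R -> B -> C) (f : input R -> A -> B) :
  Cost g (fun _ _ => 0) -> Cost f T -> Cost (fun i x => g i (f i x)) T.
Proof. by move=> Hg Hf; apply: Cost_comp Hg Hf _; exists 0. Qed.

Lemma Cost_fst B C `{Enc B} `{Enc C} (f : input R -> A -> B * C) :
  Cost f T -> Cost (fun i x => (f i x).1) T.
Proof.
apply: (@Cost_app _ _ _ _ (fun _ p => p.1)).
by apply: (@Cost_prim_acc _ _ _ _ _ _ (IGet 1 (IVar 0))) => inp a st [_ []].
Qed.

Lemma Cost_snd B C `{Enc B} `{Enc C} (f : input R -> A -> B * C) :
  Cost f T -> Cost (fun i x => (f i x).2) T.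
Proof.
apply: (@Cost_app _ _ _ _ (fun _ p => p.2)).
by apply: (@Cost_prim_acc _ _ _ _ _ _ (IGet 2 (IVar 0))) => inp a st [_ []].
Qed.

Let arg i := IGet 0 (IGet i (IVar 0)).
Let rarg i := RGet 2 (IGet i (IVar 0)).

Lemma Cost_const_nat (n : nat) : Cost (fun _ (_ : A) => n) T.
Proof. by apply: (@Cost_prim_nat _ _ _ _ (IConst n)). Qed.

Lemma Cost_true : Cost (fun _ (_ : A) => true) T.
Proof. by apply: Cost_recode (Cost_const_nat 1). Qed.

Lemma Cost_false : Cost (fun _ (_ : A) => false) T.
Proof. by apply: Cost_recode (Cost_const_nat 0). Qed.

Lemma Cost_tt : Cost (fun _ (_ : A) => tt) T.
Proof. by apply: Cost_recode (Cost_const_nat 0). Qed.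

Lemma Cost_const_real (n : nat) : Cost (fun _ (_ : A) => n%:R%R : R) T.
Proof. by apply: (@Cost_prim_real _ _ _ _ (RConst n)). Qed.

Lemma Cost_real0 : Cost (fun _ (_ : A) => 0%R : R) T.
Proof. exact: (Cost_const_real 0). Qed.

Lemma Cost_real1 : Cost (fun _ (_ : A) => 1%R : R) T.
Proof. exact: (Cost_const_real 1). Qed.

Section Nat.
Variables f g : input R -> A -> nat.
Hypotheses (Hf : Cost f T) (Hg : Cost g T).
Let Hfg := Cost_pair Hf Hg.

Lemma Cost_addn : Cost (fun i x => f i x + g i x) T.
Proof.
apply: (Cost_app (g := fun _ p => p.1 + p.2)) Hfg.
by apply: (@Cost_prim_nat _ _ _ _ (IAdd (arg 1) (arg 2))) => inp p st [_ [[_ /= ->] [_ ->]]].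
Qed.

Lemma Cost_subn : Cost (fun i x => f i x - g i x) T.
Proof.
apply: (Cost_app (g := fun _ p => p.1 - p.2)) Hfg.
by apply: (@Cost_prim_nat _ _ _ _ (ISub (arg 1) (arg 2))) => inp p st [_ [[_ /= ->] [_ ->]]].
Qed.

Lemma Cost_ltn : Cost (fun i x => f i x < g i x) T.
Proof.
apply: (Cost_app (g := fun _ p => p.1 < p.2)) Hfg.
by apply: (@Cost_prim_bool _ _ _ _ (BILt (arg 1) (arg 2))) => inp p st [_ [[_ /= ->] [_ ->]]].
Qed.

Lemma Cost_leq : Cost (fun i x => f i x <= g i x) T.
Proof.
apply: (Cost_app (g := fun _ p => p.1 <= p.2)) Hfg.
apply: (@Cost_prim_bool _ _ _ _ (BNot (BILt (arg 2) (arg 1)))) => inp p st [_ [[_ /= ->] [_ ->]]].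
lia.
Qed.

Lemma Cost_eqn : Cost (fun i x => f i x == g i x) T.
Proof.
apply: (Cost_app (g := fun _ p => p.1 == p.2)) Hfg.
apply: (@Cost_prim_bool _ _ _ _ (BAnd (BNot (BILt (arg 2) (arg 1))) (BNot (BILt (arg 1) (arg 2)))))
  => inp p st [_ [[_ /= ->] [_ ->]]].
lia.
Qed.

Lemma Cost_predn : Cost (fun i x => (f i x).-1) T.
Proof.
apply: (Cost_app (g := fun _ n => n.-1)) Hf.
by apply: (@Cost_prim_nat _ _ _ _ (ISub (IGet 0 (IVar 0)) (IConst 1))) => inp p st [_ /= ->]; lia.
Qed.

Lemma Cost_succn : Cost (fun i x => (f i x).+1) T.
Proof.
apply: (Cost_app (g := fun _ n => n.+1)) Hf.
by apply: (@Cost_prim_nat _ _ _ _ (IAdd (IGet 0 (IVar 0)) (IConst 1))) => inp p st [_ /= ->]; lia.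
Qed.

Lemma Cost_src : Cost (fun i x => in_src i (f i x)) T.
Proof.
apply: (Cost_app (g := fun i => in_src i)) Hf.
by apply: (@Cost_prim_nat _ _ _ _ (InSrc (IGet 0 (IVar 0)))) => inp p st [_ /= ->].
Qed.

Lemma Cost_dst : Cost (fun i x => in_dst i (f i x)) T.
Proof.
apply: (Cost_app (g := fun i => in_dst i)) Hf.
by apply: (@Cost_prim_nat _ _ _ _ (InDst (IGet 0 (IVar 0)))) => inp p st [_ /= ->].
Qed.

Lemma Cost_edges : Cost (fun i (x : A) => in_edges i) T.
Proof. exact: (@Cost_prim_nat _ _ _ _ InEdges). Qed.

Lemma Cost_x : Cost (fun i x => in_x i (f i x)) T.
Proof.
apply: (Cost_app (g := fun i => in_x i)) Hf.
by apply: (@Cost_prim_real _ _ _ _ (InX (IGet 0 (IVar 0)))) => inp p st [_ /= ->].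
Qed.

Lemma Cost_y : Cost (fun i x => in_y i (f i x)) T.
Proof.
apply: (Cost_app (g := fun i => in_y i)) Hf.
by apply: (@Cost_prim_real _ _ _ _ (InY (IGet 0 (IVar 0)))) => inp p st [_ /= ->].
Qed.

End Nat.

Section Real.
Variables f g : input R -> A -> R.
Hypotheses (Hf : Cost f T) (Hg : Cost g T).
Let Hfg := Cost_pair Hf Hg.
Local Open Scope ring_scope.

Lemma Cost_add : Cost (fun i x => f i x + g i x) T.
Proof.
apply: (Cost_app (g := fun _ p => p.1 + p.2)) Hfg.
by apply: (@Cost_prim_real _ _ _ _ (RAdd (rarg 1) (rarg 2))) => inp p st [_ [[_ /= ->] [_ ->]]].
Qed.

Lemma Cost_sub : Cost (fun i x => f i x - g i x) T.
Proof.
apply: (Cost_app (g := fun _ p => p.1 - p.2)) Hfg.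
by apply: (@Cost_prim_real _ _ _ _ (RSub (rarg 1) (rarg 2))) => inp p st [_ [[_ /= ->] [_ ->]]].
Qed.

Lemma Cost_mul : Cost (fun i x => f i x * g i x) T.
Proof.
apply: (Cost_app (g := fun _ p => p.1 * p.2)) Hfg.
by apply: (@Cost_prim_real _ _ _ _ (RMul (rarg 1) (rarg 2))) => inp p st [_ [[_ /= ->] [_ ->]]].
Qed.

Lemma Cost_div : Cost (fun i x => f i x / g i x) T.
Proof.
apply: (Cost_app (g := fun _ p => p.1 / p.2)) Hfg.
by apply: (@Cost_prim_real _ _ _ _ (RDiv (rarg 1) (rarg 2))) => inp p st [_ [[_ /= ->] [_ ->]]].
Qed.

Lemma Cost_lt : Cost (fun i x => f i x < g i x) T.
Proof.
apply: (Cost_app (g := fun _ p => p.1 < p.2)) Hfg.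
by apply: (@Cost_prim_bool _ _ _ _ (BRLt (rarg 1) (rarg 2))) => inp p st [_ [[_ /= ->] [_ ->]]].
Qed.

Lemma Cost_ler : Cost (fun i x => f i x <= g i x) T.
Proof.
apply: (Cost_app (g := fun _ p => p.1 <= p.2)) Hfg.
apply: (@Cost_prim_bool _ _ _ _ (BNot (BRLt (rarg 2) (rarg 1)))) => inp p st [_ [[_ /= ->] [_ ->]]].
by rewrite -leNgt.
Qed.

Lemma Cost_eqr : Cost (fun i x => f i x == g i x) T.
Proof.
apply: (Cost_app (g := fun _ p => p.1 == p.2)) Hfg.
apply: (@Cost_prim_bool _ _ _ _ (BAnd (BNot (BRLt (rarg 2) (rarg 1))) (BNot (BRLt (rarg 1) (rarg 2)))))
  => inp p st [_ [[_ /= ->] [_ ->]]].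
by rewrite -!leNgt -eq_le.
Qed.

Lemma Cost_sqrt : Cost (fun i x => Num.sqrt (f i x)) T.
Proof.
apply: (Cost_app (g := fun _ r => Num.sqrt r)) Hf.
by apply: (@Cost_prim_real _ _ _ _ (RSqrt (RGet 2 (IVar 0)))) => inp p st [_ /= ->].
Qed.

End Real.

Section Bool.
Variables f g : input R -> A -> bool.
Hypotheses (Hf : Cost f T) (Hg : Cost g T).

Lemma Cost_negb : Cost (fun i x => ~~ f i x) T.
Proof. exact: Cost_if Hf Cost_false Cost_true. Qed.

Lemma Cost_andb : Cost (fun i x => f i x && g i x) T.
Proof. exact: Cost_if Hf Hg Cost_false. Qed.

Lemma Cost_orb : Cost (fun i x => f i x || g i x) T.
Proof. exact: Cost_if Hf Cost_true Hg. Qed.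

End Bool.

(** Case analysis for every type encoded as a tag 0 or 1 followed by the arguments; [view]
    decomposes it into a sum. Options, lists and trees are instances. *)
Lemma Cost_sum B C1 C2 D `{Enc B} `{Enc C1} `{Enc C2} `{Enc D} (view : B -> C1 + C2)
    (f : input R -> A -> B) (g : input R -> A -> C1 -> D) (h : input R -> A -> C2 -> D) :
  (forall b, enc b = match view b with
                     | inl c => VP (VN R 0) (enc c) | inr c => VP (VN R 1) (enc c) end) ->
  Cost f T -> Cost (fun i p => g i p.1 p.2) (fun i (p : A * C1) => T i p.1) ->
  Cost (fun i p => h i p.1 p.2) (fun i (p : A * C2) => T i p.1) ->
  Cost (fun i x => match view (f i x) with inl c => g i x c | inr c => h i x c end) T.
Proof.
move=> Hv [c [K Hc]] [c1 [K1 H1']] [c2 [K2 H2']].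
(* The value to be analysed is paired with [a], giving (a, (tag, c)). Here [tag] reads the tag and
   [proj] rearranges the rest to (a, c), the argument of the branches. *)
pose tag := alloc_nat (IGet 0 (IGet 1 (IGet 2 (IVar 0)))).
pose proj := pair_cmd (ISet 0 (IGet 1 (IVar 0))) (ISet 0 (IGet 2 (IGet 2 (IVar 0)))).
exists (Seq (pair_cmd Skip c) (if_cmd tag (Seq proj c2) (Seq proj c1))), (K + K1 + K2 + 300) => inp a.
have Htag b y : runs inp tag (VP (enc a) (VP (VN R b) y)) (VN R b) 20.
  apply: runs_le; first apply: runs_alloc_nat => /= st; last by [].
  by case=> _ [_ [_ [[_ ->] _]]].
have Hproj b y : runs inp proj (VP (enc a) (VP (VN R b) y)) (VP (enc a) y) 60.
  apply: runs_le; first apply: runs_pair.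
  - by apply: runs_acc => st [_ [? _]].
  - by apply: runs_acc => st [_ [_ [_ [_ ?]]]].
  - by [].
have H3 := runs_pair (@runs_skip _ inp (enc a)) (Hc inp a).
rewrite Hv in H3.
case E : (view (f inp a)) H3 => [y|y] H3.
- have Hb := runs_seq (Hproj 0 _) (H1' inp (a, y) : runs inp c1 (VP (enc a) (enc y)) _ _).
  have Hi := @runs_if _ inp tag (Seq proj c2) (Seq proj c1) _ _ false _ _ (Htag 0 _) Hb.
  apply: (runs_le (runs_seq H3 Hi)).
  rewrite /=; lia.
- have Hb := runs_seq (Hproj 1 _) (H2' inp (a, y) : runs inp c2 (VP (enc a) (enc y)) _ _).
  have Hi := @runs_if _ inp tag (Seq proj c2) (Seq proj c1) _ _ true _ _ (Htag 1 _) Hb.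
  apply: (runs_le (runs_seq H3 Hi)).
  rewrite /=; lia.
Qed.

End Fixed.

Section Cases.
Context {A : Type} `{EA : Enc A} (T : input R -> A -> nat).

Lemma Cost_option B D `{Enc B} `{Enc D} (f : input R -> A -> option B)
    (g : input R -> A -> B -> D) (h : input R -> A -> D) :
  Cost f T -> Cost (fun i p => g i p.1 p.2) (fun i (p : A * B) => T i p.1) -> Cost h T ->
  Cost (fun i x => match f i x with Some y => g i x y | None => h i x end) T.
Proof.
move=> Hf Hg Hh.
apply: (Cost_ext (f := fun i x => match (if f i x is Some y then inr y else inl tt) with
   inl u => (fun i x _ => h i x) i x u | inr y => g i x y end)).
  by move=> i x; case: (f i x).
apply: (Cost_sum (view := fun o : option B => if o is Some y then inr y else inl tt) (f := f)
  (g := fun i x _ => h i x) (h := g)) => //; first by case.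
apply: (Cost_comp (g := h)) Hh _ _; last by exists 1 => inp a; lia.
by apply: Cost_fst; apply: Cost_id.
Qed.

Lemma Cost_seq B D `{Enc B} `{Enc D} (f : input R -> A -> seq B)
    (g : input R -> A -> B -> seq B -> D) (h : input R -> A -> D) :
  Cost f T -> Cost (fun i p => g i p.1 p.2.1 p.2.2) (fun i (p : A * (B * seq B)) => T i p.1) ->
  Cost h T ->
  Cost (fun i x => match f i x with y :: s => g i x y s | [::] => h i x end) T.
Proof.
move=> Hf Hg Hh.
apply: (Cost_ext (f := fun i x => match (if f i x is y :: s then inr (y, s) else inl tt) with
   inl u => (fun i x _ => h i x) i x u | inr y => g i x y.1 y.2 end)).
  by move=> i x; case: (f i x).
apply: (Cost_sum (view := fun o : seq B => if o is y :: s then inr (y, s) else inl tt) (f := f)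
  (g := fun i x _ => h i x) (h := fun i x p => g i x p.1 p.2)) => //; first by case.
apply: (Cost_comp (g := h)) Hh _ _; last by exists 1 => inp a; lia.
by apply: Cost_fst; apply: Cost_id.
Qed.

Lemma Cost_Some B `{Enc B} (f : input R -> A -> B) : Cost f T -> Cost (fun i x => Some (f i x)) T.
Proof.
move=> Hf; apply: (Cost_recode (f := fun i x => (1, f i x))) => //.
exact: Cost_pair (Cost_const_nat _ _) Hf.
Qed.

Lemma Cost_None B `{Enc B} : Cost (fun _ _ => None : option B) T.
Proof.
apply: (Cost_recode (f := fun i x => (0, 0))) => //.
exact: Cost_pair (Cost_const_nat _ _) (Cost_const_nat _ _).
Qed.

Lemma Cost_cons B `{Enc B} (f : input R -> A -> B) (g : input R -> A -> seq B) :
  Cost f T -> Cost g T -> Cost (fun i x => f i x :: g i x) T.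
Proof.
move=> Hf Hg; apply: (Cost_recode (f := fun i x => (1, (f i x, g i x)))) => //.
exact: Cost_pair (Cost_const_nat _ _) (Cost_pair Hf Hg).
Qed.

Lemma Cost_nil B `{Enc B} : Cost (fun _ _ => [::] : seq B) T.
Proof.
apply: (Cost_recode (f := fun i x => (0, 0))) => //.
exact: Cost_pair (Cost_const_nat _ _) (Cost_const_nat _ _).
Qed.

End Cases.

(** [F] is the final state of the loop, characterised by its two equations. The potential [N] drops
    in each round by more than the round costs, which yields termination and total cost together;
    [T <= N] pays for the last test. *)
Lemma Cost_while A `{EA : Enc A} (c : A -> bool) (f : input R -> A -> A) (F : input R -> A -> A) T N :
  Cost (fun=> c) T -> Cost f T ->
  (forall i a, ~~ c a -> F i a = a) -> (forall i a, c a -> F i (f i a) = F i a) ->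
  (forall i a, c a -> N i (f i a) + T i a < N i a) ->
  (forall i a, T i a <= N i a) -> Cost F N.
Proof.
move=> [p [K1 H1]] [q [K2 H2]] F0 F1 N1 N0.
exists (while_cmd p q), (K1 + K2 + 50) => inp a.
suff [n Hn] : exists n, iter_while n inp p q (EA a) (EA (F inp a)) ((K1 + K2 + 50) * (N inp a).+1).
  exact: runs_while Hn.
have [k] := ubnP (N inp a); elim: k a => // k IH a ak.
have Hp := H1 inp a; have Hq := H2 inp a.
have [ca|ca] := boolP (c a); rewrite ?ca ?(negbTE ca) in Hp.
  have Nlt := N1 inp a ca.
  have [|n Hn] := IH (f inp a); first lia.
  rewrite F1 // in Hn.
  exists n.+1, (K1 * (T inp a).+1), (EA (f inp a)), (K2 * (T inp a).+1).
  exists ((K1 + K2 + 50) * (N inp (f inp a)).+1); split; [exact: Hp | exact: Hq | exact: Hn |].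
  have : (K1 + K2 + 50) * ((N inp (f inp a)).+1 + (T inp a).+1) <= (K1 + K2 + 50) * (N inp a).+1.
    by rewrite leq_mul2l; apply/orP; right; lia.
  nia.
exists 0, (K1 * (T inp a).+1); split; [by rewrite F0 | exact: Hp |].
have := N0 inp a => Hle.
have : K1 * (T inp a).+1 <= K1 * (N inp a).+1 by rewrite leq_mul2l; apply/orP; right.
nia.
Qed.

End Expressions.

#[global] Opaque Cost.

(** A syntax-directed search: the head symbol of the function selects the closure lemma. [cost_user]
    is a hook, redefined whenever new functions have received a cost. *)
Ltac cost_user := fail.
Ltac cost_step := cbv beta zeta; lazymatch goal with
| H : @Cost ?R ?A ?B ?EA ?EB ?f ?T |- @Cost ?R ?A ?B ?EA ?EB ?f ?T => exact H
| |- Cost (fun _ x => x) _ => eapply Cost_id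
| |- Cost (fun i x => (@?f i x, @?g i x)) _ => eapply Cost_pair
| |- Cost (fun i x => (@?f i x).1) _ => eapply Cost_fst
| |- Cost (fun i x => (@?f i x).2) _ => eapply Cost_snd
| |- Cost (fun i x => Some (@?f i x)) _ => eapply Cost_Some
| |- Cost (fun i x => None) _ => eapply Cost_None
| |- Cost (fun i x => @?f i x :: @?g i x) _ => eapply Cost_cons
| |- Cost (fun i x => [::]) _ => eapply Cost_nil
| |- Cost (fun i x => true) _ => eapply Cost_true
| |- Cost (fun i x => false) _ => eapply Cost_false
| |- Cost (fun i x => tt) _ => eapply Cost_tt
| |- Cost (fun i x => addn (@?f i x) (@?g i x)) _ => eapply Cost_addn
| |- Cost (fun i x => subn (@?f i x) (@?g i x)) _ => eapply Cost_subn
| |- Cost (fun i x => (S (@?f i x)) <= (@?g i x)) _ => eapply Cost_ltn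
| |- Cost (fun i x => (@?f i x) <= (@?g i x)) _ => eapply Cost_leq
| |- Cost (fun i x => (@?f i x : nat) == (@?g i x)) _ => first [eapply Cost_eqn | eapply Cost_eqr]
| |- Cost (fun i x => ((@?f i x) < (@?g i x))%R) _ => eapply Cost_lt
| |- Cost (fun i x => ((@?f i x) <= (@?g i x))%R) _ => eapply Cost_ler
| |- Cost (fun i x => ((@?f i x) - (@?g i x))%R) _ => eapply Cost_sub
| |- Cost (fun i x => ((@?f i x) + (@?g i x))%R) _ => eapply Cost_add
| |- Cost (fun i x => ((@?f i x) / (@?g i x))%R) _ => eapply Cost_div
| |- Cost (fun i x => ((@?f i x) * (@?g i x))%R) _ => eapply Cost_mul
| |- Cost (fun i x => Num.sqrt (@?f i x)) _ => eapply Cost_sqrt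
| |- Cost (fun i x => 0%R) _ => eapply Cost_real0
| |- Cost (fun i x => 1%R) _ => eapply Cost_real1
| |- Cost (fun i x => ~~ (@?f i x)) _ => eapply Cost_negb
| |- Cost (fun i x => (@?f i x) && (@?g i x)) _ => eapply Cost_andb
| |- Cost (fun i x => (@?f i x) || (@?g i x)) _ => eapply Cost_orb
| |- Cost (fun i x => predn (@?f i x)) _ => eapply Cost_predn
| |- Cost (fun i x => in_src i (@?f i x)) _ => eapply Cost_src
| |- Cost (fun i x => in_dst i (@?f i x)) _ => eapply Cost_dst
| |- Cost (fun i x => in_x i (@?f i x)) _ => eapply Cost_x
| |- Cost (fun i x => in_y i (@?f i x)) _ => eapply Cost_y
| |- Cost (fun i x => in_edges i) _ => eapply Cost_edges
| |- Cost (fun i x => S (@?f i x)) _ => first [eapply Cost_const_nat | eapply Cost_succn]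
| |- Cost (fun i x => O) _ => eapply Cost_const_nat
| |- _ => first [eassumption | cost_user | eapply Cost_if | eapply Cost_option | eapply Cost_seq]
end.
Ltac cost := repeat cost_step.

(** * Iteration and folds over lists *)

Section Loops.
Variable R : realType.
Local Notation Enc := (Enc R).
Local Notation Cost := (@Cost R _ _ _ _).

Fixpoint iter_cost A (T : A -> nat) (f : A -> A) n a :=
  if n is n'.+1 then T a + (iter_cost T f n' (f a)).+1 else T a.

Fixpoint foldl_cost B X (T : B -> nat) (f : B -> X -> B) b s :=
  if s is x :: s' then T b + (foldl_cost T f (f b x) s').+1 else T b.

Lemma Cost_iter A `{EA : Enc A} (f : input R -> A -> A) T : Cost f T ->
  Cost (fun i (p : nat * A) => iter p.1 (f i) p.2) (fun i p => iter_cost (T i) (f i) p.1 p.2).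
Proof.
move=> Hf.
apply: (Cost_snd (f := fun i p => (0, iter p.1 (f i) p.2))).
apply: (Cost_while (c := fun p => 0 < p.1) (f := fun i p => (p.1.-1, f i p.2)) (T := fun i p => T i p.2)).
- by cost.
- apply: Cost_pair; first by cost.
  apply: (Cost_comp (g := f) (f := fun _ p => p.2) Hf); first by cost.
  by exists 1 => i p; lia.
- by move=> i [[|n] a].
- by move=> i [[|n] a] //= _; rewrite -iterSr.
- move=> i [[|n] a] //= _; lia.
- move=> i [[|n] a] //=; lia.
Qed.

Lemma Cost_foldl B X `{EB : Enc B} `{EX : Enc X} (f : input R -> B -> X -> B) T :
  Cost (fun i p => f i p.1 p.2) (fun i (p : B * X) => T i p.1) ->
  Cost (fun i (p : B * seq X) => foldl (f i) p.1 p.2) (fun i p => foldl_cost (T i) (f i) p.1 p.2).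
Proof.
move=> Hf.
apply: (Cost_fst (f := fun i p => (foldl (f i) p.1 p.2, [::]))).
apply: (Cost_while (c := fun p : B * seq X => if p.2 is _ :: _ then true else false)
  (f := fun i p => if p.2 is x :: s then (f i p.1 x, s) else p) (T := fun i p => T i p.1)).
- by cost.
- cost.
  apply: (Cost_comp (f := fun _ (p : (B * seq X) * (X * seq X)) => (p.1.1, p.2.1)) Hf); first by cost.
  by exists 1 => i p /=; lia.
- by move=> i [b [|x s]].
- by move=> i [b [|x s]].
- move=> i [b [|x s]] //= _; lia.
- move=> i [b [|x s]] //=; lia.
Qed.

End Loops.

(** * Balanced trees *)

(* A leaf-oriented AVL tree; a leaf holding None is the place of a deleted
   element. Nodes carry the height and a summary of the elements below. *)
Inductive tree (E M : Type) :=
| Leaf of option E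
| Node of nat & M & tree E M & tree E M.
Arguments Leaf {E M}.
Arguments Node {E M}.

Section Tree.
Variables E M : Type.
Implicit Types (t l r : tree E M) (o : option E).

Definition height t := if t is Node h _ _ _ then h else 0.
(** [height] reads the stored field in constant time. [depth] is the true depth, by which costs can
    be stated for trees that satisfy no invariant. *)
Fixpoint depth t := if t is Node _ _ l r then (maxn (depth l) (depth r)).+1 else 0.
Fixpoint leaves t := if t is Node _ _ l r then leaves l + leaves r else 1.
Definition oseq o : seq E := if o is Some e then [:: e] else [::].
Fixpoint elems t := if t is Node _ _ l r then elems l ++ elems r else if t is Leaf o then oseq o else [::].

Fixpoint avl t := if t is Node h _ l r then
  [&& avl l, avl r, h == (maxn (height l) (height r)).+1,
      height l <= (height r).+1 & height r <= (height l).+1] else true.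

Lemma avl_depth t : avl t -> depth t = height t.
Proof.
elim: t => //= h m l IHl r IHr /and5P[al ar /eqP-> _ _].
by rewrite IHl ?IHr.
Qed.

Lemma leaves_gt0 t : 0 < leaves t. Proof. elim: t => //= *; lia. Qed.

(** The square avoids the golden ratio. If the heights differ by one and z is 2 to the smaller one,
    the leaf counts satisfy a^2 >= 2 z and b^2 >= z up to order, hence a b >= z and (a + b)^2 >= 5
    z, where 4 z is needed. *)
Lemma avl_leaves t : avl t -> 2 ^ height t <= leaves t ^ 2.
Proof.
elim: t => //= h m l IHl r IHr /and5P[al ar /eqP-> h1 h2].
have := IHl al; have := IHr ar; rewrite -!mulnn.
move: (leaves_gt0 l) (leaves_gt0 r) h1 h2.
move: (height l) (height r) (leaves l) (leaves r) => x y a b a0 b0 h1 h2 hb ha.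
have h3 : (x == y) || (x == y.+1) || (y == x.+1) by lia.
case/orP: h3 => [/orP[]|] /eqP e; subst.
- rewrite maxnn expnS; nia.
- rewrite (maxn_idPl (leqnSn _)) !expnS in ha *; move: ha hb; set z := 2 ^ y => ha hb.
  have : z <= a * b by nia.
  nia.
- rewrite (maxn_idPr (leqnSn _)) !expnS in hb *; move: ha hb; set z := 2 ^ x => ha hb.
  have : z <= a * b by nia.
  nia.
Qed.

Variables (lm : option E -> M) (mul : M -> M -> M) (lst : M -> option E).

Definition aug t := match t with Leaf o => lm o | Node _ m _ _ => m end.
Definition node l r := Node (maxn (height l) (height r)).+1 (mul (aug l) (aug r)) l r.

(** The usual single and double rotations. The cases with a [Leaf] do not arise for the heights at
    which [bal] calls these functions. *)
Definition balr l r :=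
  match l with
  | Node _ _ ll lr =>
      if height lr <= height ll then node ll (node lr r)
      else match lr with
           | Node _ _ lrl lrr => node (node ll lrl) (node lrr r)
           | Leaf _ => node l r end
  | Leaf _ => node l r end.
Definition ball l r :=
  match r with
  | Node _ _ rl rr =>
      if height rl <= height rr then node (node l rl) rr
      else match rl with
           | Node _ _ rll rlr => node (node l rll) (node rlr rr)
           | Leaf _ => node l r end
  | Leaf _ => node l r end.
Definition bal l r :=
  if (height r).+1 < height l then balr l r
  else if (height l).+1 < height r then ball l r else node l r.

(** The last clause covers the case without rotation. It is needed in [upd_avl] to see that an
    update does not lower a node that stays in balance. *)
Lemma bal_avl l r : avl l -> avl r -> height l <= (height r).+2 -> height r <= (height l).+2 ->
  [/\ avl (bal l r), maxn (height l) (height r) <= height (bal l r) <= (maxn (height l) (height r)).+1 &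
     height l <= (height r).+1 -> height r <= (height l).+1 ->
     height (bal l r) = (maxn (height l) (height r)).+1].
Proof.
rewrite /bal /balr /ball => al ar h1 h2.
case: ifP => c1.
  case: l al h1 h2 c1 => //= h m ll lr /and5P[all alr /eqP eh d1 d2] h1 h2 c1.
  case: ifP => c2.
    rewrite /= all alr ar /=; split; lia.
  case: lr alr eh d1 d2 c2 => [o|h' m' lrl lrr] /=; first by lia.
  move=> /and5P[a1 a2 /eqP eh' d3 d4] eh d1 d2 c2.
  rewrite all ar a1 a2 /=; split; lia.
case: ifP => c2.
  case: r ar h1 h2 c1 c2 => //= h m rl rr /and5P[arl arr /eqP eh d1 d2] h1 h2 c1 c2.
  case: ifP => c3.
    rewrite /= al arl arr /=; split; lia.
  case: rl arl eh d1 d2 c3 => [o|h' m' rll rlr] /=; first by lia.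
  move=> /and5P[a1 a2 /eqP eh' d3 d4] eh d1 d2 c3.
  rewrite al arr a1 a2 /=; split; lia.
rewrite /= al ar /=; split; lia.
Qed.

Lemma bal_elems l r : elems (bal l r) = elems l ++ elems r.
Proof.
rewrite /bal /balr /ball; case: ifP => _.
  case: l => //= h m ll lr; case: ifP => _; first by rewrite /= catA.
  by case: lr => //= h' m' lrl lrr; rewrite !catA.
case: ifP => _ //.
case: r => //= h m rl rr; case: ifP => _; first by rewrite /= catA.
by case: rl => //= h' m' rll rlr; rewrite !catA.
Qed.

Lemma bal_leaves l r : leaves (bal l r) = leaves l + leaves r.
Proof.
rewrite /bal /balr /ball; case: ifP => _.
  case: l => //= h m ll lr; case: ifP => _ /=; first by rewrite addnA.
  by case: lr => //= h' m' lrl lrr; lia.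
case: ifP => _ //.
case: r => //= h m rl rr; case: ifP => _ /=; first by rewrite addnA.
by case: rl => //= h' m' rll rlr; lia.
Qed.

Lemma bal_depth l r : depth (bal l r) <= (maxn (depth l) (depth r)).+2.
Proof.
rewrite /bal /balr /ball; case: ifP => _.
  case: l => [o|h m ll lr] /=; first by lia.
  case: ifP => _ /=; first by lia.
  by case: lr => [o|h' m' lrl lrr] /=; lia.
case: ifP => _ /=; last by lia.
case: r => [o|h m rl rr] /=; first by lia.
case: ifP => _ /=; first by lia.
by case: rl => [o|h' m' rll rlr] /=; lia.
Qed.

(** [spec] is a homomorphism from sequences to summaries. It lets the search read the last element
    of a subtree off its root, and that element decides the direction. *)
Variable spec : seq E -> M.
Hypothesis spec_lm : forall o, lm o = spec (oseq o).
Hypothesis spec_mul : forall s1 s2, mul (spec s1) (spec s2) = spec (s1 ++ s2).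
Hypothesis spec_lst0 : lst (spec [::]) = None.
Hypothesis spec_lst : forall s e, lst (spec (rcons s e)) = Some e.

Fixpoint augok t := if t is Node _ m l r then [/\ m = spec (elems l ++ elems r), augok l & augok r] else True.

Lemma augE t : augok t -> aug t = spec (elems t).
Proof. by case: t => [o _|h m l r [->]] //=; exact: spec_lm. Qed.

Lemma node_augok l r : augok l -> augok r -> augok (node l r).
Proof. by move=> al ar; split=> //; rewrite !augE // spec_mul. Qed.

Lemma bal_augok l r : augok l -> augok r -> augok (bal l r).
Proof.
move=> al ar; rewrite /bal /balr /ball; case: ifP => _.
  case: l al => [o|h m ll lr] al; first exact: node_augok.
  have [_ all alr] := al.
  case: ifP => _; first by apply: node_augok => //; apply: node_augok.
  case: lr al alr => [o|h' m' lrl lrr] al; first by move=> _; exact: node_augok.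
  by case=> _ a1 a2; apply: node_augok; apply: node_augok.
case: ifP => _; last exact: node_augok.
case: r ar => [o|h m rl rr] ar; first exact: node_augok.
have [_ arl arr] := ar.
case: ifP => _; first by apply: node_augok => //; apply: node_augok.
case: rl ar arl => [o|h' m' rll rlr] ar; first by move=> _; exact: node_augok.
by case=> _ a1 a2; apply: node_augok; apply: node_augok.
Qed.

(** [B q] marks the elements to the left of the place sought. [act] gives the new content of the
    leaf found there and, optionally, the content of a new leaf to its right; insertion, deletion
    and replacement are all of this form. *)
Variables (Q : Type) (B : Q -> E -> bool) (act : Q -> option E -> option E * option (option E)).

Definition goleft q l := if lst (aug l) is Some e then ~~ B q e else false.
Definition grow (p : option E * option (option E)) :=
  if p.2 is Some o then node (Leaf p.1) (Leaf o) else Leaf p.1.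
Definition actseq q o : seq E := oseq (act q o).1 ++ (if (act q o).2 is Some o' then oseq o' else [::]).

Fixpoint upd q t :=
  match t with
  | Leaf o => grow (act q o)
  | Node _ _ l r => if goleft q l then bal (upd q l) r else bal l (upd q r)
  end.

(** Deletion empties a leaf without removing it, so heights never drop and one update disturbs the
    balance of a node by at most one. *)
Lemma upd_avl q t : avl t -> avl (upd q t) /\ height t <= height (upd q t) <= (height t).+1.
Proof.
elim: t => [o _|h m l IHl r IHr] /=.
  by rewrite /grow; case: (act q o) => a [b|].
case/and5P=> al ar /eqP-> h1 h2.
have [{}IHl bl] := IHl al; have [{}IHr br] := IHr ar.
case: ifP => _.
  by have [||b1 b2 b3] := bal_avl IHl ar; try lia; split=> //; lia.
by have [||b1 b2 b3] := bal_avl al IHr; try lia; split=> //; lia.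
Qed.

Lemma upd_leaves q t : leaves (upd q t) <= (leaves t).+1.
Proof.
elim: t => [o|h m l IHl r IHr] /=.
  by rewrite /grow; case: (act q o) => a [b|].
by case: ifP => _; rewrite bal_leaves; lia.
Qed.

(** [bal] adds at most 2 levels where a plain node adds 1, hence the factor 2. Needing no invariant,
    this bounds the cost of a second update in terms of the tree before the first. *)
Lemma upd_depth q t : depth (upd q t) <= (depth t).*2.+1.
Proof.
elim: t => [o|h m l IHl r IHr] /=.
  by rewrite /grow; case: (act q o) => a [b|].
by case: ifP => _; apply: leq_trans (bal_depth _ _) _; lia.
Qed.

Lemma upd_augok q t : augok t -> augok (upd q t).
Proof.
elim: t => [o _|h m l IHl r IHr [_ al ar]] /=.
  rewrite /grow; case: (act q o) => a [b|] //=; split=> //.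
  by rewrite !spec_lm spec_mul.
by case: ifP => _; apply: bal_augok; auto.
Qed.

Lemma goleftP q l (l1 l2 : seq E) : augok l -> elems l = l1 ++ l2 -> all (B q) l1 -> all (predC (B q)) l2 ->
  goleft q l = ~~ nilp l2.
Proof.
move=> al el b1 b2; rewrite /goleft augE // el.
case/lastP: l2 b2 {el} => [|l2 e] b2.
  rewrite cats0; case/lastP: l1 b1 => [|l1 e]; first by rewrite spec_lst0.
  by rewrite spec_lst all_rcons => /andP[->].
rewrite -rcons_cat spec_lst.
by move: b2; rewrite all_rcons => /andP[/= -> _]; case: l2.
Qed.

(* The update acts on a leaf at the boundary between the elements satisfying
   [B q] and the others; on the first of the others, if there is one. *)
Lemma upd_elems q t (l1 l2 : seq E) : augok t -> elems t = l1 ++ l2 ->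
  all (B q) l1 -> all (predC (B q)) l2 ->
  exists x o, elems (upd q t) = x ++ actseq q o ++ behead l2 /\
    if l2 is e :: _ then o = Some e /\ x = l1 else l1 = x ++ oseq o.
Proof.
elim: t l1 l2 => [o|h m l IHl r IHr] l1 l2 /=.
  move=> _ el b1 b2; exists [::], o.
  have -> : elems (grow (act q o)) = actseq q o.
    by rewrite /grow /actseq; case: (act q o) => a [b|] //=; rewrite cats0.
  case: l2 el {b2} => [|e l2] el; first by rewrite !cats0 in el *.
  by case: o l1 el {b1} => [a|] [|? [|? l1]] //= [-> <-]; rewrite cats0.
case=> _ al ar el b1 b2.
have [le|le] := leqP (size (elems l)) (size l1).
  have e1 : elems l = take (size (elems l)) l1.
    by have := congr1 (take (size (elems l))) el; rewrite take_size_cat // takel_cat.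
  have e2 : elems r = drop (size (elems l)) l1 ++ l2.
    have := congr1 (drop (size (elems l))) el; rewrite drop_size_cat // => ->.
    rewrite drop_cat; case: ltnP => // le2.
    have -> : size (elems l) = size l1 by lia.
    by rewrite subnn drop0 drop_size.
  have b3 := b1; rewrite -(cat_take_drop (size (elems l)) l1) all_cat in b3.
  case/andP: b3 => b3 b4.
  have gl : goleft q l = false.
    by rewrite (@goleftP q l _ [::] al _ b3) // cats0.
  have [x [o [h1 h2]]] := IHr _ _ ar e2 b4 b2.
  exists (elems l ++ x), o; rewrite gl bal_elems h1 !catA; split=> //.
  case: l2 {el b2 e2 h1} h2 => [|e l2'] h2.
    by rewrite -catA -h2 {1}e1 cat_take_drop.
  by case: h2 => -> ->; rewrite {1}e1 cat_take_drop.
have e1 : elems l = l1 ++ take (size (elems l) - size l1) l2.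
  have := congr1 (take (size (elems l))) el; rewrite take_size_cat // => {1}->.
  by rewrite take_cat ltnNge ltnW.
have e2 : elems r = drop (size (elems l) - size l1) l2.
  have := congr1 (drop (size (elems l))) el; rewrite drop_size_cat // => {1}->.
  by rewrite drop_cat ltnNge ltnW.
have b3 := b2; rewrite -(cat_take_drop (size (elems l) - size l1) l2) all_cat in b3.
case/andP: b3 => b3 b4.
have gl : goleft q l.
  rewrite (@goleftP q l _ _ al e1) //; move: e1 le; case: (take _ _) => // ->.
  by rewrite cats0 ltnn.
have [x [o [h1 h2]]] := IHl _ _ al e1 b1 b3.
exists x, o; rewrite gl bal_elems h1 e2.
move: e1 le h1 h2 {b2 b3 b4 el e2}; case: l2 => [|e l2] e1 le; first by rewrite e1 cats0 ltnn in le.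
have : 0 < size (elems l) - size l1 by lia.
case: (size (elems l) - size l1) => // k _ h1 h2; split=> //=.
by rewrite -!catA cat_take_drop.
Qed.

(** If all elements satisfy [B q], the search ends at the last leaf: the new element fills it, or
    goes behind its content. Otherwise it goes in front of the first element that fails [B q]. *)
Lemma upd_insert q e t (l1 l2 : seq E) : augok t -> elems t = l1 ++ l2 ->
  all (B q) l1 -> all (predC (B q)) l2 ->
  (forall o, act q o = if o is Some a then
      if B q a then (Some a, Some (Some e)) else (Some e, Some (Some a)) else (Some e, None)) ->
  elems (upd q t) = l1 ++ e :: l2.
Proof.
move=> ok el b1 b2 ha; have [x [o [-> h]]] := upd_elems ok el b1 b2.
rewrite /actseq ha; case: l2 {el} b2 h => [|a l2] b2 h.
  case: o h => [a|] h; last by rewrite h /= cats0.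
  by move: b1; rewrite h all_cat /= => /and3P[_ -> _]; rewrite /= -catA.
by case: h b2 => -> -> /= /andP[/negbTE -> _].
Qed.

Lemma upd_delete q e t (l1 l2 : seq E) : augok t -> elems t = l1 ++ e :: l2 ->
  all (B q) l1 -> all (predC (B q)) (e :: l2) -> (forall o, act q o = (None, None)) ->
  elems (upd q t) = l1 ++ l2.
Proof.
move=> ok el b1 b2 ha; have [x [o [-> [_ ->]]]] := upd_elems ok el b1 b2.
by rewrite /actseq ha.
Qed.

Lemma upd_replace q e e' t (l1 l2 : seq E) : augok t -> elems t = l1 ++ e :: l2 ->
  all (B q) l1 -> all (predC (B q)) (e :: l2) -> act q (Some e) = (Some e', None) ->
  elems (upd q t) = l1 ++ e' :: l2.
Proof.
move=> ok el b1 b2 ha; have [x [o [-> [-> ->]]]] := upd_elems ok el b1 b2.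
by rewrite /actseq ha.
Qed.

(** The recursion of [upd] as two loops: a descent that records the siblings passed, and a fold that
    rebuilds the tree along them. *)
Fixpoint down q t ctx :=
  match t with
  | Leaf o => (o, ctx)
  | Node _ _ l r => if goleft q l then down q l ((true, r) :: ctx) else down q r ((false, l) :: ctx)
  end.
Definition fill t (f : bool * tree E M) := if f.1 then bal t f.2 else bal f.2 t.

Lemma updE q t : upd q t = foldl fill (grow (act q (down q t [::]).1)) (down q t [::]).2.
Proof.
rewrite -[LHS]/(foldl fill (upd q t) [::]).
elim: t [::] => //= h m l IHl r IHr ctx.
by case: ifP => _; rewrite -?IHl -?IHr.
Qed.

Lemma size_down q t ctx : size (down q t ctx).2 <= depth t + size ctx.
Proof.
elim: t ctx => //= h m l IHl r IHr ctx; case: ifP => _.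
  by apply: leq_trans (IHl _) _ => /=; lia.
by apply: leq_trans (IHr _) _ => /=; lia.
Qed.

Definition find q t := (down q t [::]).1.

Lemma down_find q t (l1 : seq E) e (l2 : seq E) ctx : augok t -> elems t = l1 ++ e :: l2 ->
  all (B q) l1 -> all (predC (B q)) (e :: l2) -> (down q t ctx).1 = Some e.
Proof.
elim: t l1 l2 ctx => [o|h m l IHl r IHr] l1 l2 ctx /=.
  by move=> _; case: o l1 => [a|] [|? [|? l1]] //= [->].
case=> _ al ar el b1 b2.
have [le|le] := leqP (size (elems l)) (size l1).
  have e1 : elems l = take (size (elems l)) l1.
    by have := congr1 (take (size (elems l))) el; rewrite take_size_cat // takel_cat.
  have e2 : elems r = drop (size (elems l)) l1 ++ e :: l2.
    have := congr1 (drop (size (elems l))) el; rewrite drop_size_cat // => ->.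
    rewrite drop_cat; case: ltnP => // le2.
    have -> : size (elems l) = size l1 by lia.
    by rewrite subnn drop0 drop_size.
  have b3 := b1; rewrite -(cat_take_drop (size (elems l)) l1) all_cat in b3.
  case/andP: b3 => b3 b4.
  have -> : goleft q l = false.
    by rewrite (@goleftP q l _ [::] al _ b3) // cats0.
  exact: IHr ar e2 b4 b2.
have : 0 < size (elems l) - size l1 by lia.
have e1 : elems l = l1 ++ take (size (elems l) - size l1) (e :: l2).
  have := congr1 (take (size (elems l))) el; rewrite take_size_cat // => {1}->.
  by rewrite take_cat ltnNge ltnW.
have b3 : all (predC (B q)) (take (size (elems l) - size l1) (e :: l2)).
  pose s := e :: l2; pose k := size (elems l) - size l1.
  have b4 : all (predC (B q)) (take k s ++ drop k s) by rewrite cat_take_drop.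
  by move: b4; rewrite all_cat => /andP[].
move: e1 b3; case: (size (elems l) - size l1) => //= k e1 b3 _.
rewrite (@goleftP q l _ _ al e1) //=.
exact: IHl al e1 b1 b3.
Qed.

End Tree.

(** * Costs of operations on trees *)

Section TreeCost.
Variable R : realType.
Local Notation Enc := (Enc R).
Local Notation Cost := (@Cost R _ _ _ _).

Lemma Cost_app2 A B C D `{Enc A} `{Enc B} `{Enc C} `{Enc D} (h : B -> C -> D) T
    (f : input R -> A -> B) (g : input R -> A -> C) :
  Cost (fun _ p => h p.1 p.2) (fun _ _ => 0) -> Cost f T -> Cost g T ->
  Cost (fun i x => h (f i x) (g i x)) T.
Proof.
move=> Hh Hf Hg.
exact: (Cost_app (g := fun _ p => h p.1 p.2) (f := fun i x => (f i x, g i x)) Hh (Cost_pair Hf Hg)).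
Qed.

Section Enc.
Context {E M : Type} `{EE : Enc E} `{EM : Enc M}.

#[global] Instance Enc_tree : Enc (tree E M) :=
  fix e t := match t with
             | Leaf o => VP (VN R 0) (enc o)
             | Node h m l r => VP (VN R 1) (VP (VN R h) (VP (enc m) (VP (e l) (e r))))
             end.

Context {A : Type} `{EA : Enc A} (T : input R -> A -> nat).

Lemma Cost_Leaf (f : input R -> A -> option E) : Cost f T -> Cost (fun i x => Leaf (f i x) : tree E M) T.
Proof.
move=> Hf; apply: (Cost_recode (f := fun i x => (0, f i x))) => //.
by cost.
Qed.

Lemma Cost_Node (f : input R -> A -> nat) (g : input R -> A -> M) (h k : input R -> A -> tree E M) :
  Cost f T -> Cost g T -> Cost h T -> Cost k T ->
  Cost (fun i x => Node (f i x) (g i x) (h i x) (k i x)) T.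
Proof.
move=> Hf Hg Hh Hk; apply: (Cost_recode (f := fun i x => (1, (f i x, (g i x, (h i x, k i x)))))) => //.
by cost.
Qed.

Lemma Cost_tree D `{Enc D} (f : input R -> A -> tree E M) (g : input R -> A -> option E -> D)
   (h : input R -> A -> nat -> M -> tree E M -> tree E M -> D) :
  Cost f T -> Cost (fun i p => g i p.1 p.2) (fun i (p : A * option E) => T i p.1) ->
  Cost (fun i p => h i p.1 p.2.1 p.2.2.1 p.2.2.2.1 p.2.2.2.2)
    (fun i (p : A * (nat * (M * (tree E M * tree E M)))) => T i p.1) ->
  Cost (fun i x => match f i x with Leaf o => g i x o | Node a m l r => h i x a m l r end) T.
Proof.
move=> Hf Hg Hh.
apply: (Cost_ext (f := fun i x => match (match f i x with Leaf o => inl o | Node a m l r => inr (a, (m, (l, r))) end)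
   with inl o => g i x o | inr p => h i x p.1 p.2.1 p.2.2.1 p.2.2.2 end)).
  by move=> i x; case: (f i x).
apply: (Cost_sum (view := fun t : tree E M => match t with Leaf o => inl o | Node a m l r => inr (a, (m, (l, r))) end)
  (f := f) (g := g) (h := fun i x p => h i x p.1 p.2.1 p.2.2.1 p.2.2.2)) => //; first by case.
Qed.

End Enc.

Ltac cost_user ::= first [eapply Cost_Leaf | eapply Cost_Node | eapply Cost_tree].

Section Height.
Context {E M : Type} `{EE : Enc E} `{EM : Enc M}.
Context {A : Type} `{EA : Enc A} (T : input R -> A -> nat).

Lemma Cost_height (f : input R -> A -> tree E M) : Cost f T -> Cost (fun i x => height (f i x)) T.
Proof. by move=> Hf; rewrite /height; cost. Qed.

Lemma Cost_maxn (f g : input R -> A -> nat) : Cost f T -> Cost g T -> Cost (fun i x => maxn (f i x) (g i x)) T.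
Proof. by move=> Hf Hg; rewrite /maxn; cost. Qed.
End Height.

Section Ops.
Context {E M Q : Type} `{EE : Enc E} `{EM : Enc M} `{EQ : Enc Q}.
Variables (lm : option E -> M) (mul : M -> M -> M) (lst : M -> option E).
Variables (B : Q -> E -> bool) (act : Q -> option E -> option E * option (option E)).
Let zero {X : Type} : input R -> X -> nat := fun _ _ => 0.
Hypothesis H_lm : Cost (fun=> lm) zero.
Hypothesis H_mul : Cost (fun _ p => mul p.1 p.2) zero.
Hypothesis H_lst : Cost (fun=> lst) zero.
Hypothesis H_B : Cost (fun _ p => B p.1 p.2) zero.
Hypothesis H_act : Cost (fun _ p => act p.1 p.2) zero.

Ltac cost_user ::= first [
    eapply Cost_height | eapply Cost_maxn
  | eapply (Cost_app (g := fun=> lm)); [exact H_lm|]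
  | eapply (Cost_app (g := fun=> lst)); [exact H_lst|]
  | eapply (Cost_app2 (h := mul)); [exact H_mul| |]
  | eapply (Cost_app2 (h := B)); [exact H_B| |]
  | eapply (Cost_app2 (h := act)); [exact H_act| |]
  | eapply Cost_Leaf | eapply Cost_Node | eapply Cost_tree].

Section Closed.
Context {A : Type} `{EA : Enc A} (T : input R -> A -> nat).
Variables (f g : input R -> A -> tree E M).
Hypotheses (Hf : Cost f T) (Hg : Cost g T).

Lemma Cost_node : Cost (fun i x => node lm mul (f i x) (g i x)) T.
Proof. by rewrite /node /aug; cost. Qed.
End Closed.

Section Closed2.
Context {A : Type} `{EA : Enc A} (T : input R -> A -> nat).
Variables (f g : input R -> A -> tree E M).
Hypotheses (Hf : Cost f T) (Hg : Cost g T).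

Lemma Cost_bal : Cost (fun i x => bal lm mul (f i x) (g i x)) T.
Proof.
apply: (Cost_app2 (h := bal lm mul)) Hf Hg.
rewrite /bal /balr /ball.
by do 20?[cost; try eapply Cost_node].
Qed.
End Closed2.

Local Notation down := (down lm lst B).
Local Notation upd := (upd lm mul lst B act).

Ltac cost_user ::= first [
    eapply Cost_bal | eapply Cost_node | eapply Cost_height | eapply Cost_maxn
  | eapply (Cost_app (g := fun=> lm)); [exact H_lm|]
  | eapply (Cost_app (g := fun=> lst)); [exact H_lst|]
  | eapply (Cost_app2 (h := mul)); [exact H_mul| |]
  | eapply (Cost_app2 (h := B)); [exact H_B| |]
  | eapply (Cost_app2 (h := act)); [exact H_act| |]
  | eapply Cost_Leaf | eapply Cost_Node | eapply Cost_tree].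

Lemma Cost_down : Cost (fun _ p => down p.1 p.2 [::]) (fun _ (p : Q * tree E M) => depth p.2).
Proof.
(* A loop ends in a state of the same type as it starts in, so the content found is kept wrapped in
   a [Leaf]. *)
pose F (s : Q * (tree E M * seq (bool * tree E M))) :=
  (s.1, (Leaf (down s.1 s.2.1 s.2.2).1 : tree E M, (down s.1 s.2.1 s.2.2).2)).
have HF : Cost (fun=> F) (fun _ s => depth s.2.1).
  apply: (Cost_while (c := fun s => if s.2.1 is Node _ _ _ _ then true else false)
    (f := fun _ s => match s.2.1 with
      | Leaf _ => s
      | Node _ _ l r => if goleft lm lst B s.1 l then (s.1, (l, (true, r) :: s.2.2))
                        else (s.1, (r, (false, l) :: s.2.2)) end)
    (T := fun _ _ => 0)).
  - by cost.
  - by rewrite /goleft /aug; cost.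
  - by move=> i [q [[o|h m l r] ctx]].
  - by move=> i [q [[o|h m l r] ctx]] //= _; rewrite /F /=; case: ifP.
  - by move=> i [q [[o|h m l r] ctx]] //= _; case: ifP => _ /=; lia.
  - by [].
apply: (Cost_ext (f := fun i p => (match (F (p.1, (p.2, [::]))).2.1 with
   | Leaf o => o | Node _ _ _ _ => None end, (F (p.1, (p.2, [::]))).2.2))).
  by move=> i [q t]; rewrite /F /=; case: (down q t [::]).
have H0 : Cost (fun _ (p : Q * tree E M) => F (p.1, (p.2, [::]))) (fun _ p => depth p.2).
  apply: (Cost_comp (g := fun=> F) (f := fun _ (p : Q * tree E M) => (p.1, (p.2, [::]))) HF); first by cost.
  by exists 1 => i p /=; lia.
by cost.
Qed.

Lemma foldl_cost0 X Y (f : X -> Y -> X) b s : foldl_cost (fun=> 0) f b s = size s.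
Proof. by elim: s b => //= x s IH b; rewrite IH. Qed.

Lemma Cost_upd : Cost (fun _ p => upd p.1 p.2) (fun _ (p : Q * tree E M) => depth p.2).
Proof.
apply: (Cost_ext (f := fun i p => foldl (fill lm mul) (grow lm mul (act p.1 (down p.1 p.2 [::]).1))
  (down p.1 p.2 [::]).2)).
  by move=> i p; rewrite updE.
have Hd := Cost_down.
have Hf : Cost (fun _ (p : tree E M * seq (bool * tree E M)) => foldl (fill lm mul) p.1 p.2)
   (fun _ p => size p.2).
  apply: (Cost_ext (f := fun _ p => foldl (fill lm mul) p.1 p.2)) => //.
  apply: (Cost_le (C := 1) _ (Cost_foldl (f := fun=> fill lm mul) (T := fun _ _ => 0) _)).
    by move=> i p; rewrite foldl_cost0; lia.
  by rewrite /fill; cost.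
apply: (Cost_comp (f := fun _ (p : Q * tree E M) => (_, _)) Hf).
  apply: Cost_pair; last by cost.
  apply: (Cost_app (g := fun=> grow lm mul)); first by rewrite /grow; cost.
  by cost.
exists 1 => i [q t] /=; have := size_down lm lst B q t [::] => /=; lia.
Qed.

Lemma Cost_find : Cost (fun _ p => find lm lst B p.1 p.2) (fun _ (p : Q * tree E M) => depth p.2).
Proof. by have Hd := Cost_down; rewrite /find; cost. Qed.

End Ops.

(** A loop takes subtrees from a stack, the rightmost first, and prepends their elements to the
    output. The potential counts nodes, 2 leaves - 1 per tree, so the bound holds however unbalanced
    the tree is. *)
Lemma Cost_elems E M `{EE : Enc E} `{EM : Enc M} :
  Cost (fun=> @elems E M) (fun _ t => leaves t).
Proof.
pose F (s : seq (tree E M) * seq E) := ([::] : seq (tree E M), foldl (fun o t => elems t ++ o) s.2 s.1).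
have HF : Cost (fun=> F) (fun _ s => sumn [seq (leaves t).*2.-1 | t <- s.1]).
  apply: (Cost_while (c := fun s => if s.1 is _ :: _ then true else false)
    (f := fun _ s => match s.1 with
      | [::] => s
      | t :: st => match t with
          | Leaf o => (st, if o is Some e then e :: s.2 else s.2)
          | Node _ _ l r => (r :: l :: st, s.2) end end)
    (T := fun _ _ => 0)).
  - by cost.
  - by do 10?[cost; try eapply Cost_tree].
  - by move=> i [[|t st] out].
  - by move=> i [[|[[e|]|h m l r] st] out] //= _; rewrite /F /= catA.
  - move=> i [[|[[e|]|h m l r] st] out] //= _; try lia.
    by have := leaves_gt0 l; have := leaves_gt0 r; lia.
  - by [].
have H0 : Cost (fun _ (t : tree E M) => F ([:: t], [::])) (fun _ t => leaves t).
  apply: (Cost_comp (g := fun=> F) (f := fun _ (t : tree E M) => ([:: t], [::])) HF); first by cost.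
  by exists 2 => i t /=; lia.
apply: (Cost_ext (f := fun i t => (F ([:: t], [::])).2)); last by cost.
by move=> i t; rewrite /F /= cats0.
Qed.

End TreeCost.

Lemma avl_depth_le E M (t : tree E M) : avl t -> depth t <= (trunc_log 2 (leaves t)).*2.+1.
Proof.
move=> at_; rewrite avl_depth // -ltnS -(ltn_exp2l _ _ (isT : 1 < 2)).
apply: leq_ltn_trans (avl_leaves at_) _.
have := trunc_log_ltn (leaves t) (isT : 1 < 2) => h.
have -> : 2 ^ (trunc_log 2 (leaves t)).*2.+2 = (2 ^ (trunc_log 2 (leaves t)).+1) ^ 2.
  by rewrite -expnM muln2 doubleS.
by rewrite ltn_exp2r.
Qed.

(** The successor matches the leaf count: n insertions into one empty leaf give at most n + 1
    leaves. *)
Definition lg n := trunc_log 2 n.+1.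

Section UpdFold.
Variables (E M Q : Type).
Variables (lm : option E -> M) (mul : M -> M -> M) (lst : M -> option E).
Variables (B : Q -> E -> bool) (act : Q -> option E -> option E * option (option E)).
Local Notation upd := (upd lm mul lst B act).

Lemma foldl_upd_avl t s : avl t ->
  avl (foldl (fun t q => upd q t) t s) /\ leaves (foldl (fun t q => upd q t) t s) <= leaves t + size s.
Proof.
elim: s t => [|q s IH] t at_ /=; first by split=> //; lia.
have [a1 a2] := upd_avl lm mul lst B act q at_.
have [b1 b2] := IH _ a1; split=> //.
by apply: leq_trans b2 _; have := upd_leaves lm mul lst B act q t; lia.
Qed.

Lemma avl_depth_lg (t : tree E M) n : avl t -> leaves t <= n.+1 -> depth t <= (lg n).*2.+1.
Proof.
move=> at_ h; apply: leq_trans (avl_depth_le at_) _.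
by rewrite ltnS leq_double /lg; apply: leq_trunc_log.
Qed.

Lemma foldl_upd_cost t s n : avl t -> leaves t + size s <= n.+1 ->
  foldl_cost (@depth E M) (fun t q => upd q t) t s <= (size s).+1 * (lg n).*2.+2.
Proof.
elim: s t => [|q s IH] t at_ /= h.
  by have := avl_depth_lg (n := n) at_; lia.
have [a1 a2] := upd_avl lm mul lst B act q at_.
have := IH _ a1; have := upd_leaves lm mul lst B act q t; have := avl_depth_lg (n := n) at_.
by move=> h1 h2 h3; rewrite mulSn; lia.
Qed.

End UpdFold.

(** * Sorting by insertion into a balanced tree *)

Section LastSummary.
Variable E : Type.
Definition mulL (a b : option E) := if b is Some e then Some e else a.
Definition specL (s : seq E) : option E := foldl (fun _ e => Some e) None s.
Lemma specL_rcons s e : specL (rcons s e) = Some e.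
Proof. by rewrite /specL foldl_rcons. Qed.
Lemma specL_lm o : id o = specL (oseq o). Proof. by case: o. Qed.
Lemma specL_mul s1 s2 : mulL (specL s1) (specL s2) = specL (s1 ++ s2).
Proof.
case/lastP: s2 => [|s2 e]; first by rewrite cats0.
by rewrite -rcons_cat !specL_rcons.
Qed.
End LastSummary.

Definition act_insert (E : Type) (B : bool) (e : E) (o : option E) : option E * option (option E) :=
  if o is Some a then if B then (Some a, Some (Some e)) else (Some e, Some (Some a)) else (Some e, None).

Section Sort.
Variables (E : eqType) (lt : rel E).
Definition sortB (q e : E) := ~~ lt q e.
Definition sort_act q (o : option E) := act_insert (if o is Some a then sortB q a else false) q o.
Definition sort_upd := upd (id : option E -> option E) (@mulL E) id sortB sort_act.
Definition sort_tree (s : seq E) := foldl (fun t q => sort_upd q t) (Leaf None) s.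
Definition tsort s := elems (sort_tree s).

Hypothesis le_total : forall x y, ~~ lt y x || ~~ lt x y.
Hypothesis le_trans : transitive (fun x y => ~~ lt y x).
Local Notation le := (fun x y => ~~ lt y x).

Lemma sorted_split q s : sorted le s ->
  exists s1 s2, [/\ s = s1 ++ s2, all (sortB q) s1 & all (predC (sortB q)) s2].
Proof.
move=> so; exists (filter (sortB q) s), (filter (predC (sortB q)) s); split; rewrite ?filter_all //.
elim: s so => //= a s IH pa; rewrite {}[in LHS]IH ?(path_sorted pa) //.
case: ifP => //= na; have /allP al := order_path_min le_trans pa.
suff -> : [seq x <- s | sortB q x] = [::] by [].
apply/eqP; rewrite -(negbK (_ == _)) -has_filter; apply/hasPn => x xs.
have : le a x := al x xs.
by apply: contraL => qx; apply/negP => h; move: na (le_trans h qx); rewrite /sortB => ->.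
Qed.

Lemma sort_tree_ok s : augok (@specL E) (sort_tree s) /\
  sorted le (tsort s) /\ perm_eq (tsort s) s.
Proof.
rewrite /tsort /sort_tree; elim/last_ind: s => [//|s q [IH1 [IH2 IH3]]].
rewrite foldl_rcons; move: (foldl _ _ _) IH1 IH2 IH3 => t IH1 IH2 IH3.
split; first by apply: upd_augok IH1; [exact: specL_lm | exact: specL_mul].
have [s1 [s2 [e h1 h2]]] := sorted_split q IH2.
have -> : elems (sort_upd q t) = s1 ++ q :: s2.
  by apply: (@upd_insert _ _ _ _ _ (@specL E)) IH1 e h1 h2 _; [exact: specL_lm | | exact: specL_rcons | case].
split; last by rewrite perm_catC /= perm_sym perm_rcons perm_cons perm_sym perm_catC -e.
rewrite e in IH2; have le_refl x : le x x by have := le_total x x; rewrite orbb.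
have [h3 h4] : sorted le s1 /\ sorted le s2.
  by move: IH2; rewrite (sorted_pairwise le_trans) pairwise_cat !(sorted_pairwise le_trans) => /and3P[].
rewrite (sorted_pairwise le_trans) pairwise_cat /= -!(sorted_pairwise le_trans) h3 h4 !andbT.
have h5 : all (le q) s2.
  by apply: sub_all h2 => x /= ; rewrite negbK => lt_qx; have := le_total q x; rewrite lt_qx orbF.
rewrite h5 andbT allrel_consr h1 /= ?andbT.
by move: IH2; rewrite (sorted_pairwise le_trans) pairwise_cat => /and3P[].
Qed.

End Sort.

Section SortCost.
Variable R : realType.
Local Notation Enc := (Enc R).
Local Notation Cost := (@Cost R _ _ _ _).

Lemma Cost_mulL E A `{EE : Enc E} `{EA : Enc A} (f g : input R -> A -> option E) T :
  Cost f T -> Cost g T -> Cost (fun i x => mulL (f i x) (g i x)) T.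
Proof. by move=> Hf Hg; rewrite /mulL; cost. Qed.

Lemma Cost_act_insert E A `{EE : Enc E} `{EA : Enc A} (c : input R -> A -> bool)
   (f : input R -> A -> E) (g : input R -> A -> option E) T :
  Cost c T -> Cost f T -> Cost g T -> Cost (fun i x => act_insert (c i x) (f i x) (g i x)) T.
Proof.
move=> Hc Hf Hg; apply: (Cost_app2 (h := fun c p => act_insert c p.1 p.2) (g := fun i x => (f i x, g i x))) => //.
  by rewrite /act_insert; cost.
by cost.
Qed.

Section Fold.
Context {E M Q : Type} `{EE : Enc E} `{EM : Enc M} `{EQ : Enc Q}.
Variables (lm : option E -> M) (mul : M -> M -> M) (lst : M -> option E).
Variables (B : Q -> E -> bool) (act : Q -> option E -> option E * option (option E)).
Let zero {X : Type} : input R -> X -> nat := fun _ _ => 0.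
Hypothesis H_lm : Cost (fun=> lm) zero.
Hypothesis H_mul : Cost (fun _ p => mul p.1 p.2) zero.
Hypothesis H_lst : Cost (fun=> lst) zero.
Hypothesis H_B : Cost (fun _ p => B p.1 p.2) zero.
Hypothesis H_act : Cost (fun _ p => act p.1 p.2) zero.
Local Notation upd := (upd lm mul lst B act).

Lemma Cost_foldl_upd : Cost (fun _ p => foldl (fun t q => upd q t) p.1 p.2)
  (fun _ (p : tree E M * seq Q) => foldl_cost (@depth E M) (fun t q => upd q t) p.1 p.2).
Proof.
apply: (Cost_foldl (f := fun=> fun t q => upd q t) (T := fun=> @depth E M)).
apply: (Cost_comp (f := fun _ (p : tree E M * Q) => (p.2, p.1)) (Cost_upd H_lm H_mul H_lst H_B H_act)).
  by cost.
by exists 1 => i p /=; lia.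
Qed.
End Fold.

Lemma Cost_tsort (E : eqType) `{EE : Enc E} (lt : rel E) :
  Cost (fun _ p => lt p.1 p.2) (fun _ _ => 0) ->
  Cost (fun=> tsort lt) (fun _ s => (size s).+1 * (lg (size s)).+1).
Proof.
move=> Hlt.
have HB : Cost (fun _ p => sortB lt p.1 p.2) (fun _ _ => 0).
  by rewrite /sortB; cost.
have H : Cost (fun _ (s : seq E) => sort_tree lt s) (fun _ s => (size s).+1 * (lg (size s)).+1).
  have HA : Cost (fun _ p => sort_act lt p.1 p.2) (fun _ _ => 0).
    rewrite /sort_act; apply: Cost_act_insert; cost.
    by eapply (Cost_app2 (h := lt)); [exact: Hlt | |]; cost.
  have Hid : Cost (fun _ (o : option E) => o) (fun _ _ => 0) by cost.
  have Hmul : Cost (fun _ p => @mulL E p.1 p.2) (fun _ _ => 0) by apply: Cost_mulL; cost.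
  have Hu := Cost_foldl_upd Hid Hmul Hid HB HA.
  apply: (Cost_ext (f := fun _ s => foldl (fun t q => sort_upd lt q t) (Leaf None) s)) => //.
  apply: (Cost_comp (f := fun _ (s : seq E) => (Leaf None : tree E (option E), s)) Hu).
  - apply: Cost_pair; last by cost.
    by eapply Cost_Leaf; cost.
  - exists 2 => i s /=.
    have := @foldl_upd_cost E (option E) E (id : option E -> option E) (@mulL E) id (sortB lt) (sort_act lt)
      (Leaf None) s (size s) isT; rewrite add1n => /(_ (leqnn _)) h.
    apply: leq_trans h _; nia.
rewrite /tsort.
apply: (Cost_comp (f := fun=> sort_tree lt) (@Cost_elems R E (option E) _ _) H).
exists 2 => i s.
have [_] := @foldl_upd_avl E (option E) E (id : option E -> option E) (@mulL E) id (sortB lt) (sort_act lt)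
      (Leaf None) s isT; rewrite /= => h.
apply: leq_trans h _; nia.
Qed.
End SortCost.

(** * The sweep *)

Section Geometry.
Variable R : realType.
Local Open Scope ring_scope.

Notation pt := (R * R)%type.
Notation seg := (nat * (pt * pt))%type.
Notation query := (pt * (bool * seg))%type.
Notation event := (pt * (seg * seg))%type.

(* The sweep line is vertical, tilted by an infinitesimal amount. *)
Definition lexlt (p q : pt) : bool := (p.1 < q.1) || ((p.1 == q.1) && (p.2 < q.2)).

Lemma lexlt_trans p q r : lexlt p q -> lexlt q r -> lexlt p r.
Proof.
rewrite /lexlt => /orP[h|/andP[/eqP h h']] /orP[k|/andP[/eqP k k']]; apply/orP.
- left; lra.
- left; lra.
- left; lra.
- by right; apply/andP; split; [apply/eqP|]; lra.
Qed.

Lemma lexltNge p q : ~~ lexlt p q = lexlt q p || (q == p).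
Proof.
case: p q => [a b] [c d]; rewrite /lexlt /= xpair_eqE.
by case: (ltgtP a c) => //= _; case: (ltgtP b d).
Qed.

Lemma lexlt_irr p : lexlt p p = false.
Proof. by rewrite /lexlt !ltxx andbF. Qed.

Lemma lexle_trans p q r : ~~ lexlt p q -> ~~ lexlt q r -> ~~ lexlt p r.
Proof.
rewrite !lexltNge => /orP[h|/eqP->//] /orP[k|/eqP->]; last by rewrite h.
by rewrite (lexlt_trans k h).
Qed.

Definition segdx (s : seg) := s.2.2.1 - s.2.1.1.
Definition segdy (s : seg) := s.2.2.2 - s.2.1.2.
Definition segdet (a b : seg) := segdx a * segdy b - segdy a * segdx b.
(* The position on a of its intersection with the line of b. *)
Definition tau (a b : seg) :=
  ((b.2.1.1 - a.2.1.1) * segdy b - (b.2.1.2 - a.2.1.2) * segdx b) / segdet a b.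
Definition xing (a b : seg) : bool :=
  [&& segdet a b != 0, 0 < tau a b, tau a b < 1, 0 < tau b a & tau b a < 1].
Definition xpt (a b : seg) : pt :=
  (a.2.1.1 + tau a b * segdx a, a.2.1.2 + tau a b * segdy a).

Definition lft (s : seg) : pt := if lexlt s.2.1 s.2.2 then s.2.1 else s.2.2.
Definition rgt (s : seg) : pt := if lexlt s.2.1 s.2.2 then s.2.2 else s.2.1.
(** Orientation determinants of segments directed from left to right: [odet a b] is positive if b is
    steeper than a, and [side s p] if p lies above the line of s. *)
Definition odet (a b : seg) :=
  ((rgt a).1 - (lft a).1) * ((rgt b).2 - (lft b).2) - ((rgt a).2 - (lft a).2) * ((rgt b).1 - (lft b).1).
Definition side (s : seg) (p : pt) :=
  ((rgt s).1 - (lft s).1) * (p.2 - (lft s).2) - ((rgt s).2 - (lft s).2) * (p.1 - (lft s).1).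

(* The intersection of a and b, if a is below b to its left. *)
Definition cand (a b : seg) : option event :=
  if (odet a b < 0) && xing a b then Some (xpt a b, (a, b)) else None.

Definition minc (o1 o2 : option event) : option event :=
  if o1 is Some x then if o2 is Some y then if lexlt y.1 x.1 then Some y else Some x
  else Some x else o2.

(** Ties go to the left argument. Associativity makes the summary depend on the sequence alone and
    not on the shape of the tree. *)
Lemma mincA : associative minc.
Proof.
move=> [x|] [y|] [z|] //=.
- case zy: (lexlt z.1 y.1); case yx: (lexlt y.1 x.1); rewrite /= ?zy ?yx //=.
    by rewrite (lexlt_trans zy yx).
  by rewrite (negbTE (lexle_trans (negbT zy) (negbT yx))).
- by case: ifP.
Qed.

(* First and last element, and the first intersection of consecutive elements. *)
Notation summary := (option ((seg * seg) * option event))%type.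
Definition slm (o : option seg) : summary := if o is Some s then Some ((s, s), None) else None.
Definition smul (m1 m2 : summary) : summary :=
  if m1 is Some x then if m2 is Some y then
    Some ((x.1.1, y.1.2), minc (minc x.2 (cand x.1.2 y.1.1)) y.2)
  else m1 else m2.
Definition slst (m : summary) : option seg := if m is Some x then Some x.1.2 else None.
Definition sbest (m : summary) : option event := if m is Some x then x.2 else None.

Fixpoint bestc (a : seg) (l : seq seg) : option event :=
  if l is b :: l' then minc (cand a b) (bestc b l') else None.
Definition sspec (l : seq seg) : summary :=
  if l is a :: l' then Some ((a, last a l'), bestc a l') else None.

Lemma slm_spec o : slm o = sspec (oseq o). Proof. by case: o. Qed.
Lemma smul_spec s1 s2 : smul (sspec s1) (sspec s2) = sspec (s1 ++ s2).
Proof.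
case: s1 => //= a s1; case: s2 => [|b s2] /=; first by rewrite cats0.
rewrite last_cat /=; congr (Some (_, _)).
elim: s1 a => [|c s1 IH] a //=.
by rewrite -IH !mincA.
Qed.
Lemma slst0 : slst (sspec [::]) = None. Proof. by []. Qed.
Lemma slst_spec s e : slst (sspec (rcons s e)) = Some e.
Proof. by case: s => //= a s; rewrite last_rcons. Qed.

Lemma bestc_Some a l e : bestc a l = Some e ->
  exists l1 u v l2, [/\ a :: l = l1 ++ u :: v :: l2, cand u v = Some e & e = (xpt u v, (u, v))].
Proof.
elim: l a => //= b l IH a.
case E : (cand a b) => [x|] /=; last first.
  by move=> /IH[l1 [u [v [l2 [-> h1 h2]]]]]; exists (a :: l1), u, v, l2.
case E' : (bestc b l) => [y|].
  case: ifP => _ [ee]; subst e.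
    by have [l1 [u [v [l2 [-> h1 h2]]]]] := IH _ E'; exists (a :: l1), u, v, l2.
  by exists [::], a, b, l; split=> //; move: E; rewrite /cand; case: ifP => // _ [].
by move=> [ee]; subst e; exists [::], a, b, l; split=> //; move: E; rewrite /cand; case: ifP => // _ [].
Qed.

Lemma bestc_min a l l1 u v l2 e : a :: l = l1 ++ u :: v :: l2 -> cand u v = Some e ->
  exists2 e', bestc a l = Some e' & ~~ lexlt e.1 e'.1.
Proof.
elim: l1 a l => [|c l1 IH] a l /= [-> ->] h.
  rewrite /= h; case: (bestc v l2) => [y|] /=; last by exists e; rewrite ?lexlt_irr.
  case: ifPn => [h'|_]; last by exists e; rewrite ?lexlt_irr.
  by exists y => //; rewrite lexltNge h'.
case: l1 IH => [|d l1] IH /=; have [e' + h1] := IH _ _ erefl h => /= ->.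
  case: (cand c u) => [x|] /=; last by exists e'.
  case: ifPn => h2; first by exists e'.
  by exists x => //; exact: lexle_trans h1 h2.
case: (cand c d) => [x|] /=; last by exists e'.
case: ifPn => h2; first by exists e'.
by exists x => //; exact: lexle_trans h1 h2.
Qed.

(* The query (p, (true, s)) inserts s into the status, just above the segments
   that pass below p or leave p below s; (p, (false, s)) deletes the lowest
   segment that neither passes below p nor enters p below s. *)
Definition qB (q : query) (x : seg) : bool :=
  (0 < side x q.1) || ((side x q.1 == 0) && (if q.2.1 then 0 < odet x q.2.2 else odet x q.2.2 < 0)).
Definition qact (q : query) (o : option seg) : option seg * option (option seg) :=
  if q.2.1 then act_insert (if o is Some a then qB q a else false) q.2.2 o else (None, None).
Definition supd := upd slm smul slst qB qact.

(** At a common point, ends precede beginnings; thus two segments, one of which ends where the other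
    begins, are never in the status together. *)
Definition qlt (q q' : query) : bool :=
  lexlt q.1 q'.1 || ((q.1 == q'.1) && (~~ q.2.1 && q'.2.1)).
Definition start (s : seg) : query := (lft s, (true, s)).
Definition stop (s : seg) : query := (rgt s, (false, s)).

Notation status := (tree seg summary).
(* The next event is the next entry of the sorted list of end-points or the
   first crossing of two neighbours in the status, which is read off the summary
   at the root. At a crossing, the lower segment is deleted and inserted again. *)
Definition sstep (st : seq query * (status * seq (seg * seg))) :
    seq query * (status * seq (seg * seg)) :=
  if st.1 is q :: rest then
    match sbest (aug slm st.2.1) with
    | Some e =>
        if lexlt e.1 q.1 then
          (st.1, (supd (e.1, (true, e.2.1)) (supd (e.1, (false, e.2.1)) st.2.1), e.2 :: st.2.2))
        else (rest, (supd q st.2.1, st.2.2))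
    | None => (rest, (supd q st.2.1, st.2.2))
    end
  else st.

Definition entries (S : seq seg) : seq query :=
  tsort qlt (foldl (fun es s => start s :: stop s :: es) [::] S).
(** Each segment has two entries, and in the application there are at most as many crossings as
    segments. *)
Definition sweep (S : seq seg) : seq (seg * seg) :=
  (iter (3 * size S) sstep (entries S, (Leaf None, [::]))).2.2.
Definition sym (out : seq (seg * seg)) := out ++ [seq (p.2, p.1) | p <- out].

Lemma qle_total x y : ~~ qlt y x || ~~ qlt x y.
Proof.
rewrite /qlt; case: x y => [p [b s]] [q [b' s']] /=; rewrite -negb_and.
apply/negP => /andP[/orP[h|/andP[/eqP h h']] /orP[k|/andP[/eqP k k']]].
- by have := lexlt_trans h k; rewrite lexlt_irr.
- by rewrite k lexlt_irr in h.
- by rewrite h lexlt_irr in k.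
- by case: b b' h' k' => [] [].
Qed.

Lemma qle_trans : transitive (fun x y => ~~ qlt y x).
Proof.
move=> [q [b s]] [p [b' s']] [r [b'' s'']]; rewrite /qlt /=.
move=> /norP[h1 h2] /norP[h3 h4]; apply/norP; split; first exact: lexle_trans h3 h1.
apply/negP => /and3P[/eqP e h5 h6]; subst r.
move: h1 h3; rewrite !lexltNge => /orP[h1|/eqP h1] /orP[h3|/eqP h3].
- by have := lexlt_trans h1 h3; rewrite lexlt_irr.
- by rewrite h3 lexlt_irr in h1.
- by rewrite h1 lexlt_irr in h3.
- by subst; move: h2 h4 h5 h6; rewrite eqxx /=; case: b b' b'' => [] [] [].
Qed.

End Geometry.

(** * The shear that replaces the lexicographic order *)

Section Shear.
Variable R : realType.
Local Open Scope ring_scope.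
Notation pt := (R * R)%type.

Lemma shear_pairs (s : seq (pt * pt)) : exists2 e : R, 0 < e &
  forall e', 0 < e' <= e -> forall p, p \in s -> lexlt p.1 p.2 ->
    p.1.1 + e' * p.1.2 < p.2.1 + e' * p.2.2.
Proof.
elim: s => [|[p q] s [e e0 IH]]; first by exists 1.
pose d := `|q.2 - p.2| + 1.
have d0 : 0 < d by rewrite /d; have := normr_ge0 (q.2 - p.2); lra.
have key : exists2 e1, 0 < e1 & forall e', 0 < e' <= e1 -> lexlt p q -> p.1 + e' * p.2 < q.1 + e' * q.2.
  have [h|h] := ltP p.1 q.1.
    exists ((q.1 - p.1) / (2 * d)); first by apply: divr_gt0; lra.
    move=> e' /andP[h1 h2] _.
    have : e' * d <= (q.1 - p.1) / 2.
      rewrite ler_pdivlMr in h2; last by lra.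
      by move: h2; rewrite mulrCA; lra.
    have := ler_norm (- (q.2 - p.2)); rewrite normrN => h3 h4.
    have : e' * (p.2 - q.2) <= e' * d by rewrite ler_wpM2l //; rewrite /d; lra.
    lra.
  exists 1 => // e' /andP[h1 h2]; rewrite /lexlt ltNge h /= => /andP[/eqP-> h3].
  by rewrite ltrD2l ltr_pM2l.
case: key => e1 e10 h1; exists (Num.min e e1); first by rewrite lt_min e0.
move=> e' /andP[h2]; rewrite le_min => /andP[h3 h4] r; rewrite inE => /orP[/eqP->|rs].
  by apply: h1; rewrite h2.
by apply: IH; rewrite ?h2.
Qed.

Lemma shear_exists (P : seq pt) : exists2 e : R, 0 < e &
  forall p q, p \in P -> q \in P -> lexlt p q -> p.1 + e * p.2 < q.1 + e * q.2.
Proof.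
have [e e0 H] := shear_pairs [seq (p, q) | p <- P, q <- P].
exists e => // p q pP qP; apply: (H e _ (p, q)); first by rewrite e0 lexx.
by apply/allpairsP; exists (p, q).
Qed.

Lemma gap_above (b : R) (s : seq R) : exists2 c, b < c & forall v, v \in s -> b < v -> c < v.
Proof.
elim: s => [|v s [c bc IH]]; first by exists (b + 1); rewrite ?ltrDl.
have [bv|bv] := ltP b v; last first.
  by exists c => // w; rewrite inE => /orP[/eqP->|/IH//]; rewrite ltNge bv.
exists (Num.min c ((b + v) / 2)); first by rewrite lt_min bc /=; lra.
move=> w; rewrite inE gt_min => /orP[/eqP-> _|ws bw]; apply/orP; first by right; lra.
by left; apply: IH.
Qed.

Lemma seq_min (T : eqType) (f : T -> R) (s : seq T) x : x \in s ->
  exists2 y, y \in s & forall z, z \in s -> f y <= f z.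
Proof.
elim: s x => // a s IH x _.
case: s IH => [_|b s IH]; first by exists a; rewrite ?inE // => z; rewrite inE => /eqP->.
have [y ys h] := IH b (mem_head _ _).
have [ay|ya] := leP (f a) (f y).
  exists a; first exact: mem_head.
  by move=> z; rewrite inE => /orP[/eqP->//|/h h']; apply: le_trans h'.
exists y; first by rewrite inE ys orbT.
by move=> z; rewrite inE => /orP[/eqP->|/h//]; apply: ltW.
Qed.

Lemma split_below (T : Type) (f : T -> R) k (l : seq T) : pairwise (fun x y => f x < f y) l ->
  exists l1 l2, [/\ l = l1 ++ l2, all (fun x => f x < k) l1 & all (fun x => k <= f x) l2].
Proof.
elim: l => [_|a l IH /=]; first by exists [::], [::].
move=> /andP[al /IH[l1 [l2 [e h1 h2]]]].
have [ak|ka] := ltP (f a) k; first by exists (a :: l1), l2; rewrite e /= ak.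
exists [::], (a :: l); split=> //=; rewrite ka /=.
by apply: sub_all al => x h; apply: le_trans ka (ltW h).
Qed.
End Shear.

(** * The invariant of the sweep and its three kinds of events *)

Section Sweep.
Variable R : realType.
Local Open Scope ring_scope.
Notation pt := (R * R)%type.
Notation seg := (nat * (pt * pt))%type.
Notation query := (pt * (bool * seg))%type.

Definition onseg (s : seg) (P : pt) := exists2 t : R, 0 <= t <= 1 & P = along s.2.1 s.2.2 t.

Variable S : seq seg.
Hypothesis S_uniq : uniq S.
Hypothesis S_nondeg : forall s, s \in S -> s.2.1 != s.2.2.
Hypothesis S_meet : forall s t P, s \in S -> t \in S -> s != t -> onseg s P -> onseg t P ->
  (P \in [:: s.2.1; s.2.2] /\ P \in [:: t.2.1; t.2.2]) \/ (xing s t /\ P = xpt s t).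
Hypothesis S_triangle : forall s t u, s \in S -> t \in S -> u \in S ->
  xing s t -> xing t u -> xing s u -> False.

Definition ends_of := [seq s.2.1 | s <- S] ++ [seq s.2.2 | s <- S].
Definition xpts := [seq xpt s t | s <- S, t <- S].

Lemma xing_sym (s t : seg) : xing s t = xing t s.
Proof.
rewrite /xing; have -> : segdet t s = - segdet s t by rewrite /segdet; ring.
by rewrite oppr_eq0; case: (0 < tau s t); case: (tau s t < 1); case: (0 < tau t s); case: (tau t s < 1);
  rewrite ?andbF.
Qed.

Lemma segdetC (s t : seg) : segdet t s = - segdet s t.
Proof. by rewrite /segdet; ring. Qed.

Lemma xpt_sym (s t : seg) : segdet s t != 0 -> xpt s t = xpt t s.
Proof.
case: s t => [i [[a b] [c d]]] [j [[a' b'] [c' d']]].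
rewrite /xpt /tau segdetC oppr_eq0 /segdet /segdx /segdy /= => d0.
by congr (_, _); field.
Qed.

Lemma xing_irr (s : seg) : xing s s = false.
Proof. by rewrite /xing /segdet mulrC subrr eqxx. Qed.

Lemma lft_rgt (s : seg) : s \in S -> lexlt (lft s) (rgt s).
Proof.
move=> /S_nondeg; rewrite /lft /rgt; case: ifPn => //.
by rewrite lexltNge => /orP[//|/eqP->]; rewrite eqxx.
Qed.

Lemma lft_in (s : seg) : lft s \in [:: s.2.1; s.2.2].
Proof. by rewrite /lft !inE; case: ifP; rewrite eqxx ?orbT. Qed.
Lemma rgt_in (s : seg) : rgt s \in [:: s.2.1; s.2.2].
Proof. by rewrite /rgt !inE; case: ifP; rewrite eqxx ?orbT. Qed.
Lemma lft_or_rgt (s : seg) P : P \in [:: s.2.1; s.2.2] -> P = lft s \/ P = rgt s.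
Proof. by rewrite /lft /rgt !inE; case: ifP => _ /orP[]/eqP->; auto. Qed.

Lemma end_in s P : s \in S -> P \in [:: s.2.1; s.2.2] -> P \in ends_of.
Proof.
move=> sS; rewrite !inE mem_cat => /orP[]/eqP->; apply/orP; [left|right]; exact: map_f.
Qed.
Lemma xpt_in s t : s \in S -> t \in S -> xpt s t \in xpts.
Proof. by move=> sS tS; apply/allpairsP; exists (s, t). Qed.

Variable eps : R.
Definition X (p : pt) := p.1 + eps * p.2.
Hypothesis X_mono : forall p q, p \in ends_of ++ xpts -> q \in ends_of ++ xpts -> lexlt p q -> X p < X q.

Let pts := ends_of ++ xpts.
Lemma X_lt p q : p \in pts -> q \in pts -> (X p < X q) = lexlt p q.
Proof.
move=> pP qP; apply/idP/idP; last exact: X_mono.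
apply: contraTT; rewrite lexltNge -leNgt => /orP[/(X_mono qP pP)/ltW//|/eqP->//].
Qed.
Lemma X_inj p q : p \in pts -> q \in pts -> X p = X q -> p = q.
Proof.
move=> pP qP e; apply/eqP; have := X_lt pP qP; rewrite e ltxx => /esym/negbT.
rewrite lexltNge => /orP[h|]; last by rewrite eq_sym.
by have := X_mono qP pP h; rewrite e ltxx.
Qed.
Lemma lft_pts s : s \in S -> lft s \in pts.
Proof. by move=> sS; rewrite mem_cat (end_in sS) // lft_in. Qed.
Lemma rgt_pts s : s \in S -> rgt s \in pts.
Proof. by move=> sS; rewrite mem_cat (end_in sS) // rgt_in. Qed.
Lemma xpt_pts s t : s \in S -> t \in S -> xpt s t \in pts.
Proof. by move=> sS tS; rewrite mem_cat xpt_in // orbT. Qed.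

Definition XL s := X (lft s).
Definition XR s := X (rgt s).
Definition slope (s : seg) := ((rgt s).2 - (lft s).2) / (XR s - XL s).
Definition Y s c := (lft s).2 + slope s * (c - XL s).
Definition P s c : pt := (c - eps * Y s c, Y s c).
Definition cx s t := X (xpt s t).

Lemma XLR s : s \in S -> XL s < XR s.
Proof. by move=> sS; apply: X_mono (lft_pts sS) (rgt_pts sS) (lft_rgt sS). Qed.

Lemma X_P s c : X (P s c) = c. Proof. by rewrite /X /P /=; ring. Qed.

Lemma Y_lft s : Y s (XL s) = (lft s).2. Proof. by rewrite /Y subrr mulr0 addr0. Qed.
Lemma Y_rgt s : s \in S -> Y s (XR s) = (rgt s).2.
Proof.
move=> /XLR h; rewrite /Y /slope mulfVK; first by ring.
by rewrite subr_eq0 gt_eqF.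
Qed.

Lemma P_eq (p : pt) s : Y s (X p) = p.2 -> P s (X p) = p.
Proof. by case: p => [a b] /= e; rewrite /P e /X /=; congr (_, _); ring. Qed.

Lemma P_along s c : s \in S -> P s c = along (lft s) (rgt s) ((c - XL s) / (XR s - XL s)).
Proof.
move=> sS; have h := XLR sS; have n0 : XR s - XL s != 0 by rewrite subr_eq0 gt_eqF.
rewrite /P /along /Y /slope; congr (_, _); last by ring.
by move: n0; rewrite /XR /XL /X => n0; field.
Qed.

Lemma onseg_lr (s : seg) p t : 0 <= t <= 1 -> p = along (lft s) (rgt s) t -> onseg s p.
Proof.
rewrite /lft /rgt; case: ifP => _ ht ->; first by exists t.
exists (1 - t); first by move: ht => /andP[h1 h2]; apply/andP; split; lra.
by rewrite /along; congr (_, _); ring.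
Qed.

Lemma P_on s c : s \in S -> XL s <= c <= XR s -> onseg s (P s c).
Proof.
move=> sS /andP[h1 h2]; have h := XLR sS.
apply: (@onseg_lr s _ ((c - XL s) / (XR s - XL s))); last exact: P_along.
by rewrite divr_ge0 ?ler_pdivrMr ?subr_gt0 ?mul1r ?lerB ?subr_ge0 //= ltW.
Qed.

Lemma xing_X s t : s \in S -> t \in S -> xing s t ->
  [/\ XL s < cx s t < XR s & Y s (cx s t) = (xpt s t).2].
Proof.
move=> sS tS /and5P[d0 t0 t1 _ _].
have hs := XLR sS.
have [u /andP[u0 u1] e] : exists2 u, 0 < u < 1 & xpt s t = along (lft s) (rgt s) u.
  rewrite /lft /rgt; case: ifP => _.
    by exists (tau s t); rewrite ?t0.
  exists (1 - tau s t); first by apply/andP; split; lra.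
  by rewrite /xpt /along /segdx /segdy; congr (_, _); ring.
have ec : cx s t = XL s + u * (XR s - XL s).
  by rewrite /cx e /along /XL /XR /X /=; ring.
split.
  rewrite ec; apply/andP; split.
    by rewrite ltrDl mulr_gt0 // subr_gt0.
  have : u * (XR s - XL s) < 1 * (XR s - XL s) by rewrite ltr_pM2r // subr_gt0.
  lra.
rewrite ec e /along /Y /slope /=.
have n0 : XR s - XL s != 0 by rewrite subr_eq0 gt_eqF.
by field.
Qed.

Lemma cx_sym s t : xing s t -> cx s t = cx t s.
Proof. by move=> /and5P[d0 _ _ _ _]; rewrite /cx xpt_sym. Qed.

Lemma meetP s t c : s \in S -> t \in S -> s != t ->
  XL s <= c <= XR s -> XL t <= c <= XR t -> Y s c = Y t c ->
  (P s c \in [:: s.2.1; s.2.2] /\ P s c \in [:: t.2.1; t.2.2]) \/ (xing s t /\ c = cx s t).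
Proof.
move=> sS tS st hs ht e.
have eP : P s c = P t c by rewrite /P e.
have ont : onseg t (P s c) by rewrite eP; apply: P_on.
case: (S_meet sS tS st (P_on sS hs) ont) => [//|[h1 h2]]; first by left.
by right; split=> //; rewrite /cx -h2 X_P.
Qed.

Lemma end_X s c : s \in S -> XL s < c -> P s c \in [:: s.2.1; s.2.2] -> c = XR s /\ P s c = rgt s.
Proof.
move=> sS h /lft_or_rgt[e|e].
  by move: h; rewrite -(X_P s c) e /XL ltxx.
by rewrite -{1}(X_P s c) e.
Qed.

(* Segments keep their order until they cross or end in a common point. *)
Lemma order_keep u v c d : u \in S -> v \in S -> c < d ->
  XL u <= c -> d <= XR u -> XL v <= c -> d <= XR v -> Y u c < Y v c ->
  (xing u v -> ~~ (c < cx u v <= d)) ->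
  Y u d < Y v d \/ [/\ Y u d = Y v d, d = XR u & d = XR v].
Proof.
move=> uS vS cd lu ru lv rv h nx.
have uv : u != v by apply: contraTneq h => ->; rewrite ltxx.
have [|le] := ltP (Y u d) (Y v d); [by left|right].
pose D x := Y u x - Y v x.
have affine x : D x = D c + (slope u - slope v) * (x - c) by rewrite /D /Y; ring.
have Dc : D c < 0 by rewrite subr_lt0.
have Dd : 0 <= D d by rewrite subr_ge0.
(* The zero of the affine function [D], which is negative at c and nonnegative at d. The segments
   meet there, so it is a crossing, which is excluded, or a common right end, which can only be at
   d. *)
pose e := c + (d - c) * (- D c / (D d - D c)).
have r01 : 0 < - D c / (D d - D c) <= 1.
  by rewrite divr_gt0 ?ler_pdivrMr ?mul1r //=; lra.
have [ce ed] : c < e /\ e <= d.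
  move: r01 => /andP[r0 r1]; split; first by rewrite /e ltrDl mulr_gt0 // subr_gt0.
  have : (d - c) * (- D c / (D d - D c)) <= (d - c) * 1 by rewrite ler_wpM2l // subr_ge0 ltW.
  rewrite /e; lra.
have De : D e = 0.
  have n0 : D d - D c != 0 by rewrite gt_eqF //; lra.
  have hd : D d - D c = (slope u - slope v) * (d - c) by rewrite [D d]affine; ring.
  rewrite affine /e.
  have -> : (slope u - slope v) * (c + (d - c) * (- D c / (D d - D c)) - c) =
    ((slope u - slope v) * (d - c)) * (- D c / (D d - D c)) by ring.
  by rewrite -hd; field.
have eY : Y u e = Y v e by apply/eqP; rewrite -subr_eq0 -/(D e) De.
have hu : XL u <= e <= XR u by apply/andP; split; lra.
have hv : XL v <= e <= XR v by apply/andP; split; lra.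
case: (meetP uS vS uv hu hv eY) => [[h1 h2]|[h1 h2]]; last first.
  by have := nx h1; rewrite -h2 ce ed.
have [e1 _] := end_X uS (le_lt_trans lu ce) h1.
have eP : P u e = P v e by rewrite /P eY.
rewrite eP in h2; have [e2 _] := end_X vS (le_lt_trans lv ce) h2.
have ed' : e = d by apply/eqP; rewrite eq_le ed /= e1.
by rewrite -ed'.
Qed.

(** The program evaluates a determinant that does not mention [eps]; its sign is that of a height
    difference after the shear. The next lemmas do the same for slopes. *)
Lemma sideE s p : s \in S -> side s p = (XR s - XL s) * (p.2 - Y s (X p)).
Proof.
move=> sS; have h := XLR sS; have n0 : XR s - XL s != 0 by rewrite subr_eq0 gt_eqF.
rewrite /side /Y /slope; move: n0; rewrite /XR /XL /X.
by move: (lft s) (rgt s) p => [a b] [c d] [e f] /= n0; field.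
Qed.
Lemma odetE s t : s \in S -> t \in S ->
  odet s t = (XR s - XL s) * (XR t - XL t) * (slope t - slope s).
Proof.
move=> sS tS; have hs := XLR sS; have ht := XLR tS.
have ns : XR s - XL s != 0 by rewrite subr_eq0 gt_eqF.
have nt : XR t - XL t != 0 by rewrite subr_eq0 gt_eqF.
rewrite /odet /slope; move: ns nt; rewrite /XR /XL /X.
move: (lft s) (rgt s) (lft t) (rgt t) => [a b] [c d] [a' b'] [c' d'] /= ns nt; field.
by rewrite ns nt.
Qed.
Lemma odet_gt0 s t : s \in S -> t \in S -> (0 < odet s t) = (slope s < slope t).
Proof.
by move=> sS tS; rewrite odetE // pmulr_rgt0 ?subr_gt0 // mulr_gt0 // subr_gt0 XLR.
Qed.
Lemma odet_lt0 s t : s \in S -> t \in S -> (odet s t < 0) = (slope t < slope s).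
Proof.
by move=> sS tS; rewrite odetE // pmulr_rlt0 ?subr_lt0 // mulr_gt0 // subr_gt0 XLR.
Qed.
Lemma qBE q z : z \in S -> q.2.2 \in S -> qB q z = (Y z (X q.1) < q.1.2) ||
  ((Y z (X q.1) == q.1.2) && (if q.2.1 then slope z < slope q.2.2 else slope q.2.2 < slope z)).
Proof.
move=> zS qS; have h := XLR zS.
rewrite /qB sideE // odet_gt0 // odet_lt0 // pmulr_rgt0 ?subr_gt0 //.
by rewrite mulf_eq0 subr_eq0 gt_eqF //= subr_eq0 [_.2 == _]eq_sym.
Qed.

Definition allents := [seq start s | s <- S] ++ [seq stop s | s <- S].

Lemma allentsP e : e \in allents -> exists2 s, s \in S & e = start s \/ e = stop s.
Proof. by rewrite mem_cat => /orP[]/mapP[s sS ->]; exists s; auto. Qed.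
Lemma start_in s : s \in S -> start s \in allents.
Proof. by move=> sS; rewrite mem_cat map_f. Qed.
Lemma stop_in s : s \in S -> stop s \in allents.
Proof. by move=> sS; rewrite mem_cat map_f ?orbT. Qed.
Lemma ent_pts e : e \in allents -> e.1 \in pts.
Proof. by move=> /allentsP[s sS [->|->]]; [apply: lft_pts | apply: rgt_pts]. Qed.

Lemma sym_in (out : seq (seg * seg)) u v : ((u, v) \in sym out) = ((u, v) \in out) || ((v, u) \in out).
Proof.
rewrite mem_cat; congr (_ || _); apply/mapP/idP => [[[a b] h [-> ->]]//|h].
by exists (v, u).
Qed.

Lemma xpt_on s t : s \in S -> t \in S -> xing s t -> P s (cx s t) = xpt s t.
Proof. by move=> sS tS st; have [_ e] := xing_X sS tS st; apply: P_eq. Qed.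

Lemma interior s p : s \in S -> XL s < X p < XR s -> p \notin [:: s.2.1; s.2.2].
Proof.
move=> sS /andP[h1 h2]; apply/negP => /lft_or_rgt[] e; subst.
  by move: h1; rewrite ltxx.
by move: h2; rewrite ltxx.
Qed.

(** The crossing lies inside u. Another segment through it therefore does not meet u in a common
    end, so it crosses u. *)
Lemma xing_share u v w : u \in S -> v \in S -> w \in S -> xing u v -> u != w -> onseg w (xpt u v) -> xing u w.
Proof.
move=> uS vS wS uv uw ow.
have [h e] := xing_X uS vS uv.
have ou : onseg u (xpt u v).
  rewrite -(xpt_on uS vS uv); apply: P_on => //; move/andP: h => [h1 h2].
  by rewrite !ltW.
by case: (S_meet uS wS uw ou ow) => [[h1 _]|[//]]; rewrite (negbTE (interior uS h)) in h1.
Qed.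

Lemma xpt_onseg u v : u \in S -> v \in S -> xing u v -> onseg u (xpt u v) /\ onseg v (xpt u v).
Proof.
move=> uS vS uv.
have aux a b : a \in S -> b \in S -> xing a b -> onseg a (xpt a b).
  move=> aS bS ab; have [/andP[h1 h2] _] := xing_X aS bS ab.
  by rewrite -(xpt_on aS bS ab); apply: P_on => //; rewrite !ltW.
split; first exact: aux.
by rewrite xpt_sym; [apply: aux; rewrite // xing_sym | case/and5P: uv].
Qed.

(** A third segment through the crossing of u and v would cross both of them and close a
    triangle. *)
Lemma xpt_inj u v u' v' : u \in S -> v \in S -> u' \in S -> v' \in S ->
  xing u v -> xing u' v' -> xpt u v = xpt u' v' -> (u', v') = (u, v) \/ (u', v') = (v, u).
Proof.
move=> uS vS uS' vS' uv uv' e.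
have uv_ne : xpt v u = xpt u v by rewrite xpt_sym //; case/and5P: uv => d0; rewrite segdetC oppr_eq0.
have vu : xing v u by rewrite xing_sym.
have [o1 o2] := xpt_onseg uS' vS' uv'.
have key w : w \in S -> onseg w (xpt u v) -> w = u \/ w = v.
  move=> wS ow; have [->|nu] := eqVneq u w; first by left.
  have [->|nv] := eqVneq v w; first by right.
  have uw := xing_share uS vS wS uv nu ow.
  have ow' : onseg w (xpt v u) by rewrite uv_ne.
  have vw := xing_share vS uS wS vu nv ow'.
  by case: (S_triangle uS vS wS uv vw uw).
rewrite -e in o1 o2.
have n : u' != v' by apply: contraTneq uv' => ->; rewrite xing_irr.
case: (key _ uS' o1) (key _ vS' o2) n => -> [] -> ; rewrite ?eqxx //; auto.
Qed.

(** [inv_c] asks for a position c of the sweep line at which the status is strictly ordered and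
    which separates reported from unreported crossings. It is not compared with beginnings still to
    come or with ends already handled, as several segments may begin or end in one point. [inv_x]
    says that entries and crossings are handled in sheared order. *)
Record inv (ents : seq query) (l : seq seg) (out : seq (seg * seg)) : Prop := Inv {
  inv_sorted : sorted (fun x y => ~~ qlt y x) ents;
  inv_uniq : uniq ents;
  inv_sub : {subset ents <= allents};
  inv_order : forall e e', e \in allents -> e \notin ents -> e' \in ents -> ~~ qlt e' e;
  inv_mem : forall s, (s \in l) = [&& s \in S, start s \notin ents & stop s \in ents];
  inv_usym : uniq (sym out);
  inv_out : forall u v, (u, v) \in sym out -> [/\ u \in S, v \in S & xing u v];
  inv_c : exists c, [/\ pairwise (fun u v => Y u c < Y v c) l,
     forall s, s \in S -> start s \notin ents -> XL s < c,
     forall s, s \in S -> stop s \in ents -> c < XR s &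
     forall u v, u \in S -> v \in S -> xing u v -> if (u, v) \in sym out then cx u v < c else c < cx u v];
  inv_x : forall e u v, e \in allents -> u \in S -> v \in S -> xing u v ->
     if e \in ents then (u, v) \in sym out -> cx u v < X e.1 else (u, v) \notin sym out -> X e.1 < cx u v
}.

Lemma pairwise_lt_mem (f : seg -> R) l1 z l2 : pairwise (fun u v => f u < f v) (l1 ++ z :: l2) ->
  (forall x, x \in l1 -> f x < f z) /\ (forall x, x \in l2 -> f z < f x).
Proof.
rewrite pairwise_cat allrel_consr => /and3P[/andP[/allP h _] _ /= /andP[/allP h' _]].
by split.
Qed.

Lemma pairwise_uniq (f : seg -> R) l : pairwise (fun u v => f u < f v) l -> uniq l.
Proof.
elim: l => //= a l IH /andP[/allP h /IH ->]; rewrite andbT.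
by apply/negP => /h; rewrite ltxx.
Qed.

Lemma pairwise_total (f : seg -> R) l a b : pairwise (fun u v => f u < f v) l ->
  a \in l -> b \in l -> a != b -> f a < f b \/ f b < f a.
Proof.
move=> + al; case/splitPr: al => l1 l2 /pairwise_lt_mem[h1 h2].
rewrite mem_cat inE => /or3P[/h1|/eqP->|/h2]; rewrite ?eqxx //; auto.
Qed.

Lemma pairwise_split (f : seg -> R) l a b : pairwise (fun u v => f u < f v) l ->
  a \in l -> b \in l -> f a < f b ->
  exists l1 m l2, l = l1 ++ a :: m ++ b :: l2 /\ forall z, z \in m -> f a < f z /\ f z < f b.
Proof.
move=> pl al bl ab; move: pl bl; case/splitPr: al => l1 l2 pl.
have [h1 h2] := pairwise_lt_mem pl.
rewrite mem_cat inE => /or3P[/h1 h|/eqP e|bl]; try by [have := lt_trans h ab; rewrite ltxx | rewrite e ltxx in ab].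
move: pl h2; case/splitPr: bl => m l3 pl h2; exists l1, m, l3; split=> // z zm; split.
  by apply: h2; rewrite mem_cat zm.
rewrite -cat_cons catA in pl.
by have [h3 _] := pairwise_lt_mem pl; apply: h3; rewrite mem_cat inE zm !orbT.
Qed.

(* The pair with the first of the remaining crossings is adjacent in the
   status, as a segment between them would have to cross one of them earlier. *)
Lemma next_adjacent ents l out u v : inv ents l out -> u \in S -> v \in S -> xing u v ->
  (u, v) \notin sym out ->
  (forall e, e \in ents -> cx u v < X e.1) ->
  (forall u' v', u' \in S -> v' \in S -> xing u' v' -> (u', v') \notin sym out -> cx u v <= cx u' v') ->
  exists a b l1 l2, [/\ l = l1 ++ a :: b :: l2, (a, b) = (u, v) \/ (a, b) = (v, u),
     a \in S, b \in S & cand a b = Some (xpt a b, (a, b))].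
Proof.
move=> I uS vS uv nout hents hmin.
have [c [sl st_ sp xc]] := inv_c I.
have cc : c < cx u v by have := xc u v uS vS uv; rewrite (negbTE nout).
have inl w z : w \in S -> z \in S -> xing w z -> (w, z) \notin sym out -> cx w z = cx u v -> w \in l.
  move=> wS zS wz nwz e; rewrite (inv_mem I) wS /=.
  have [/andP[h1 h2] _] := xing_X wS zS wz.
  apply/andP; split.
    by apply/negP => /hents; rewrite -e -/(XL w); lra.
  apply: contraT => h; have := inv_x I (stop_in wS) wS zS wz; rewrite (negbTE h) => /(_ nwz) /=.
  rewrite -/(XR w); lra.
have vu : xing v u by rewrite xing_sym.
have nout' : (v, u) \notin sym out by rewrite sym_in orbC -sym_in.
have ul := inl _ _ uS vS uv nout erefl.
have vl := inl _ _ vS uS vu nout' (esym (cx_sym uv)).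
have uvn : u != v by apply: contraTneq uv => ->; rewrite xing_irr.
have {ul vl inl} [a [b [al bl ab abS]]] : exists a b, [/\ a \in l, b \in l, Y a c < Y b c &
    (a, b) = (u, v) \/ (a, b) = (v, u)].
  case: (pairwise_total sl ul vl uvn) => h; [exists u, v | exists v, u]; split=> //; auto.
have [aS bS xab exab] : [/\ a \in S, b \in S, xing a b & cx a b = cx u v].
  by case: abS => -[-> ->]; split=> //; rewrite cx_sym.
have reach z : z \in l -> z \in S /\ XL z < c /\ cx u v < XR z.
  rewrite (inv_mem I) => /and3P[zS h1 h2]; split=> //; split; first exact: st_.
  exact: hents h2.
have keep w z : w \in l -> z \in l -> Y w c < Y z c -> ~~ (xing w z && (cx w z == cx u v)) ->
    Y w (cx u v) < Y z (cx u v).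
  move=> /reach[wS [w1 w2]] /reach[zS [z1 z2]] h nx.
  case: (@order_keep w z c (cx u v)) => //; try exact: ltW.
    move=> wz; apply/negP => /andP[h1 h2].
    have nwz : (w, z) \notin sym out.
      by apply/negP => h3; have := xc _ _ wS zS wz; rewrite h3; lra.
    move: nx; rewrite wz /= eq_le h2 /= => /negP; apply; exact: hmin.
  by case=> _ e; rewrite e ltxx in w2.
have [l1 [m [l2 [el hm]]]] := pairwise_split sl al bl ab.
have em : m = [::].
  case: m el hm => // z m el hm; have [h1 h2] := hm z (mem_head _ _).
  have zl : z \in l by rewrite el mem_cat !inE eqxx !orbT.
  have [zS _] := reach z zl.
  have xab' : xing b a by rewrite xing_sym.
  have exab' : cx b a = cx u v by rewrite -exab cx_sym.
  (* By [xpt_inj], z does not pass through the crossing itself. So it would stay strictly between a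
     and b up to the point where these meet. *)
  have dist w w' : w \in S -> w' \in S -> xing w w' -> cx w w' = cx u v -> w != z -> w' != z ->
      ~~ (xing w z && (cx w z == cx u v)).
    move=> wS wS' ww e n1 n2; apply/negP => /andP[wz /eqP e'].
    have e2 : xpt w w' = xpt w z by apply: X_inj; rewrite ?xpt_pts // -/(cx w w') e -e'.
    case: (xpt_inj wS wS' wS zS ww wz e2) => -[] *; subst; rewrite ?eqxx // in n1 n2.
  have az : a != z by apply: contraTneq h1 => ->; rewrite ltxx.
  have bz : b != z by apply: contraTneq h2 => ->; rewrite ltxx.
  have k1 := keep a z al zl h1 (dist a b aS bS xab exab az bz).
  have k2 : Y z (cx u v) < Y b (cx u v).
    apply: keep => //; rewrite xing_sym; apply/negP => /andP[h3 h4].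
    have := dist b a bS aS xab' exab' bz az; rewrite h3 /=.
    by rewrite cx_sym // h4.
  have [_ e1] := xing_X aS bS xab; have [_ e2] := xing_X bS aS xab'.
  rewrite exab in e1; rewrite exab' in e2.
  have e3 : xpt a b = xpt b a by apply: xpt_sym; case/and5P: xab.
  by move: (lt_trans k1 k2); rewrite e1 e2 e3 ltxx.
subst m; exists a, b, l1, l2; split=> //.
rewrite /cand xab andbT odet_lt0 //.
suff -> : slope b < slope a by [].
have [_ e1] := xing_X aS bS xab; have [_ e2] := xing_X bS aS (etrans (xing_sym b a) xab).
have e3 : xpt a b = xpt b a by apply: xpt_sym; case/and5P: xab.
have e4 : Y a (cx a b) = Y b (cx a b) by rewrite e1 e3 -e2 -cx_sym.
have cc' : c < cx a b by rewrite exab.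
move: e4 ab; rewrite /Y => e4 ab.
have : (slope b - slope a) * (cx a b - c) < 0 by lra.
by rewrite pmulr_llt0 ?subr_gt0 // subr_lt0.
Qed.

Lemma keep_order ents l out c d : inv ents l out ->
  pairwise (fun u v => Y u c < Y v c) l ->
  (forall s, s \in l -> XL s < c /\ d < XR s) -> c < d ->
  forall u v, u \in l -> v \in l -> Y u c < Y v c ->
  ~~ (xing u v && (c < cx u v <= d)) -> Y u d < Y v d.
Proof.
move=> I sl hl cd u v ul vl h nx.
have [u1 u2] := hl u ul; have [v1 v2] := hl v vl.
have uS : u \in S by move: ul; rewrite (inv_mem I) => /andP[].
have vS : v \in S by move: vl; rewrite (inv_mem I) => /andP[].
case: (order_keep uS vS cd _ _ _ _ h) => //; try exact: ltW.
  by move=> uv; move: nx; rewrite uv.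
by case=> _ e; rewrite e ltxx in u2.
Qed.

Lemma pairwise_sub (f g : seg -> R) l : pairwise (fun u v => f u < f v) l ->
  (forall u v, u \in l -> v \in l -> f u < f v -> g u < g v) -> pairwise (fun u v => g u < g v) l.
Proof.
elim: l => //= a l IH /andP[/allP h1 h2] H; apply/andP; split.
  by apply/allP => z zl; apply: H (h1 z zl); rewrite ?mem_head // inE zl orbT.
by apply: IH h2 _ => u v ul vl; apply: H; rewrite inE ?ul ?vl orbT.
Qed.

Lemma pairwise_swap (f g : seg -> R) l1 a b l2 : pairwise (fun u v => f u < f v) (l1 ++ a :: b :: l2) ->
  (forall u v, u \in l1 ++ a :: b :: l2 -> v \in l1 ++ a :: b :: l2 -> f u < f v -> (u, v) != (a, b) -> g u < g v) ->
  g b < g a -> pairwise (fun u v => g u < g v) (l1 ++ b :: a :: l2).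
Proof.
move=> pl H ba; elim: l1 pl H => [|c l1 IH] /= pl H.
  move: pl => /= /and3P[/andP[ab /allP al] /allP bl pl]; rewrite ba /=; apply/and3P; split.
  - apply/allP => z zl; apply: H (bl z zl) _; rewrite ?inE ?eqxx ?zl ?orbT //.
    by rewrite xpair_eqE; case: eqP => // e; move: ab; rewrite e ltxx.
  - apply/allP => z zl; apply: H (al z zl) _; rewrite ?inE ?eqxx ?zl ?orbT //.
    by rewrite xpair_eqE andbC; case: eqP => // e; move: (bl z zl); rewrite e ltxx.
  - apply: (pairwise_sub pl) => u v ul vl uv; apply: H uv _; rewrite ?inE ?ul ?vl ?orbT //.
    by rewrite xpair_eqE; case: eqP => // e; move: (al u ul); rewrite e ltxx.
case/andP: pl => /allP cl pl; apply/andP; split; last first.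
  by apply: IH pl _ => u v ul vl; apply: H; rewrite inE ?ul ?vl orbT.
apply/allP => z zl.
have zl' : z \in l1 ++ a :: b :: l2.
  by move: zl; rewrite !mem_cat !inE; case: (z \in l1); case: (z == a); case: (z == b).
apply: H (cl z zl') _; rewrite ?mem_head ?inE ?zl' ?orbT //.
rewrite xpair_eqE; case: eqP => // e.
by have := cl a; rewrite mem_cat mem_head orbT => /(_ isT); rewrite e ltxx.
Qed.

Lemma qle_X e e' : e \in allents -> e' \in allents -> ~~ qlt e' e -> X e.1 <= X e'.1.
Proof.
move=> /ent_pts h1 /ent_pts h2 /norP[h _]; move: h; rewrite lexltNge => /orP[h|/eqP->//].
by apply: ltW; apply: X_mono.
Qed.

(** A position after [base] and before all later events; it provides new witnesses for [inv_c]. *)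
Lemma events_gap (base : R) : exists c, [/\ base < c,
  forall e, e \in allents -> base < X e.1 -> c < X e.1 &
  forall u v, u \in S -> v \in S -> base < cx u v -> c < cx u v].
Proof.
have [c c1 c2] := gap_above base [seq X p | p <- pts].
exists c; split=> // [e ein|u v uS vS]; apply: c2; apply: map_f.
  exact: ent_pts.
exact: xpt_pts.
Qed.

(** The other segments of the status pass strictly above or below the crossing. For a and b, which
    meet there, the tie is broken by slope, in opposite senses for deletion and insertion; as b has
    the smaller slope, a is deleted and comes back just above b. *)
Lemma step_cross ents l1 a b l2 out : inv ents (l1 ++ a :: b :: l2) out ->
  a \in S -> b \in S -> xing a b -> odet a b < 0 -> (a, b) \notin sym out ->
  (forall e, e \in ents -> cx a b < X e.1) ->
  (forall u' v', u' \in S -> v' \in S -> xing u' v' -> (u', v') \notin sym out -> cx a b <= cx u' v') ->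
  [/\ inv ents (l1 ++ b :: a :: l2) ((a, b) :: out),
     all (qB (xpt a b, (false, a))) l1, all (predC (qB (xpt a b, (false, a)))) (a :: b :: l2),
     all (qB (xpt a b, (true, a))) (l1 ++ [:: b]) & all (predC (qB (xpt a b, (true, a)))) l2].
Proof.
set l := l1 ++ a :: b :: l2 => I aS bS ab od nout hents hmin.
have [c [sl st_ sp xc]] := inv_c I.
have reach z : z \in l -> [/\ z \in S, XL z < c & cx a b < XR z].
  rewrite (inv_mem I) => /and3P[zS h1 h2]; split=> //; first exact: st_.
  exact: hents h2.
have cab : c < cx a b by have := xc a b aS bS ab; rewrite (negbTE nout).
have ba : xing b a by rewrite xing_sym.
have nout' : (b, a) \notin sym out by rewrite sym_in orbC -sym_in.
have sba : slope b < slope a by rewrite -odet_lt0.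
have [_ e1] := xing_X aS bS ab; have [_ e2] := xing_X bS aS ba.
have e3 : xpt a b = xpt b a by apply: xpt_sym; case/and5P: ab.
have e4 : cx b a = cx a b by rewrite -cx_sym.
rewrite e4 -e3 in e2.
have al : a \in l by rewrite mem_cat mem_head orbT.
have bl : b \in l by rewrite mem_cat !inE eqxx !orbT.
have once u v : u \in S -> v \in S -> xing u v -> (u, v) \notin sym out -> cx u v = cx a b ->
    (u, v) = (a, b) \/ (u, v) = (b, a).
  move=> uS vS uv _ e; apply: (xpt_inj aS bS uS vS ab uv).
  by apply: X_inj; rewrite ?xpt_pts.
have keep w z d : w \in l -> z \in l -> Y w c < Y z c -> (w, z) != (a, b) -> (w, z) != (b, a) -> c < d ->
    (forall s, s \in l -> d < XR s) ->
    (forall u v, u \in S -> v \in S -> xing u v -> cx a b < cx u v -> d < cx u v) -> Y w d < Y z d.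
  move=> wl zl h n1 n2 cd dR dx; apply: (keep_order I sl _ cd wl zl h).
    by move=> s sl'; have [_ h1 _] := reach s sl'; split=> //; apply: dR.
  have [wS _ _] := reach w wl; have [zS _ _] := reach z zl.
  apply/negP => /andP[wz /andP[h1 h2]].
  have nwz : (w, z) \notin sym out.
    by apply/negP => h3; have := xc _ _ wS zS wz; rewrite h3; lra.
  have := hmin w z wS zS wz nwz; rewrite le_eqVlt => /orP[/eqP e|h3].
    by case: (once w z wS zS wz nwz (esym e)) => e5; rewrite e5 eqxx in n1 n2.
  by have := dx w z wS zS wz h3; lra.
have [d [d1 d2 d3]] := events_gap (cx a b).
have dR s : s \in l -> d < XR s.
  move=> sl'; have [sS _ h] := reach s sl'; apply: (d2 (stop s)) => //; exact: stop_in.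
have cd : c < d by apply: lt_trans cab d1.
have ul : uniq l := pairwise_uniq sl.
have [ha1 ha2] := pairwise_lt_mem sl.
have [hb1 hb2] : (forall x, x \in l1 ++ [:: a] -> Y x c < Y b c) /\ (forall x, x \in l2 -> Y b c < Y x c).
  by apply: pairwise_lt_mem; rewrite -catA.
have lS z : z \in l -> z \in S by case/reach.
have l1S z : z \in l1 -> z \in l by move=> h; rewrite mem_cat h.
have l2S z : z \in l2 -> z \in l by move=> h; rewrite mem_cat !inE h !orbT.
have na z : z \in l1 -> [/\ z != a & z != b].
  move=> h; split; apply: contraTneq (ha1 z h) => ->; rewrite -leNgt //.
  by apply: ltW; apply: hb1; rewrite mem_cat mem_head orbT.
have nb z : z \in l2 -> [/\ z != a & z != b].
  move=> h; split; apply: contraTneq (hb2 z h) => ->; rewrite -leNgt //.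
  by apply: ltW; apply: hb1; rewrite mem_cat mem_head orbT.
have low z : z \in l1 -> Y z (cx a b) < (xpt a b).2.
  move=> h; rewrite -e1; have [n1 n2] := na z h.
  apply: keep => //; rewrite ?xpair_eqE ?(negbTE n1) ?(negbTE n2) //; try exact: l1S; try exact: ha1.
  by move=> s /reach[].
have high z : z \in l2 -> (xpt a b).2 < Y z (cx a b).
  move=> h; rewrite -e2; have [n1 n2] := nb z h.
  apply: keep => //; rewrite ?xpair_eqE ?(negbTE n1) ?(negbTE n2) ?andbF //; try exact: l2S; try exact: hb2.
  by move=> s /reach[].
have lo q z : z \in l1 -> q.1 = xpt a b -> q.2.2 = a -> qB q z.
  move=> h eq1 eq2; rewrite qBE ?eq2 //; last exact: lS (l1S z h).
  by rewrite eq1 -/(cx a b) low.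
have hi q z : z \in l2 -> q.1 = xpt a b -> q.2.2 = a -> ~~ qB q z.
  move=> h eq1 eq2; rewrite qBE ?eq2 //; last exact: lS (l2S z h).
  rewrite eq1 -/(cx a b).
  by have h' := high z h; rewrite ltNge (ltW h') /= gt_eqF.
split; last first.
- by apply/allP => z zl; rewrite /= hi.
- rewrite all_cat /= andbT; apply/andP; split; first by apply/allP => z zl; rewrite lo.
  by rewrite qBE //= -/(cx a b) e2 eqxx sba orbT.
- rewrite /= !qBE //= -/(cx a b) e1 e2 eqxx ltxx /= ltxx -leNgt ltW //=.
  by apply/allP => z zl; rewrite /= hi.
- by apply/allP => z zl; rewrite lo.
have insym u v : ((u, v) \in sym ((a, b) :: out)) = [|| (u, v) == (a, b), (v, u) == (a, b) | (u, v) \in sym out].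
  by rewrite sym_in !inE sym_in; do !case: (_ == _) => //=; rewrite ?orbT.
split; try by case: I.
- move=> s; rewrite -(inv_mem I) !mem_cat !inE; congr (_ || _).
  by rewrite orbCA.
- have pe : perm_eq (sym ((a, b) :: out)) ((a, b) :: (b, a) :: sym out).
    by rewrite /sym /= perm_cons -[_ :: map _ _]cat1s -[(b, a) :: _ in X in perm_eq _ X]cat1s perm_catCA.
  have abn : a != b by apply: contraTneq ab => ->; rewrite xing_irr.
  by rewrite (perm_uniq pe) /= inE xpair_eqE (negbTE abn) /= nout nout' (inv_usym I).
- move=> u v; rewrite insym => /or3P[/eqP[-> ->]//|/eqP[-> ->]|/(inv_out I)//].
  by split.
- exists d; split.
  + apply: (pairwise_swap sl).
      move=> u v ul' vl uv n; apply: keep => //; last by move=> u' v' uS' vS' _; exact: d3.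
      apply: contraTneq uv => -[-> ->]; rewrite -leNgt; apply: ltW.
      by apply: hb1; rewrite mem_cat mem_head orbT.
    have : (slope b - slope a) * (d - cx a b) < 0 by rewrite nmulr_rlt0 ?subr_gt0 // subr_lt0.
    have {}e1 : Y a (cx a b) = Y b (cx a b) by rewrite e1 e2.
    by move: e1; rewrite /Y => h h'; lra.
  + by move=> s sS h; apply: lt_trans (st_ s sS h) _.
  + by move=> s sS h; apply: (d2 (stop s)); [exact: stop_in | exact: hents].
  + move=> u v uS vS uv; rewrite insym; case: ifPn.
      case/or3P => [/eqP[-> ->]//|/eqP[-> ->]|h]; first by rewrite e4.
      by have := xc u v uS vS uv; rewrite h => h'; apply: lt_trans h' _.
    case/norP => n1 /norP[n2 n3]; apply: d3 => //.
    rewrite lt_neqAle hmin // andbT; apply/negP => /eqP e.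
    case: (once u v uS vS uv n3 (esym e)) => [e5|[e5 e6]]; first by rewrite e5 eqxx in n1.
    by rewrite e5 e6 eqxx in n2.
- move=> e u v ein uS vS uv; have := inv_x I ein uS vS uv; rewrite insym.
  case: ifP => h h'; last by case/norP => _ /norP[_]; exact: h'.
  case/or3P => [/eqP[-> ->]|/eqP[-> ->]|]; last exact: h'.
    exact: hents.
  by rewrite e4; exact: hents.
Qed.

Lemma stop_after ents l out s : inv ents l out -> s \in S -> start s \in ents -> stop s \in ents.
Proof.
move=> I sS h; apply: contraT => h'.
have := inv_order I (stop_in sS) h' h.
by rewrite /qlt /= (lft_rgt sS).
Qed.

Lemma mem_split (T : eqType) (x : T) (l : seq T) : x \in l -> exists l1 l2, l = l1 ++ x :: l2.
Proof. by case/splitPr => l1 l2; exists l1, l2. Qed.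

Section Entry.
Variables (q : query) (rest : seq query) (l : seq seg) (out : seq (seg * seg)).
Hypothesis I : inv (q :: rest) l out.
Hypothesis hx : forall u v, u \in S -> v \in S -> xing u v -> (u, v) \notin sym out -> X q.1 < cx u v.

Let qin : q \in allents. Proof. by apply: (inv_sub I); rewrite mem_head. Qed.
Let q_rest : q \notin rest. Proof. by have /andP[] := inv_uniq I. Qed.
Lemma rest_after e : e \in rest -> ~~ qlt e q.
Proof.
have h : transitive (fun x y : query => ~~ qlt y x) := @qle_trans R.
by have := order_path_min h (inv_sorted I) => /allP; apply.
Qed.

Lemma inv_x_rest e u v : e \in allents -> u \in S -> v \in S -> xing u v ->
  if e \in rest then (u, v) \in sym out -> cx u v < X e.1 else (u, v) \notin sym out -> X e.1 < cx u v.
Proof.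
move=> ein uS vS uv; have := inv_x I ein uS vS uv; rewrite inE.
case: eqP => //= -> _; rewrite (negbTE q_rest); exact: hx.
Qed.

Lemma inv_order_rest e e' : e \in allents -> e \notin rest -> e' \in rest -> ~~ qlt e' e.
Proof.
move=> ein er er'; have [->|n] := eqVneq e q; first exact: rest_after.
by apply: (inv_order I) => //; rewrite inE ?er' ?orbT // negb_or n.
Qed.

(** Segments that end together have equal heights at the end. Of two such segments the lower one is
    the steeper one, and this is what the tie-break for deletions tests. *)
Lemma step_stop s : s \in S -> q = stop s ->
  exists l1 l2, [/\ l = l1 ++ s :: l2, inv rest (l1 ++ l2) out,
     all (qB q) l1 & all (predC (qB q)) (s :: l2)].
Proof.
move=> sS eq_; have [c [sl st_ sp xc]] := inv_c I.
have sts : start s \notin q :: rest.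
  rewrite inE negb_or; apply/andP; split; first by rewrite eq_; apply/eqP => -[].
  by apply/negP => /rest_after; rewrite eq_ /qlt /= (lft_rgt sS).
have sin : s \in l by rewrite (inv_mem I) sS sts -eq_ mem_head.
have [l1 [l2 el]] := mem_split sin; have sl' := sl; rewrite el in sl'.
have [h1 h2] := pairwise_lt_mem sl'.
have eX : X q.1 = XR s by rewrite eq_.
have csX : c < XR s by apply: sp; rewrite // -eq_ mem_head.
have reach z : z \in l -> [/\ z \in S, XL z < c, c < XR z & XR s <= XR z].
  rewrite (inv_mem I) => /and3P[zS z1 z2]; split; [by [] | exact: st_ | exact: sp |].
  rewrite -eX; apply: (@qle_X q (stop z)) => //; first exact: stop_in.
  by move: z2; rewrite inE => /orP[/eqP->|/rest_after//]; have := qle_total q q; rewrite orbb.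
have nx u v : u \in S -> v \in S -> xing u v -> ~~ (c < cx u v <= XR s).
  move=> uS vS uv; apply/negP => /andP[x1 x2].
  have := xc u v uS vS uv; case: ifPn => [_|h _]; first by lra.
  by have := hx uS vS uv h; rewrite eX; lra.
have keep u v : u \in l -> v \in l -> Y u c < Y v c ->
   Y u (XR s) < Y v (XR s) \/ (Y u (XR s) = Y v (XR s) /\ slope v < slope u).
  move=> /reach[uS u1 u2 u3] /reach[vS v1 v2 v3] uv.
  case: (order_keep uS vS csX (ltW u1) u3 (ltW v1) v3 uv); [by move=> ?; exact: nx | by left |].
  move=> [e _ _]; right; split=> //; move: uv e; rewrite /Y => uv e.
  have : (slope v - slope u) * (XR s - c) < 0 by lra.
  by rewrite pmulr_llt0 ?subr_gt0 // subr_lt0.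
have Ys : Y s (XR s) = q.1.2 by rewrite Y_rgt // eq_.
have Bz z : z \in S -> qB q z = (Y z (XR s) < q.1.2) || ((Y z (XR s) == q.1.2) && (slope s < slope z)).
  by move=> zS; rewrite qBE ?eq_.
exists l1, l2; split=> //.
- split.
  + exact: path_sorted (inv_sorted I).
  + by case/andP: (inv_uniq I).
  + by move=> e er; apply: (inv_sub I); rewrite inE er orbT.
  + exact: inv_order_rest.
  + move=> z; have un := pairwise_uniq sl'.
    have [->|zs] := eqVneq z s.
      rewrite -eq_ (negbTE q_rest) !andbF.
      by move: un; rewrite -cat1s uniq_catCA /= => /andP[/negbTE].
    have := inv_mem I z; rewrite el !mem_cat !inE (negbTE zs) /= => ->.
    have -> : (start z == q) = false by apply/eqP; rewrite eq_.
    have -> : (stop z == q) = false by apply/eqP; rewrite eq_ => -[_ e]; rewrite e eqxx in zs.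
    by [].
  + exact: inv_usym I.
  + exact: inv_out I.
  + exists c; split=> //.
    * apply: subseq_pairwise sl'; apply: cat_subseq => //; exact: subseq_cons.
    * move=> z zS h; apply: st_ => //; rewrite inE negb_or h andbT.
      by apply/eqP; rewrite eq_.
    * by move=> z zS h; apply: sp; rewrite // inE h orbT.
  + exact: inv_x_rest.
- apply/allP => z zl; have zin : z \in l by rewrite el mem_cat zl.
  have [zS _ _ _] := reach z zin; rewrite Bz //.
  by case: (keep z s zin sin (h1 z zl)) => [|[-> ->]]; rewrite Ys ?eqxx ?orbT // => ->.
- apply/allP => z; rewrite inE => /orP[/eqP->|zl] /=; first by rewrite Bz // Ys !ltxx andbF.
  have zin : z \in l by rewrite el mem_cat inE zl !orbT.
  have [zS _ _ _] := reach z zin; rewrite Bz //.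
  case: (keep s z sin zin (h2 z zl)) => [|[e h]].
    by rewrite Ys => h; rewrite ltNge (ltW h) /= gt_eqF.
  by rewrite -e Ys ltxx eqxx /= -leNgt ltW.
Qed.

(** The place of s is the one it has just after its beginning, at [d]. A segment through the
    beginning is compared by slope; with equal slopes the two would still coincide at [d]. *)
Lemma step_start s : s \in S -> q = start s ->
  exists l1 l2, [/\ l = l1 ++ l2, inv rest (l1 ++ s :: l2) out,
     all (qB q) l1 & all (predC (qB q)) l2].
Proof.
move=> sS eq_; have [c [sl st_ sp xc]] := inv_c I.
have eX : X q.1 = XL s by rewrite eq_.
have stop_rest z : z \in S -> stop z \in q :: rest -> stop z \in rest.
  by move=> zS; rewrite inE => /orP[/eqP|//]; rewrite eq_.
have sps : stop s \in rest.
  apply: stop_rest => //; apply: stop_after I sS _; by rewrite -eq_ mem_head.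
have past z : z \in S -> stop z \in rest -> XL s < XR z.
  move=> zS h; have := rest_after h; rewrite eq_ /qlt /= andbT negb_or => /andP[h1 h2].
  apply: X_mono; [exact: lft_pts | exact: rgt_pts |].
  by move: h1; rewrite lexltNge => /orP[//|/eqP e]; rewrite -e eqxx in h2.
(* If other segments began in the same point, c may already lie beyond [XL s]; hence the maximum. *)
have [d [d1 d2 d3]] := events_gap (Num.max c (XL s)).
have [cd sd] : c < d /\ XL s < d by move: d1; rewrite gt_max => /andP[].
have dR z : z \in S -> stop z \in rest -> d < XR z.
  move=> zS h; apply: (d2 (stop z)); first exact: stop_in.
  by rewrite gt_max (past z zS h) sp // inE h orbT.
have dx u v : u \in S -> v \in S -> xing u v -> (u, v) \notin sym out -> d < cx u v.
  move=> uS vS uv h; apply: d3 => //; rewrite gt_max -eX hx // andbT.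
  by have := xc u v uS vS uv; rewrite (negbTE h).
have reach z : z \in l -> [/\ z \in S, XL z < c, XL z <= XL s, d < XR z & z != s].
  rewrite (inv_mem I) => /and3P[zS z1 z2]; split=> //; first exact: st_.
  - rewrite -eX; apply: (@qle_X (start z) q) => //; first exact: start_in.
    by apply: (inv_order I); rewrite ?mem_head //; exact: start_in.
  - by apply: dR => //; exact: stop_rest.
  - by apply: contraNneq z1 => ->; rewrite -eq_ mem_head.
have sd_ : pairwise (fun u v => Y u d < Y v d) l.
  apply: (pairwise_sub sl) => u v ul vl uv.
  apply: (keep_order I sl _ cd ul vl uv).
    by move=> z zl; have [_ z1 _ z2 _] := reach z zl.
  have [uS _ _ _ _] := reach u ul; have [vS _ _ _ _] := reach v vl.
  apply/negP => /andP[xuv /andP[x1 x2]].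
  have := xc u v uS vS xuv; case: ifPn => [_|h _]; first by lra.
  by have := dx u v uS vS xuv h; lra.
have nx z : z \in S -> (xing s z -> d < cx s z).
  move=> zS sz; apply: dx => //; apply/negP => h.
  have := inv_x I (start_in sS) sS zS sz; rewrite -eq_ mem_head => /(_ h).
  by rewrite eX; have [/andP[h1 _] _] := xing_X sS zS sz; lra.
have dRs : d < XR s by apply: dR.
have Ys : Y s (XL s) = q.1.2 by rewrite Y_lft eq_.
have cmp z : z \in l -> (qB q z = (Y z d < Y s d)) /\ Y z d != Y s d.
  move=> zl; have [zS z1 z2 z3 zs] := reach z zl.
  have Bz : qB q z = (Y z (XL s) < q.1.2) || ((Y z (XL s) == q.1.2) && (slope z < slope s)).
    by rewrite qBE ?eq_.
  have sz_nx : xing s z -> ~~ (XL s < cx s z <= d).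
    by move=> h; apply/negP => /andP[_ h1]; have := nx z zS h; lra.
  have zs_nx : xing z s -> ~~ (XL s < cx z s <= d).
    by move=> h; rewrite cx_sym //; apply: sz_nx; rewrite xing_sym.
  rewrite Bz -Ys; case: (ltgtP (Y z (XL s)) (Y s (XL s))) => h /=.
  - case: (order_keep zS sS sd z2 (ltW z3) (lexx _) (ltW dRs) h zs_nx) => [k|[_ e _]].
      by rewrite k lt_eqF.
    by rewrite e ltxx in z3.
  - case: (order_keep sS zS sd (lexx _) (ltW dRs) z2 (ltW z3) h sz_nx) => [k|[_ e _]].
      by rewrite ltNge (ltW k) /= gt_eqF.
    by rewrite e ltxx in dRs.
  - have hd w : Y w d = Y w (XL s) + slope w * (d - XL s) by rewrite /Y; ring.
    have hs : slope z != slope s.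
      apply/eqP => e.
      have eY : Y z d = Y s d by rewrite !hd h e.
      have r1 : XL z <= d <= XR z by apply/andP; split; lra.
      have r2 : XL s <= d <= XR s by apply/andP; split; lra.
      case: (meetP zS sS zs r1 r2 eY) => [[_ e1]|[xzs e1]].
        have : P s d \notin [:: s.2.1; s.2.2] by apply: interior => //; rewrite X_P sd.
        by rewrite -{1}[P s d]/(P s d) /P -eY -/(P z d) in e1 *; rewrite e1.
      by have := zs_nx xzs; rewrite -e1 sd lexx.
    rewrite !hd h ltrD2l ltr_pM2r ?subr_gt0 //; split=> //.
    rewrite (inj_eq (addrI _)); apply: contra hs => /eqP /mulIf -> //.
    by rewrite subr_eq0 gt_eqF.
have [l1 [l2 [el h1 h2]]] := split_below (Y s d) sd_.
exists l1, l2; split=> //.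
- split.
  + exact: path_sorted (inv_sorted I).
  + by case/andP: (inv_uniq I).
  + by move=> e er; apply: (inv_sub I); rewrite inE er orbT.
  + exact: inv_order_rest.
  + move=> z; have [->|zs] := eqVneq z s.
      by rewrite mem_cat mem_head orbT sS sps -eq_ q_rest.
    have := inv_mem I z; rewrite el !mem_cat !inE (negbTE zs) /= => ->.
    have -> : (start z == q) = false by apply/eqP; rewrite eq_ => -[_ e]; rewrite e eqxx in zs.
    have -> : (stop z == q) = false by apply/eqP; rewrite eq_.
    by [].
  + exact: inv_usym I.
  + exact: inv_out I.
  + exists d; split=> //.
    * move: sd_; rewrite el !pairwise_cat /= allrel_consr => /and3P[-> -> ->].
      rewrite h1 /= !andbT; apply/allP => z zl; rewrite lt_neqAle eq_sym.
      have zin : z \in l by rewrite el mem_cat zl orbT.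
      by have [_ ->] := cmp z zin; move/allP: h2; apply.
    * move=> z zS h; have [->//|zs] := eqVneq z s.
      apply: lt_trans cd; apply: st_ => //; rewrite inE negb_or h andbT.
      by apply/eqP; rewrite eq_ => -[_ e]; rewrite e eqxx in zs.
    * move=> u v uS vS uv; have := xc u v uS vS uv; case: ifPn => h h'; last exact: dx.
      by apply: lt_trans cd.
  + exact: inv_x_rest.
- apply/allP => z zl; have zin : z \in l by rewrite el mem_cat zl.
  by have [-> _] := cmp z zin; move/allP: h1; apply.
- apply/allP => z zl /=; have zin : z \in l by rewrite el mem_cat zl orbT.
  by have [-> _] := cmp z zin; rewrite -leNgt; move/allP: h2; apply.
Qed.

End Entry.
End Sweep.

(** * The sweep reports every crossing once *)

Section SweepCorrect.
Variable R : realType.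
Local Open Scope ring_scope.
Notation pt := (R * R)%type.
Notation seg := (nat * (pt * pt))%type.
Notation query := (pt * (bool * seg))%type.
Notation summary := (option ((seg * seg) * option (pt * (seg * seg)))).

Variable S : seq seg.
Hypothesis S_uniq : uniq S.
Hypothesis S_nondeg : forall s, s \in S -> s.2.1 != s.2.2.
Hypothesis S_meet : forall s t P, s \in S -> t \in S -> s != t -> onseg s P -> onseg t P ->
  (P \in [:: s.2.1; s.2.2] /\ P \in [:: t.2.1; t.2.2]) \/ (xing s t /\ P = xpt s t).
Hypothesis S_triangle : forall s t u, s \in S -> t \in S -> u \in S ->
  xing s t -> xing t u -> xing s u -> False.

Definition crossings := [seq p <- [seq (u, v) | u <- S, v <- S] | xing p.1 p.2].
Hypothesis S_count : (size crossings <= (size S).*2)%N.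

Lemma mem_crossings u v : ((u, v) \in crossings) = [&& xing u v, u \in S & v \in S].
Proof.
rewrite mem_filter; congr (_ && _); apply/allpairsP/andP => [[[a b] [/= aS bS [-> ->]]]//|[uS vS]].
by exists (u, v).
Qed.

Section Fixed.
Variable eps : R.
Hypothesis X_mono : forall p q, p \in ends_of S ++ xpts S -> q \in ends_of S ++ xpts S -> lexlt p q -> X eps p < X eps q.
Local Notation X := (X eps).
Local Notation cx := (cx eps).
Local Notation inv := (inv S eps).

(** By [S_meet], an end of s on u is an end of u as well, unless s and u cross there, and then it is
    inside s; but the crossing lies inside u. Entries and crossings are thus never simultaneous and
    need no rule for ties. *)
Lemma xpt_not_end u v e : u \in S -> v \in S -> xing u v -> e \in allents S -> cx u v != X e.1.
Proof.
move=> uS vS uv ein; apply/eqP => ex.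
have {ex} ep : xpt u v = e.1 by apply: (X_inj X_mono); rewrite ?xpt_pts ?ent_pts.
have [s sS es] := allentsP ein.
have eend : e.1 \in [:: s.2.1; s.2.2] by case: es => ->; [exact: lft_in | exact: rgt_in].
have ons : onseg s e.1.
  move: eend; rewrite !inE => /orP[]/eqP->; [exists 0 | exists 1]; rewrite ?lexx ?ler01 //.
    by case: (s.2.1) => a b; rewrite /along /= !mul0r !addr0.
  by case: (s.2.1) (s.2.2) => a b [c d]; rewrite /along /=; congr (_, _); ring.
have [hu _] := xing_X S_nondeg X_mono uS vS uv.
have nu := interior uS hu.
have [us|us] := eqVneq u s; first by rewrite ep us eend in nu.
have [onu _] := xpt_onseg S_nondeg X_mono uS vS uv.
rewrite ep in onu nu; case: (S_meet uS sS us onu ons) => [[h _]|[h1 h2]]; first by rewrite h in nu.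
have h1' : xing s u by rewrite xing_sym.
have [hs _] := xing_X S_nondeg X_mono sS uS h1'.
have := interior sS hs; rewrite -xpt_sym; last by case/and5P: h1.
by rewrite -h2 eend.
Qed.

Definition sinv (st : seq query * (tree seg summary * seq (seg * seg))) :=
  augok (@sspec R) st.2.1 /\ inv st.1 (elems st.2.1) st.2.2.

Lemma out_size ents l out : inv ents l out -> (size out <= size S)%N.
Proof.
move=> I; have h : (size (sym out) <= size crossings)%N.
  apply: uniq_leq_size (inv_usym I) _ => -[u v] /(inv_out I)[uS vS uv].
  by rewrite mem_crossings uS vS uv.
by move: h S_count; rewrite /sym size_cat size_map; lia.
Qed.

(** A round uses up an entry or reports a new crossing; the measure counts both. *)
Lemma sstep_inv st : sinv st -> sinv (sstep st) /\
  (st.1 != [::] -> size (sstep st).1 + (size S - size (sstep st).2.2) < size st.1 + (size S - size st.2.2))%N.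
Proof.
case: st => [[|q rest] [t out]] [ok I] //=.
pose l := elems t; rewrite -/l in I.
rewrite /sstep /=.
have qin : q \in allents S by apply: (inv_sub I); rewrite mem_head.
have qmin e : e \in q :: rest -> X q.1 <= X e.1.
  move=> h; apply: (qle_X X_mono) => //; first exact: (inv_sub I).
  by move: h; rewrite inE => /orP[/eqP->|/(rest_after I)//]; have := qle_total q q; rewrite orbb.
have [c [sl st_ sp xc]] := inv_c I.
have lS z : z \in l -> z \in S by rewrite (inv_mem I) => /andP[].
have augl : aug (@slm R) t = sspec l by apply: augE ok; exact: slm_spec.
have best1 e : sbest (aug (@slm R) t) = Some e -> exists l1 u v l2,
    [/\ l = l1 ++ u :: v :: l2, e = (xpt u v, (u, v)), odet u v < 0, xing u v & (u, v) \notin sym out].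
  rewrite augl; case el : l => [//|a l'] /= /bestc_Some[l1 [u [v [l2 [e1 e2 e3]]]]].
  exists l1, u, v, l2; rewrite e1; split=> //; move: e2; rewrite /cand; case: ifP => // /andP[od xuv] _ //.
  have uS : u \in S by apply: lS; rewrite el e1 mem_cat mem_head orbT.
  have vS : v \in S by apply: lS; rewrite el e1 mem_cat !inE eqxx !orbT.
  have [_ h2] : (forall x, x \in l1 -> Y eps x c < Y eps u c) /\ (forall x, x \in v :: l2 -> Y eps u c < Y eps x c).
    by apply: pairwise_lt_mem; rewrite -e1 -el.
  have uv := h2 v (mem_head _ _).
  have [_ y1] := xing_X S_nondeg X_mono uS vS xuv.
  have xvu : xing v u by rewrite xing_sym.
  have [_ y2] := xing_X S_nondeg X_mono vS uS xvu.
  have exp : xpt u v = xpt v u by apply: xpt_sym; case/and5P: xuv.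
  rewrite -(cx_sym _ xuv) -exp in y2.
  rewrite (odet_lt0 S_nondeg X_mono uS vS) in od.
  (* A reported crossing lies before c. Beyond it the steeper segment u is above v, contrary to the
     order of the status at c. *)
  apply/negP => h; have := xc u v uS vS xuv; rewrite h => cc.
  have hd w : Y eps w c = Y eps w (cx u v) + slope eps w * (c - cx u v) by rewrite /Y; ring.
  move: uv; rewrite !hd y1 y2 ltrD2l.
  have : slope eps u * (c - cx u v) > slope eps v * (c - cx u v) by rewrite ltr_pM2r // subr_gt0.
  lra.
(* If an unreported crossing precedes the next entry, the first unreported one belongs to neighbours
   in the status. It is thus a candidate, and [sbest] is not later. *)
have best2 u v : u \in S -> v \in S -> xing u v -> (u, v) \notin sym out -> cx u v < X q.1 ->
    exists a b e, [/\ a \in S, b \in S, sbest (aug (@slm R) t) = Some e, ~~ lexlt (xpt a b) e.1 &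
      cx a b <= cx u v /\ forall u' v', u' \in S -> v' \in S -> xing u' v' -> (u', v') \notin sym out ->
        cx a b <= cx u' v'].
  move=> uS vS uv nuv cq.
  have uvin : (u, v) \in [seq p <- crossings | p \notin sym out].
    by rewrite mem_filter nuv mem_crossings uv uS.
  have [[u0 v0] + hm] := seq_min (fun p => cx p.1 p.2) uvin.
  rewrite mem_filter mem_crossings => /andP[n0 /and3P[x0 u0S v0S]].
  have hm' u' v' : u' \in S -> v' \in S -> xing u' v' -> (u', v') \notin sym out -> cx u0 v0 <= cx u' v'.
    by move=> h1 h2 h3 h4; apply: (hm (u', v')); rewrite mem_filter h4 mem_crossings h3 h1.
  have hle := hm _ uvin; rewrite /= in hle.
  have hents e : e \in q :: rest -> cx u0 v0 < X e.1.
    by move=> /qmin h; apply: le_lt_trans hle _; apply: lt_le_trans h.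
  have [a [b [l1 [l2 [el eab aS bS ca]]]]] :=
    next_adjacent S_nondeg S_meet S_triangle X_mono I u0S v0S x0 n0 hents hm'.
  have cab : cx a b = cx u0 v0 by case: eab => -[-> ->] //; rewrite -cx_sym.
  move: augl; rewrite el => augl.
  case e0 : (l1 ++ a :: b :: l2) => [|d l']; first by move/(congr1 size): e0; rewrite size_cat /= addnS.
  have [e' e1 e2] := bestc_min (esym e0) ca.
  exists a, b, e'; split=> //; first by rewrite augl e0.
  by rewrite cab; split.
have nonlt h : lexlt h q.1 -> h \in ends_of S ++ xpts S -> X h < X q.1.
  by move=> h1 h2; apply: X_mono => //; exact: ent_pts.
have other : (if sbest (aug (@slm R) t) is Some e then lexlt e.1 q.1 else false) = false ->
    sinv (rest, (supd q t, out)).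
  move=> noe.
  have hx u v : u \in S -> v \in S -> xing u v -> (u, v) \notin sym out -> X q.1 < cx u v.
    move=> uS vS uv nuv; rewrite ltNge le_eqVlt (negbTE (xpt_not_end uS vS uv qin)) /=.
    apply/negP => h; have [a [b [e [aS bS e1 e2 [e3 _]]]]] := best2 u v uS vS uv nuv h.
    move: noe; rewrite e1.
    have : lexlt (xpt a b) q.1 by rewrite -(X_lt X_mono) ?xpt_pts ?ent_pts //; apply: le_lt_trans h.
    by move: e2; rewrite lexltNge => /orP[e2 h1|/eqP->->//]; rewrite (lexlt_trans e2 h1).
  split; first by apply: upd_augok ok; [exact: slm_spec | exact: smul_spec].
  have [s sS [eq_|eq_]] := allentsP qin.
    have [l1 [l2 [el I' b1 b2]]] := step_start S_nondeg S_meet X_mono I hx sS eq_.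
    suff -> : elems (supd q t) = l1 ++ s :: l2 by [].
    apply: (@upd_insert _ _ _ _ _ (@sspec R)) ok el b1 b2 _; [exact: slm_spec | exact: slst0 | exact: slst_spec |].
    by move=> o; rewrite /qact eq_ /=; case: o.
  have [l1 [l2 [el I' b1 b2]]] := step_stop S_nondeg S_meet X_mono I hx sS eq_.
  suff -> : elems (supd q t) = l1 ++ l2 by [].
  apply: (@upd_delete _ _ _ _ _ (@sspec R)) ok el b1 b2 _; [exact: slm_spec | exact: slst0 | exact: slst_spec |].
  by move=> o; rewrite /qact eq_.
case be : (sbest _) other => [e|] other; last first.
  by split; [exact: other | move=> _; rewrite /=; lia].
case: ifPn => [lt_eq|/negbTE lt_eq]; last first.
  by split; [exact: other | move=> _; rewrite /=; lia].
have [l1 [u [v [l2 [el ee od xuv nuv]]]]] := best1 e be; subst e; rewrite /= in lt_eq *.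
have uS : u \in S by apply: lS; rewrite el mem_cat mem_head orbT.
have vS : v \in S by apply: lS; rewrite el mem_cat !inE eqxx !orbT.
have cq : cx u v < X q.1 by apply: nonlt => //; exact: xpt_pts.
have [a [b [e [aS bS e1 e2 [e3 e4]]]]] := best2 u v uS vS xuv nuv cq.
move: e1; rewrite be => -[e1]; subst e; rewrite /= in e2.
have le_uv : cx u v <= cx a b.
  move: e2; rewrite lexltNge => /orP[e2|/eqP e2]; last by rewrite /cx e2.
  by apply: ltW; apply: X_mono e2; exact: xpt_pts.
have hents e : e \in q :: rest -> cx u v < X e.1.
  by move=> /qmin h; apply: lt_le_trans cq h.
have hmin u' v' : u' \in S -> v' \in S -> xing u' v' -> (u', v') \notin sym out -> cx u v <= cx u' v'.
  by move=> h1 h2 h3 h4; apply: le_trans le_uv (e4 u' v' h1 h2 h3 h4).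
rewrite el in I.
have [I' b1 b2 b3 b4] := step_cross S_nondeg S_meet S_triangle X_mono I uS vS xuv od nuv hents hmin.
have out_le := out_size I'.
set t1 := supd (xpt u v, (false, u)) t.
have ok1 : augok (@sspec R) t1 by apply: upd_augok ok; [exact: slm_spec | exact: smul_spec].
have el1 : elems t1 = l1 ++ v :: l2.
  by apply: (@upd_delete _ _ _ _ _ (@sspec R)) ok el b1 b2 _; [exact: slm_spec | exact: slst0 | exact: slst_spec |].
have el2 : elems (supd (xpt u v, (true, u)) t1) = (l1 ++ [:: v]) ++ u :: l2.
  apply: (@upd_insert _ _ _ _ _ (@sspec R)) ok1 _ b3 b4 _; [exact: slm_spec | exact: slst0 | exact: slst_spec | |].
    by rewrite el1 -catA.
  by move=> o; rewrite /qact /=; case: o.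
split; last first.
  by move=> _; rewrite ltn_add2l; exact: ltn_sub2l.
split; first by apply: upd_augok ok1; [exact: slm_spec | exact: smul_spec].
by rewrite /= el2 -catA.
Qed.

Lemma sstep_iter n st : sinv st -> sinv (iter n (@sstep R) st) /\
  (size st.1 + (size S - size st.2.2) <= n -> (iter n (@sstep R) st).1 = [::])%N.
Proof.
elim: n st => [|n IH] st I; rewrite ?iterSr.
  by split=> //=; rewrite leqn0 addn_eq0 size_eq0 => /andP[/eqP].
have [I' h] := sstep_inv I; have [h1 h2] := IH _ I'; split=> // le_n.
have [e|/h] := eqVneq st.1 [::]; last by move=> h3; apply: h2; rewrite -ltnS; exact: leq_trans h3 le_n.
have fix_ : sstep st = st by case: st e {I I' h h1 h2 le_n} => [[|q ents] [t out]].
rewrite fix_; suff -> : iter n (@sstep R) st = st by [].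
by elim: n {IH h1 h2 le_n} => //= n ->.
Qed.

Lemma perm_entries : perm_eq (entries S) (allents S).
Proof.
have [_ [_ h]] := sort_tree_ok (@qle_total R) (@qle_trans R) (foldl (fun es s => start s :: stop s :: es) [::] S).
apply: perm_trans h _; rewrite -[X in perm_eq _ X]cats0 /allents -catA.
elim: S [::] => [|s T IH] es /=; first by rewrite perm_refl.
apply: perm_trans (IH _) _.
rewrite perm_sym; apply/permP => p; do 4!rewrite ?count_cat /=; lia.
Qed.

Lemma uniq_allents : uniq (allents S).
Proof.
rewrite cat_uniq !map_inj_uniq ?S_uniq; try by move=> a b [].
rewrite andbT /=; apply/hasPn => e /mapP[s _ ->]; apply/negP => /mapP[s' _].
by case.
Qed.

Lemma inv_init : inv (entries S) [::] [::].
Proof.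
have pe := perm_entries; have me := perm_mem pe.
have [_ [so _]] := sort_tree_ok (@qle_total R) (@qle_trans R) (foldl (fun es s => start s :: stop s :: es) [::] S).
have [c [c1 c2]] : exists c, (forall e, e \in allents S -> c < X e.1) /\
   (forall u v, u \in S -> v \in S -> c < cx u v).
  pose vs := 0 :: [seq X p | p <- ends_of S ++ xpts S].
  have [v _ h] := seq_min (fun v : R => v) (mem_head 0 _ : 0 \in vs).
  exists (v - 1); split=> [e ein|u w uS wS].
    have := h (X e.1); rewrite inE map_f ?orbT ?ent_pts // => /(_ isT) h'.
    by apply: lt_le_trans h'; rewrite ltrBlDr ltrDl.
  have := h (X (xpt u w)); rewrite inE map_f ?orbT ?xpt_pts // => /(_ isT) h'.
  by apply: lt_le_trans h'; rewrite ltrBlDr ltrDl.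
split=> //.
- by rewrite (perm_uniq pe) uniq_allents.
- by move=> e; rewrite me.
- by move=> e e' ein; rewrite me ein.
- move=> s; rewrite me in_nil; case sS : (s \in S) => //=.
  by rewrite start_in.
- exists c; split=> //.
  + by move=> s sS; rewrite me start_in.
  + by move=> s sS _; apply: (c1 (stop s)); exact: stop_in.
  + by move=> u v uS vS _; rewrite in_nil; exact: c2.
- by move=> e u v ein uS vS _; rewrite me ein in_nil.
Qed.

Lemma sweep_correct_fixed : uniq (sym (sweep S)) /\
  forall u v, ((u, v) \in sym (sweep S)) = [&& u \in S, v \in S & xing u v].
Proof.
have I0 : sinv (entries S, (Leaf None, [::])) by split=> //; exact: inv_init.
have [[_ I] e] := sstep_iter (3 * size S)%N I0.
rewrite e in I; last first.
  by rewrite /= (perm_size perm_entries) size_cat !size_map; lia.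
split; first exact: inv_usym I.
move=> u v; apply/idP/and3P => [/(inv_out I)[]//|[uS vS uv]].
(* No entry is left, so [inv_x] would put an unreported crossing behind the right end of u. *)
apply: contraT => h.
have := inv_x I (stop_in uS) uS vS uv => /= /(_ h).
have [/andP[_ h2] _] := xing_X S_nondeg X_mono uS vS uv.
by rewrite /= -/(XR eps u); lra.
Qed.

End Fixed.

Lemma sweep_correct : uniq (sym (sweep S)) /\
  forall u v, ((u, v) \in sym (sweep S)) = [&& u \in S, v \in S & xing u v].
Proof.
have [e _ h] := shear_exists (ends_of S ++ xpts S).
exact: (sweep_correct_fixed h).
Qed.

End SweepCorrect.

(** * Dynamic programming *)

Section DP.
Variable R : realType.
Local Open Scope ring_scope.

Notation assignment := (nat -> R * R).
Notation rope := (tree (nat * (R * R)) unit).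
(* The ink of a set of stubs and the stubs themselves, to be read off a tree. *)
Notation sol := (R * rope)%type.
Notation psol := (R * (rope * R))%type.
(* Best solutions for the crossings met so far along an edge from its source:
   before, inside and after the gap. Those inside remember where it began. *)
Notation acc := (option sol * (option psol * option sol))%type.

Definition sol0 : sol := (0, Leaf None).
(** Concatenation in constant time. The height 0 is a dummy, as these trees are only read off at the
    end. *)
Definition join (r1 r2 : rope) : rope := Node 0 tt r1 r2.
Definition addsol (a b : sol) : sol := (a.1 + b.1, join a.2 b.2).
Definition maxsol (a b : option sol) : option sol :=
  if a is Some x then if b is Some y then if x.1 < y.1 then b else a else a else b.
Definition maxpsol (a b : option psol) : option psol :=
  if a is Some x then if b is Some y then if x.1 < y.1 then b else a else a else b.

Definition close (s : nat) (len tau : R) (a : option psol) : option sol :=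
  if a is Some x then
    Some (x.1 + len * (1 - tau), join x.2.1 (Leaf (Some (s, (x.2.2, 1 - tau))))) else None.

Definition acc0 : acc := (Some sol0, (None, None)).

Definition cover (U : option sol) (a : option sol) : option sol :=
  if a is Some x then if U is Some u then Some (addsol x u) else None else None.
Definition advance (F : sol) (a : option psol) : option psol :=
  if a is Some x then Some (x.1 + F.1, (join x.2.1 F.2, x.2.2)) else None.
Definition open_gap (len tau : R) (F : sol) (a : option sol) : option psol :=
  if a is Some x then Some (x.1 + F.1 + len * tau, (join x.2 F.2, tau)) else None.

(** [P1] includes a gap that opens at this very crossing, and it may be closed here as well: both
    stubs then end at the crossing and, being half-open, do not contain it. *)
Definition pass (s : nat) (len tau : R) (F : sol) (U : option sol) (a : acc) : acc :=
  let P1 := maxpsol (advance F a.2.1) (open_gap len tau F a.1) in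
  (cover U a.1, (P1, maxsol (cover U a.2.2) (close s len tau P1))).

(* An edge without crossings is drawn in full; this only occurs when it is the
   only edge. *)
Definition finish (s : nat) (len : R) (a : acc) : sol :=
  if a.2.2 is Some x then x else (len, Leaf (Some (s, (1 / 2, 1 / 2)))).

Definition cov (f : assignment) (s : nat) (tau : R) : bool := (tau < (f s).1) || (1 - tau < (f s).2).
Definition okf (x : R * R) : bool := [&& 0 < x.1, 0 < x.2 & x.1 + x.2 <= 1].
Definition agrees (f : assignment) (r : rope) : Prop := forall e, e \in elems r -> f e.1 = e.2.

Lemma agrees_join f r1 r2 : agrees f (join r1 r2) <-> agrees f r1 /\ agrees f r2.
Proof.
split=> [h|[h1 h2] e /=]; last by rewrite mem_cat => /orP[/h1|/h2].
by split=> e he; apply: h; rewrite /= mem_cat he ?orbT.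
Qed.

(* A crossing of the edge s with another edge t together with the meaning of
   the solutions F and U for the part of the tree beyond t. *)
Record gitem := Item {
  gtau : R; gF : sol; gU : option sol;
  gok : assignment -> Prop;       (* validity beyond t *)
  gun : assignment -> Prop;       (* moreover t does not cover the crossing *)
  gink : assignment -> R;
  gnodes : seq nat
}.

Definition keys (r : rope) := [seq e.1 | e <- elems r].

Definition gsound (g : gitem) : Prop :=
  [/\ 0 < gtau g < 1,
      perm_eq (keys (gF g).2) (gnodes g),
      forall f, agrees f (gF g).2 -> gok g f /\ gink g f = (gF g).1 &
      forall u, gU g = Some u -> perm_eq (keys u.2) (gnodes g) /\
        forall f, agrees f u.2 -> [/\ gok g f, gun g f & gink g f = u.1]].

Section Pass.
Variables (s : nat) (len : R).
Hypothesis len0 : 0 <= len.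

Definition passes (gs : seq gitem) : acc :=
  foldl (fun a g => pass s len (gtau g) (gF g) (gU g) a) acc0 gs.

Definition gsum (gs : seq gitem) f := \sum_(g <- gs) gink g f.
Definition gall (gs : seq gitem) := flatten [seq gnodes g | g <- gs].

Definition Forall (P : gitem -> Prop) gs := foldr (fun g Q => P g /\ Q) True gs.
Lemma Forall_rcons P gs g : Forall P (rcons gs g) <-> Forall P gs /\ P g.
Proof. by elim: gs => /= [|a gs ->]; tauto. Qed.
Lemma Forall_impl (P Q : gitem -> Prop) gs : (forall g, P g -> Q g) -> Forall P gs -> Forall Q gs.
Proof. by move=> h; elim: gs => //= g gs IH [/h h1 /IH h2]. Qed.
Lemma Forall_and (P Q : gitem -> Prop) gs : Forall P gs -> Forall Q gs -> Forall (fun g => P g /\ Q g) gs.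
Proof. by elim: gs => //= g gs IH [h1 /IH h2] [h3 /h2 h4]. Qed.

Notation before g gs := (Forall (fun h => gtau h < gtau g) gs).
Fixpoint increasing (gs : seq gitem) : Prop :=
  if gs is g :: gs' then Forall (fun h => gtau g < gtau h) gs' /\ increasing gs' else True.
Lemma increasing_rcons gs g : increasing (rcons gs g) <-> increasing gs /\ before g gs.
Proof.
elim: gs => /= [|a gs ->]; first by tauto.
rewrite Forall_rcons; tauto.
Qed.

Lemma gsum_rcons gs g f : gsum (rcons gs g) f = gsum gs f + gink g f.
Proof. by rewrite /gsum -cats1 big_cat big_seq1. Qed.
Lemma gall_rcons gs g : gall (rcons gs g) = gall gs ++ gnodes g.
Proof. by rewrite /gall map_rcons flatten_rcons. Qed.

Definition sound0 gs (x : sol) := perm_eq (keys x.2) (gall gs) /\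
  forall f, agrees f x.2 -> Forall (fun g => gok g f /\ gun g f) gs /\ x.1 = gsum gs f.
(** The gap begins no later than some crossing already met. Hence later crossings lie beyond the
    source stub, and closing the gap at one of them keeps the sum of the fractions at most 1. *)
Definition sound1 gs (x : psol) := [/\ perm_eq (keys x.2.1) (gall gs), 0 < x.2.2,
  (exists2 g, g \in [seq gtau g | g <- gs] & x.2.2 <= g) &
  forall f, agrees f x.2.1 -> Forall (fun g => gok g f /\ (gtau g < x.2.2 -> gun g f)) gs /\
    x.1 = gsum gs f + len * x.2.2].
Definition sound2 gs (x : sol) := perm_eq (keys x.2) (s :: gall gs) /\
  forall f, agrees f x.2 -> [/\ okf (f s), Forall (fun g => gok g f /\ (cov f s (gtau g) -> gun g f)) gs &
    x.1 = gsum gs f + len * ((f s).1 + (f s).2)].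

Lemma keys_join r1 r2 : keys (join r1 r2) = keys r1 ++ keys r2.
Proof. by rewrite /keys map_cat. Qed.

Lemma sound_rcons0 gs g x u : sound0 gs x -> gsound g -> gU g = Some u -> sound0 (rcons gs g) (addsol x u).
Proof.
move=> [h1 h2] [_ _ _ h3] /h3[h4 h5]; split; first by rewrite keys_join gall_rcons perm_cat.
move=> f /agrees_join[/h2[a1 a2] /h5[b1 b2 b3]].
by rewrite Forall_rcons gsum_rcons /= a2 b3.
Qed.

Lemma sound_passes gs : Forall gsound gs -> increasing gs ->
  [/\ forall x, (passes gs).1 = Some x -> sound0 gs x,
      forall x, (passes gs).2.1 = Some x -> sound1 gs x &
      forall x, (passes gs).2.2 = Some x -> sound2 gs x].
Proof.
elim/last_ind: gs => [|gs g IH] /=.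
  move=> _ _; split=> // x [<-]; split=> // f _; by rewrite /gsum big_nil.
rewrite Forall_rcons increasing_rcons => -[gsG gG] [gsI gI].
have [{}IH0 IH1 IH2] := IH gsG gsI.
have [/andP[t0 t1] kF sF sU] := gG.
rewrite /passes foldl_rcons -/(passes gs); set a := passes gs in IH0 IH1 IH2 *.
have S1 : forall x, (pass s len (gtau g) (gF g) (gU g) a).2.1 = Some x -> sound1 (rcons gs g) x.
  have A x : advance (gF g) a.2.1 = Some x -> sound1 (rcons gs g) x.
    rewrite /advance; case E : (a.2.1) => [y|] // [<-]; have [b1 b2 [t b3 b3'] b4] := IH1 _ E; split=> //=.
    - by rewrite keys_join gall_rcons perm_cat.
    - by exists t => //; rewrite map_rcons mem_rcons inE b3 orbT.
    move=> f /agrees_join[/b4[c1 c2] /sF[d1 d2]]; rewrite Forall_rcons gsum_rcons c2 d2; split; last by ring.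
    split=> //; split=> // lt_t; exfalso.
    have : t < gtau g.
      elim: gs gI b3 {IH gsG gsI IH0 IH1 IH2 E a b1 b4 c1 c2} => //= h gs IH [i1 i2].
      by rewrite inE => /orP[/eqP->//|]; exact: IH.
    by move=> t_lt; have := lt_trans (lt_le_trans lt_t b3') t_lt; rewrite ltxx.
  have B x : open_gap len (gtau g) (gF g) a.1 = Some x -> sound1 (rcons gs g) x.
    rewrite /open_gap; case E : (a.1) => [y|] // [<-]; have [b1 b2] := IH0 _ E; split=> //=.
    - by rewrite keys_join gall_rcons perm_cat.
    - by exists (gtau g); rewrite // map_rcons mem_rcons mem_head.
    move=> f /agrees_join[/b2[c1 c2] /sF[d1 d2]]; rewrite Forall_rcons gsum_rcons c2 d2; split=> //.
    split; last by split=> //; rewrite ltxx.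
    by apply: Forall_impl c1 => h [].
  move=> x; rewrite /pass /= /maxpsol.
  case E1 : (advance _ _) => [y1|]; case E2 : (open_gap _ _ _ _) => [y2|] //.
  - by case: ifP => _ [<-]; [exact: B | exact: A].
  - by move=> [<-]; exact: A.
  - by move=> [<-]; exact: B.
split=> //.
  move=> x; rewrite /pass /= /cover; case E : (a.1) => [y|] //; case Eu : (gU g) => [u|] // [<-].
  exact: sound_rcons0 (IH0 _ E) gG Eu.
move=> x; rewrite [(pass _ _ _ _ _ _).2.2]/(maxsol _ _).
set c := close _ _ _ _.
have C y : c = Some y -> sound2 (rcons gs g) y.
  rewrite /c /close; case E : (maxpsol _ _) => [z|] // [<-].
  have [b1 b2 [t b3 b3'] b4] := S1 _ E.
  have tg : t <= gtau g.
    rewrite map_rcons mem_rcons inE in b3; case/orP: b3 => [/eqP->//|b3].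
    elim: gs gI b3 {IH gsG gsI IH0 IH1 IH2 E c a S1 b1 b4} => //= h gs IH [i1 i2].
    by rewrite inE => /orP[/eqP->|]; [exact: ltW | exact: IH].
  split.
    by rewrite keys_join /= cats1 perm_rcons perm_cons.
  move=> f /agrees_join[/b4[c1 c2]] /(_ _ (mem_head _ _)) /= fs; rewrite fs /=.
  split.
  - by rewrite /okf /= b2; apply/andP; split; lra.
  - have : Forall (fun h => gtau h <= gtau g) (rcons gs g).
      by rewrite Forall_rcons; split=> //; apply: Forall_impl gI => h /ltW.
    move=> /(Forall_and c1); apply: Forall_impl => h [[h1 h2] h3]; split=> //.
    by rewrite /cov fs /= => /orP[/h2//|]; lra.
  - by rewrite c2; ring.
rewrite /maxsol.
case E1 : (cover _ _) => [y1|]; last by exact: C.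
have D : sound2 (rcons gs g) y1.
  move: E1; rewrite /cover; case E : (a.2.2) => [y|] //; case Eu : (gU g) => [u|] // [<-].
  have [b1 b2] := IH2 _ E; have [b3 b4] := sU _ Eu; split.
    by rewrite keys_join gall_rcons -cat_cons perm_cat.
  move=> f /agrees_join[/b2[c1 c2 c3] /b4[d1 d2 d3]]; split=> //; first by apply/Forall_rcons.
  by rewrite gsum_rcons /= c3 d3; ring.
case E2 : c => [y2|]; last by move=> [<-].
by case: ifP => _ [<-] //; exact: C.
Qed.

(** [None] plays the role of minus infinity. *)
Definition oge (o : option sol) (v : R) := exists2 x, o = Some x & v <= x.1.
Definition poge (o : option psol) (v : R) := exists2 x, o = Some x & v <= x.1.

Lemma oge_maxl a b v : oge a v -> oge (maxsol a b) v.
Proof.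
move=> [x -> h]; rewrite /maxsol; case: b => [y|]; last by exists x.
case: ifP => h'; last by exists x.
by exists y => //; apply: le_trans h (ltW h').
Qed.
Lemma oge_maxr a b v : oge b v -> oge (maxsol a b) v.
Proof.
move=> [y -> h]; rewrite /maxsol; case: a => [x|]; last by exists y.
case: ifPn => h'; first by exists y.
by exists x => //; apply: le_trans h _; rewrite leNgt.
Qed.
Lemma poge_maxl a b v : poge a v -> poge (maxpsol a b) v.
Proof.
move=> [x -> h]; rewrite /maxpsol; case: b => [y|]; last by exists x.
case: ifP => h'; last by exists x.
by exists y => //; apply: le_trans h (ltW h').
Qed.
Lemma poge_maxr a b v : poge b v -> poge (maxpsol a b) v.
Proof.
move=> [y -> h]; rewrite /maxpsol; case: a => [x|]; last by exists y.
case: ifPn => h'; first by exists y.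
by exists x => //; apply: le_trans h _; rewrite leNgt.
Qed.

(* Along s, an assignment first covers crossings from the source, then leaves
   some uncovered, and then covers the rest from the other end. If it covers
   everything, it is no better than with a gap at any one crossing. *)
Lemma passes_opt gs f : increasing gs -> okf (f s) ->
  Forall (fun g => gink g f <= (gF g).1) gs ->
  Forall (fun g => cov f s (gtau g) -> oge (gU g) (gink g f)) gs ->
  [/\ Forall (fun g => gtau g < (f s).1) gs -> oge (passes gs).1 (gsum gs f),
      Forall (fun g => 1 - gtau g >= (f s).2) gs -> ~ Forall (fun g => gtau g < (f s).1) gs ->
        poge (passes gs).2.1 (gsum gs f + len * (f s).1) &
      gs <> [::] -> oge (passes gs).2.2 (gsum gs f + len * ((f s).1 + (f s).2))].
Proof.
move=> + /and3P[f0 f1 f2]; elim/last_ind: gs => [|gs g IH].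
  move=> _ _ _; split=> // _; first by exists sol0; rewrite // /gsum big_nil.
rewrite increasing_rcons 2!Forall_rcons => -[gsI gI] [FF gF'] [UU gU'].
have [{}IH0 IH1 IH2] := IH gsI FF UU.
rewrite /passes foldl_rcons -/(passes gs); set a := passes gs in IH0 IH1 IH2 *.
set tau := gtau g.
have S1 v : (poge a.2.1 (v - gink g f) \/ oge a.1 (v - gink g f - len * tau)) ->
    poge (pass s len tau (gF g) (gU g) a).2.1 v.
  case=> [[x ex h]|[x ex h]]; rewrite /pass /= /advance /open_gap ex.
    by apply: poge_maxl; eexists; [reflexivity | rewrite /=; lra].
  by apply: poge_maxr; eexists; [reflexivity | rewrite /=; lra].
have S2 v : poge (pass s len tau (gF g) (gU g) a).2.1 (v - len * (1 - tau)) ->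
    oge (pass s len tau (gF g) (gU g) a).2.2 v.
  set b := pass _ _ _ _ _ _; case=> x ex h.
  have -> : b.2.2 = maxsol (cover (gU g) a.2.2) (close s len tau b.2.1) by [].
  apply: oge_maxr; rewrite ex.
  by eexists; [reflexivity | rewrite /=; lra].
have lenle : len * ((f s).1 + (f s).2) <= len by rewrite ler_piMr.
(* Opening and closing the gap at g uses the whole length of s, at least as much as f does, and
   beyond g the unconstrained optimum is available. *)
have single : Forall (fun h => gtau h < (f s).1) gs ->
    oge (pass s len tau (gF g) (gU g) a).2.2 (gsum (rcons gs g) f + len * ((f s).1 + (f s).2)).
  move=> /IH0 [x ex h]; apply: S2; apply: S1; right; exists x => //.
  rewrite gsum_rcons; lra.
rewrite !gsum_rcons.
split.
- move=> /Forall_rcons[/IH0 [x ex h] lt_tau].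
  have [|u eu h'] := gU'; first by rewrite /cov lt_tau.
  by rewrite /pass /= /cover ex eu; eexists; [reflexivity | rewrite /=; lra].
- move=> /Forall_rcons[c1 c2] nb.
  have [b|nb'] := pselect (Forall (fun h => gtau h < (f s).1) gs).
    have ge_tau : (f s).1 <= tau by rewrite leNgt; apply/negP => h; apply: nb; apply/Forall_rcons.
    have [x ex h] := IH0 b; apply: S1; right; exists x => //.
    have : len * (f s).1 <= len * tau by rewrite ler_wpM2l.
    lra.
  have [x ex h] := IH1 c1 nb'; apply: S1; left; exists x => //; lra.
- move=> _; rewrite -gsum_rcons.
  have [b|nb] := pselect (Forall (fun h => gtau h < (f s).1) gs); first exact: single.
  have gs0 : gs <> [::] by move=> e; apply: nb; rewrite e.
  have [c|nc] := ltP (1 - tau) (f s).2.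
    have [x ex h] := IH2 gs0.
    have [|u eu h'] := gU'; first by rewrite /cov c orbT.
    have -> : (pass s len tau (gF g) (gU g) a).2.2 = maxsol (cover (gU g) a.2.2)
      (close s len tau (pass s len tau (gF g) (gU g) a).2.1) by [].
    apply: oge_maxl; rewrite /cover ex eu.
    by eexists; [reflexivity | rewrite gsum_rcons /=; lra].
  have c' : Forall (fun h => 1 - gtau h >= (f s).2) gs.
    by apply: Forall_impl gI => h; rewrite -/tau; lra.
  have [x ex h] := IH1 c' nb; apply: S2; apply: S1; left; exists x => //.
  have : len * (f s).2 <= len * (1 - tau) by rewrite ler_wpM2l.
  rewrite gsum_rcons; lra.
Qed.

End Pass.
End DP.

(** * The recursion over the tree of crossings *)

Section Solve.
Variable R : realType.
Local Open Scope ring_scope.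
Notation assignment := (nat -> R * R).
Notation rope := (tree (nat * (R * R)) unit).
Notation sol := (R * rope)%type.
Notation acc := (option sol * (option (R * (rope * R)) * option sol))%type.

(* The first accumulator leaves the crossing with the parent unconstrained, the
   second one forbids to cover it. *)
Definition pass_parent (s : nat) (len tau : R) (a : acc * acc) : acc * acc :=
  (pass s len tau (sol0 R) (Some (sol0 R)) a.1, pass s len tau (sol0 R) None a.2).
Definition pass_child (s : nat) (len tau : R) (r : sol * sol) (a : acc * acc) : acc * acc :=
  (pass s len tau r.1 (Some r.2) a.1, pass s len tau r.1 (Some r.2) a.2).
Definition finishes (s : nat) (len : R) (a : acc * acc) : sol * sol :=
  (finish s len a.1, finish s len a.2).

Variables (adj : nat -> seq (R * nat)) (len : nat -> R).

(* The first argument bounds the depth of the recursion; p is the parent. *)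
Fixpoint solve (n : nat) (s : nat) (p : option nat) : sol * sol :=
  if n is n'.+1 then
    finishes s (len s) (foldl (fun a it =>
      if Some it.2 == p then pass_parent s (len s) it.1 a
      else pass_child s (len s) it.1 (solve n' it.2 (Some s)) a) (acc0 R, acc0 R) (adj s))
  else (sol0 R, sol0 R).

Fixpoint nodes (n : nat) (s : nat) (p : option nat) : seq nat :=
  if n is n'.+1 then
    s :: flatten [seq if Some it.2 == p then [::] else nodes n' it.2 (Some s) | it <- adj s]
  else [::].

(** The fuel n suffices: no branch of the recursion comes down to 0. *)
Fixpoint good (n : nat) (s : nat) (p : option nat) : Prop :=
  if n is n'.+1 then forall it, it \in adj s -> Some it.2 != p -> good n' it.2 (Some s)
  else False.

(** [pos t s] is the position along t of its crossing with s. *)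
Variable pos : nat -> nat -> R.

Fixpoint okT (n : nat) (s : nat) (p : option nat) (f : assignment) : Prop :=
  if n is n'.+1 then okf (f s) /\ forall it, it \in adj s -> Some it.2 != p ->
    okT n' it.2 (Some s) f /\ ~~ (cov f s it.1 && cov f it.2 (pos it.2 s))
  else True.

Definition inkT n s p (f : assignment) := \sum_(v <- nodes n s p) len v * ((f v).1 + (f v).2).

Hypothesis len0 : forall s, 0 <= len s.
Hypothesis adj_pos : forall s it, it \in adj s -> it.1 = pos s it.2 /\ 0 < it.1 < 1.
Hypothesis adj_sorted : forall s, sorted <%R [seq it.1 | it <- adj s].
Hypothesis adj_sym : forall s it, it \in adj s -> exists2 it', it' \in adj it.2 & it'.2 = s.

(** The parent becomes an item without ink and without nodes. For [b = false] it has no [gU], and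
    [gun] is false, which forces the scan to leave that crossing uncovered; so one analysis of the
    scan serves both F and U. *)
Definition git (n : nat) (s : nat) (p : option nat) (b : bool) (it : R * nat) : gitem R :=
  if Some it.2 == p then
    Item it.1 (sol0 R) (if b then Some (sol0 R) else None) (fun=> True) (fun=> b) (fun=> 0) [::]
  else
    let r := solve n it.2 (Some s) in
    Item it.1 r.1 (Some r.2) (okT n it.2 (Some s)) (fun f => ~~ cov f it.2 (pos it.2 s))
      (inkT n it.2 (Some s)) (nodes n it.2 (Some s)).
Definition gits n s p b := [seq git n s p b it | it <- adj s].

Lemma gtau_git n s p b it : gtau (git n s p b it) = it.1.
Proof. by rewrite /git; case: ifP. Qed.

Lemma solve_passes n s p : solve n.+1 s p =
  (finish s (len s) (passes s (len s) (gits n s p true)), finish s (len s) (passes s (len s) (gits n s p false))).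
Proof.
rewrite /= /finishes /passes /gits.
suff h b0 b1 : foldl (fun a it => if Some it.2 == p then pass_parent s (len s) it.1 a
      else pass_child s (len s) it.1 (solve n it.2 (Some s)) a) (b0, b1) (adj s) =
  (foldl (fun a g => pass s (len s) (gtau g) (gF g) (gU g) a) b0 [seq git n s p true it | it <- adj s],
   foldl (fun a g => pass s (len s) (gtau g) (gF g) (gU g) a) b1 [seq git n s p false it | it <- adj s]).
  by rewrite h.
elim: (adj s) b0 b1 => //= it its IH b0 b1; rewrite /git.
by case: ifP => _; rewrite IH.
Qed.

Lemma Forall_map (P : gitem R -> Prop) (h : R * nat -> gitem R) (xs : seq (R * nat)) :
  Forall P [seq h x | x <- xs] <-> forall x, x \in xs -> P (h x).
Proof.
elim: xs => //= x xs ->; split=> [[h1 h2] y|H].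
  by rewrite inE => /orP[/eqP->|/h2].
by split=> [|y ys]; apply: H; rewrite inE ?eqxx ?ys ?orbT.
Qed.

Lemma gits_increasing n s p b : increasing (gits n s p b).
Proof.
have := adj_sorted s; rewrite /gits; elim: (adj s) => //= it its IH pi; split; last exact: IH (path_sorted pi).
apply/Forall_map => it' h; rewrite !gtau_git.
have /allP := order_path_min lt_trans pi; apply; exact: map_f.
Qed.

(** It is always possible to leave every crossing uncovered, so a missing [gU] never blocks the
    scan. *)
Lemma passes_some s l (gs : seq (gitem R)) : gs <> [::] -> exists x, (passes s l gs).2.2 = Some x.
Proof.
elim/last_ind: gs => // gs g IH _; rewrite /passes foldl_rcons -/(passes s l gs).
set a := passes s l gs in IH *.
have h : (exists x, a.1 = Some x) \/ (exists x, a.2.1 = Some x).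
  rewrite /a; elim/last_ind: gs {IH a} => [|gs g' [[x e]|[x e]]]; first by left; exists (sol0 R).
    right; rewrite /passes foldl_rcons -/(passes s l gs) /pass /= /open_gap e.
    by rewrite /maxpsol; case: (advance _ _) => [y|]; [case: ifP => _|]; eexists.
  right; rewrite /passes foldl_rcons -/(passes s l gs) /pass /= /advance e.
  by rewrite /maxpsol; case: (open_gap _ _ _ _) => [y|]; [case: ifP => _|]; eexists.
have [x e] : exists x, maxpsol (advance (gF g) a.2.1) (open_gap l (gtau g) (gF g) a.1) = Some x.
  case: h => [[x e]|[x e]]; rewrite /advance /open_gap e /maxpsol.
    by case: (match a.2.1 with Some _ => _ | None => _ end) => [y|]; [case: ifP => _|]; eexists.
  by case: (match a.1 with Some _ => _ | None => _ end) => [y|]; [case: ifP => _|]; eexists.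
rewrite /pass /= e /maxsol; case: (cover _ _) => [y|]; [case: ifP => _|]; by eexists.
Qed.

Lemma nodes_gall n s p b : nodes n.+1 s p = s :: gall (gits n s p b).
Proof.
rewrite /= /gall /gits -map_comp; congr (_ :: flatten _); apply: eq_map => it /=.
by rewrite /git; case: ifP.
Qed.

Lemma inkT_gsum n s p b f : inkT n.+1 s p f = len s * ((f s).1 + (f s).2) + gsum (gits n s p b) f.
Proof.
rewrite /inkT /= big_cons; congr (_ + _); rewrite big_flatten /= big_map /gsum /gits big_map.
by apply: eq_bigr => it _; rewrite /git; case: ifP => //= _; rewrite big_nil.
Qed.

Definition Fsound n s p := perm_eq (keys (solve n s p).1.2) (nodes n s p) /\
  forall f, agrees f (solve n s p).1.2 -> okT n s p f /\ inkT n s p f = (solve n s p).1.1.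
Definition Usound n s p q := perm_eq (keys (solve n s p).2.2) (nodes n s p) /\
  forall f, agrees f (solve n s p).2.2 -> [/\ okT n s p f, ~~ cov f s (pos s q) &
    inkT n s p f = (solve n s p).2.1].

Lemma solve_sound n s p : good n s p -> Fsound n s p /\
  forall it, p = Some it.2 -> it \in adj s -> Usound n s p it.2.
Proof.
elim: n s p => // n IH s p g.
have gs_sound b : Forall (@gsound R) (gits n s p b).
  apply/Forall_map => it itin; have [_ t01] := adj_pos itin.
  rewrite /git; case: eqP => [e|/eqP ne].
    by split=> //=; case: b => // u [<-]; split.
  have [[h1 h2] h3] := IH it.2 (Some s) (g it itin ne).
  have [it' h4 h5] := adj_sym itin; subst s.
  by split=> //= u [<-]; apply: h3.
have okT_of b f : okf (f s) -> Forall (fun g => gok g f /\ (cov f s (gtau g) -> gun g f)) (gits n s p b) ->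
    okT n.+1 s p f.
  move=> h1 h2; split=> // it itin ne; move/Forall_map: h2 => /(_ it itin).
  rewrite gtau_git /git (negbTE ne) /= => -[h2 h3]; split=> //.
  by apply/negP => /andP[/h3 /negbTE ->].
have body b : let x := finish s (len s) (passes s (len s) (gits n s p b)) in
    perm_eq (keys x.2) (nodes n.+1 s p) /\ forall f, agrees f x.2 ->
    [/\ okT n.+1 s p f, (forall it, p = Some it.2 -> it \in adj s -> ~~ b -> ~~ cov f s it.1) & inkT n.+1 s p f = x.1].
  rewrite (nodes_gall n s p b) /finish.
  have [e0|ne] := pselect (gits n s p b = [::]).
    have a0 : adj s = [::] by move: e0; rewrite /gits; case: (adj s).
    rewrite e0; split=> // f /(_ _ (mem_head _ _)) fs.
    have k : okf (f s) by rewrite fs /okf /=; apply/and3P; split; lra.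
    rewrite (inkT_gsum n s p b) e0 /gsum big_nil fs; split.
    - by apply: (okT_of b) => //; rewrite e0.
    - by move=> it _; rewrite a0.
    - by rewrite /=; field.
  have [x ex] := passes_some s (len s) ne.
  have [_ _ /(_ x ex)] := @sound_passes _ s (len s) _ (gs_sound b) (gits_increasing n s p b).
  rewrite ex => -[h1 h2]; split=> // f /h2[h3 h4 h5]; split.
  - exact: okT_of h4.
  - move=> it ep itin nb; move/Forall_map: h4 => /(_ it itin).
    rewrite gtau_git /git -ep eqxx /= => -[_]; case: (b) nb => // _.
    by case: (cov f s it.1) => // /(_ isT).
  - by rewrite (inkT_gsum n s p b) h5 addrC.
have [hT1 hT2] := body true; have [hF1 hF2] := body false.
rewrite /Fsound /Usound solve_passes; split.
  by split=> // f /hT2[].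
move=> it ep itin; split=> // f /hF2[h1 h2 h3]; split=> //.
by have [<- _] := adj_pos itin; apply: h2.
Qed.

Lemma solve_opt n s p f : good n s p -> okT n s p f -> inkT n s p f <= (solve n s p).1.1 /\
  forall it, p = Some it.2 -> it \in adj s -> ~~ cov f s it.1 -> inkT n s p f <= (solve n s p).2.1.
Proof.
elim: n s p => // n IH s p g [ks kc].
have body b : (forall it, p = Some it.2 -> it \in adj s -> ~~ b -> ~~ cov f s it.1) ->
    inkT n.+1 s p f <= (finish s (len s) (passes s (len s) (gits n s p b))).1.
  move=> hb; rewrite (inkT_gsum n s p b) addrC.
  have h1 : Forall (fun g => gink g f <= (gF g).1) (gits n s p b).
    apply/Forall_map => it itin; rewrite /git; case: eqP => //= /eqP ne.
    by have [k1 k2] := kc it itin ne; have [] := IH _ _ (g it itin ne) k1.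
  have h2 : Forall (fun g => cov f s (gtau g) -> oge (gU g) (gink g f)) (gits n s p b).
    apply/Forall_map => it itin; rewrite gtau_git /git; case: eqP => [e|/eqP ne] c.
      case: b hb {h1} => hb /=; first by exists (sol0 R).
      by have := hb it (esym e) itin isT; rewrite c.
    have [k1 k2] := kc it itin ne; rewrite c /= in k2.
    have [it' h4 h5] := adj_sym itin; have [h6 _] := adj_pos h4.
    rewrite /=; eexists; first reflexivity.
    have [_ h7] := IH _ _ (g it itin ne) k1.
    by apply: (h7 it') => //; rewrite ?h5 // h6 h5.
  have [_ _ h3] := passes_opt (len0 s) (gits_increasing n s p b) ks h1 h2.
  rewrite /finish; have [e0|ne] := pselect (gits n s p b = [::]).
    rewrite e0 /= /gsum big_nil add0r.
    by case/and3P: ks => _ _ k; rewrite ler_piMr.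
  by have [x -> h] := h3 ne.
rewrite solve_passes; split; first exact: body.
move=> it ep itin nc; apply: body => it' ep' itin' _.
suff -> : it'.1 = it.1 by [].
have [-> _] := adj_pos itin; have [-> _] := adj_pos itin'.
by move: ep'; rewrite ep => -[->].
Qed.

Section Leaves.
Local Open Scope nat_scope.

Definition acc_leaves (B : nat) (a : acc) : Prop :=
  [/\ forall x, a.1 = Some x -> leaves x.2 <= B, forall x, a.2.1 = Some x -> leaves x.2.1 <= B
    & forall x, a.2.2 = Some x -> leaves x.2 <= B.+1].

Lemma pass_leaves B C s l tau (F : sol) U (a : acc) : acc_leaves B a -> leaves F.2 <= C ->
  (forall u, U = Some u -> leaves u.2 <= C) -> acc_leaves (B + C) (pass s l tau F U a).
Proof.
case: a => [a0 [a1 a2]] [/= h0 h1 h2] hF hU.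
have cov_leaves D (o : option sol) : (forall x, o = Some x -> leaves x.2 <= D) ->
    forall x, cover U o = Some x -> leaves x.2 <= D + C.
  move=> h x; case: o h => // y /(_ y erefl) hy; case: U hU => // u /(_ u erefl) hu [<-] /=.
  exact: leq_add.
have P1 x : maxpsol (advance F a1) (open_gap l tau F a0) = Some x -> leaves x.2.1 <= B + C.
  have adv y : advance F a1 = Some y -> leaves y.2.1 <= B + C.
    by case: a1 h1 => // z /(_ z erefl) hz [<-]; exact: leq_add.
  have opn y : open_gap l tau F a0 = Some y -> leaves y.2.1 <= B + C.
    by case: a0 h0 => // z /(_ z erefl) hz [<-]; exact: leq_add.
  move: adv opn; case: (advance _ _) => [y|]; case: (open_gap _ _ _ _) => [z|] //= hy hz.
  - by case: ifP => _ e; [exact: hz | exact: hy].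
  - exact: hy.
  - exact: hz.
split=> //=; first exact: cov_leaves.
have cl x : close s l tau (maxpsol (advance F a1) (open_gap l tau F a0)) = Some x -> leaves x.2 <= (B + C).+1.
  by case: (maxpsol _ _) P1 => // y /(_ y erefl) hy [<-] /=; rewrite addn1.
move=> x; move: (cov_leaves _ _ h2) cl; rewrite addSn.
case: (cover U a2) => [y|]; case: (close _ _ _ _) => [z|] //= hy hz.
- by case: ifP => _ e; [exact: hz | exact: hy].
- exact: hy.
- exact: hz.
Qed.

(** Each edge contributes its own entry, the empty leaf at the start of its scan and possibly the
    empty leaf for its parent, hence the factor 3. Reading off a solution costs time linear in the
    leaves. *)
Lemma solve_leaves (adj_uniq : forall s, uniq [seq it.2 | it <- adj s]) n s p : good n s p ->
  leaves (solve n s p).1.2 <= 3 * size (nodes n s p) /\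
  leaves (solve n s p).2.2 <= 3 * size (nodes n s p).
Proof.
elim: n s p => // n IH s p g.
pose w (it : R * nat) := if Some it.2 == p then 1 else 3 * size (nodes n it.2 (Some s)).
have H its a B : {subset its <= adj s} -> acc_leaves B a.1 -> acc_leaves B a.2 ->
    let r := foldl (fun a it => if Some it.2 == p then pass_parent s (len s) it.1 a
      else pass_child s (len s) it.1 (solve n it.2 (Some s)) a) a its in
    acc_leaves (B + \sum_(it <- its) w it) r.1 /\ acc_leaves (B + \sum_(it <- its) w it) r.2.
  elim: its a B => [|it its IHi] a B sub h1 h2 /=; first by rewrite big_nil addn0.
  have itin := sub it (mem_head _ _).
  rewrite big_cons addnA /w; case: eqP => [_|/eqP ne].
    apply: IHi; [by move=> x h; apply: sub; rewrite inE h orbT | |];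
      by apply: pass_leaves => // u [<-].
  have [l1 l2] := IH _ _ (g it itin ne).
  apply: IHi; [by move=> x h; apply: sub; rewrite inE h orbT | |];
    by apply: pass_leaves => // u [<-].
have h0 : acc_leaves 1 (acc0 R) by split=> // x [<-].
have [] := H (adj s) (acc0 R, acc0 R) 1 (fun _ h => h) h0 h0.
have ws : (\sum_(it <- adj s) w it).+2 <= 3 * size (nodes n.+1 s p).
  rewrite /= mulnS size_flatten /shape -map_comp sumnE big_map big_distrr /=.
  have cnt : count (fun it => Some it.2 == p) (adj s) <= 1.
    case: p {g w H} => [q|]; last by rewrite (eq_count (a2 := pred0)) ?count_pred0.
    have -> : count (fun it => Some it.2 == Some q) (adj s) = count_mem q [seq it.2 | it <- adj s].
      by rewrite count_map; apply: eq_count => x /=.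
    by rewrite count_uniq_mem ?adj_uniq //; case: (_ \in _).
  rewrite -sum1_count big_mkcond /= in cnt.
  have -> : \sum_(it <- adj s) w it = \sum_(it <- adj s) (if Some it.2 == p then 1 else 0) +
     \sum_(it <- adj s) 3 * size (if Some it.2 == p then [::] else nodes n it.2 (Some s)).
    by rewrite -big_split; apply: eq_bigr => it _; rewrite /w /=; case: ifP; rewrite /= ?muln0.
  lia.
set r := foldl _ _ _ => h1 h2.
have fin a : acc_leaves (1 + \sum_(it <- adj s) w it) a -> leaves (finish s (len s) a).2 <= 3 * size (nodes n.+1 s p).
  case=> _ _; rewrite /finish; case: a.2.2 => [x|] h /=; last by rewrite mulnS.
  by apply: leq_trans (h x erefl) _; rewrite add1n.
by split; apply: fin.
Qed.

End Leaves.

End Solve.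

(** * Adjacency lists in a search tree, and the recursion as a loop *)

Section Machine.
Variable R : realType.
Notation rope := (tree (nat * (R * R)) unit).
Notation sol := (R * rope)%type.
Notation acc := (option sol * (option (R * (rope * R)) * option sol))%type.

(* The value of an edge is its length and its crossings in order. *)
Notation entry := (nat * (R * seq (R * nat)))%type.
Notation mtree := (tree entry (option entry)).
Notation mquery := (nat * (R * option (R * nat)))%type.

Definition mB (q : mquery) (e : entry) : bool := e.1 < q.1.
Definition mact (q : mquery) (o : option entry) : option entry * option (option entry) :=
  match q.2.2 with
  | None => act_insert (if o is Some e then mB q e else false) (q.1, (q.2.1, [::])) o
  | Some r => (if o is Some e then
                 if e.1 == q.1 then Some (e.1, (e.2.1, r :: e.2.2)) else Some e
               else None, None)
  end.
Definition mupd := upd (id : option entry -> option entry) (@mulL entry) id mB mact.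
Definition mfind (s : nat) (t : mtree) : R * seq (R * nat) :=
  if find (id : option entry -> option entry) id mB (s, (0%R, None)) t is Some e then e.2 else (0%R, [::]).

Definition msorted (l : seq entry) := sorted ltn [seq e.1 | e <- l].

Lemma msplit (l : seq entry) k : msorted l ->
  exists l1 l2, [/\ l = l1 ++ l2, all (fun e => e.1 < k) l1 & all (fun e => k <= e.1) l2].
Proof.
rewrite /msorted; elim: l => [_|a l IH /= pl]; first by exists [::], [::].
have [l1 [l2 [e h1 h2]]] := IH (path_sorted pl).
have [ak|ka] := ltnP a.1 k; first by exists (a :: l1), l2; rewrite e /= ak.
exists [::], (a :: l); split=> //=; rewrite ka /=.
have := order_path_min ltn_trans pl; rewrite all_map.
by apply: sub_all => x /= h; apply: ltnW (leq_ltn_trans ka h).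
Qed.

Definition minv (t : mtree) (g : nat -> option (R * seq (R * nat))) :=
  [/\ augok (@specL entry) t, msorted (elems t) & forall e, (e \in elems t) = (g e.1 == Some e.2)].

Lemma msorted_cat (l1 l2 : seq entry) : msorted (l1 ++ l2) =
  [&& msorted l1, msorted l2 & allrel (fun a b => a.1 < b.1) l1 l2].
Proof.
rewrite /msorted map_cat !(sorted_pairwise ltn_trans) pairwise_cat andbC.
rewrite -andbA; do 2!congr (_ && _); rewrite /allrel all_map; apply: eq_all => a /=.
by rewrite all_map.
Qed.

Lemma minv_insert t g s len : minv t g -> g s = None ->
  minv (mupd (s, (len, None)) t) (fun u => if u == s then Some (len, [::]) else g u).
Proof.
move=> [ok so me] gs; have [l1 [l2 [el h1 h2]]] := msplit s so.
have b2 : all (predC (mB (s, (len, None)))) l2 by apply: sub_all h2 => e /=; rewrite /mB -leqNgt.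
have ee : elems (mupd (s, (len, None)) t) = l1 ++ (s, (len, [::])) :: l2.
  apply: (@upd_insert _ _ _ _ _ (@specL entry)) ok el h1 b2 _;
    [exact: specL_lm | by [] | exact: specL_rcons |].
  by move=> o; rewrite /mact /=; case: o.
split.
- by apply: upd_augok ok; [exact: specL_lm | exact: specL_mul].
- have ns e : e \in elems t -> e.1 != s.
    by rewrite me; apply: contraTneq => ->; rewrite gs.
  move: so; rewrite ee -cat1s !msorted_cat el msorted_cat /= => /and3P[-> -> h3].
  rewrite allrel_consl allrel_consr h3 /= !andbT; apply/andP; split; last exact: h1.
  by apply/allP => e h; rewrite ltn_neqAle eq_sym ns ?(allP h2) // el mem_cat h orbT.
- move=> [u v]; rewrite ee mem_cat inE /=; have [->|ne] := eqVneq u s.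
    have -> : ((s, v) \in l1) = false.
      by apply/negP => h; have := allP h1 _ h; rewrite ltnn.
    have -> : ((s, v) \in l2) = false.
      apply/negP => h; have : (s, v) \in elems t by rewrite el mem_cat h orbT.
      by rewrite me gs.
    rewrite orbF xpair_eqE eqxx /=; apply/eqP/eqP => [->//|[->]//].
  by rewrite xpair_eqE (negbTE ne) /= -mem_cat -el me.
Qed.

Lemma minv_push t g s r len adj : minv t g -> g s = Some (len, adj) ->
  minv (mupd (s, (0%R, Some r)) t) (fun u => if u == s then Some (len, r :: adj) else g u).
Proof.
move=> [ok so me] gs; have [l1 [l2 [el h1 h2]]] := msplit s so.
have b2 : all (predC (mB (s, (0%R, Some r)))) l2 by apply: sub_all h2 => e /=; rewrite /mB -leqNgt.
have : (s, (len, adj)) \in elems t by rewrite me gs.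
rewrite el mem_cat => /orP[h|h]; first by have := allP h1 _ h; rewrite ltnn.
case: l2 h h2 b2 el => // e l2 h h2 b2 el.
have ee : e = (s, (len, adj)).
  move: h; rewrite inE => /orP[/eqP->//|h].
  move: so; rewrite el msorted_cat => /and3P[_ + _]; rewrite -cat1s msorted_cat => /and3P[_ _].
  rewrite /allrel /= andbT => /allP /(_ _ h) /=; case/andP: h2 => h2 _.
  by rewrite ltnNge h2.
subst e.
have eu : elems (mupd (s, (0%R, Some r)) t) = l1 ++ (s, (len, r :: adj)) :: l2.
  apply: (@upd_replace _ _ _ _ _ (@specL entry)) ok el h1 b2 _;
    [exact: specL_lm | by [] | exact: specL_rcons |].
  by rewrite /mact /= eqxx.
split.
- by apply: upd_augok ok; [exact: specL_lm | exact: specL_mul].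
- by move: so; rewrite eu el /msorted !map_cat.
- move=> [u v]; have := me (u, v); rewrite eu el !mem_cat !inE /=.
  have nl1 w : ((s, w) \in l1) = false.
    by apply/negP => h'; have := allP h1 _ h'; rewrite ltnn.
  have nl2 w : ((s, w) \in l2) = false.
    apply/negP => h'; move: so; rewrite el msorted_cat => /and3P[_ + _].
    rewrite -cat1s msorted_cat => /and3P[_ _]; rewrite /allrel /= andbT => /allP /(_ _ h') /=.
    by rewrite ltnn.
  have [->|ne] := eqVneq u s; last by rewrite !xpair_eqE (negbTE ne).
  by move=> _; rewrite nl1 nl2 orbF xpair_eqE eqxx /= eq_sym; apply/eqP/eqP => [->//|[->]].
Qed.

Lemma mfindP t g s v : minv t g -> g s = Some v -> mfind s t = v.
Proof.
move=> [ok so me] gs; have [l1 [l2 [el h1 h2]]] := msplit s so.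
have : (s, v) \in elems t by rewrite me gs.
rewrite el mem_cat => /orP[h|h]; first by have := allP h1 _ h; rewrite ltnn.
case: l2 h h2 el => // e l2 h h2 el.
have ee : e = (s, v).
  move: h; rewrite inE => /orP[/eqP->//|h].
  move: so; rewrite el msorted_cat => /and3P[_ + _]; rewrite -cat1s msorted_cat => /and3P[_ _].
  rewrite /allrel /= andbT => /allP /(_ _ h) /=; case/andP: h2 => h2 _.
  by rewrite ltnNge h2.
subst e; rewrite /mfind /find.
have b2 : all (predC (mB (s, (0%R, None)))) ((s, v) :: l2).
  by apply: sub_all h2 => e /=; rewrite /mB -leqNgt.
have h1' : all (mB (s, (0%R, None))) l1 := h1.
have -> // : (down (id : option entry -> option entry) id mB (s, (0%R, None)) t [::]).1 = Some (s, v).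
by apply: (@down_find _ _ _ _ (@specL entry)) ok el h1' b2; [exact: specL_lm | by [] | exact: specL_rcons].
Qed.

(** A suspended call of [solve]: edge, parent, length, crossings still to be passed and the two
    accumulators. While a child is being solved, its crossing stays at the head of the list of the
    frame below. *)
Notation frame := (nat * (option nat * (R * (seq (R * nat) * (acc * acc)))))%type.

Definition new_frame (s : nat) (p : option nat) (v : R * seq (R * nat)) : frame :=
  (s, (p, (v.1, (v.2, (acc0 R, acc0 R))))).
Definition is_parent (p : option nat) (t : nat) : bool := if p is Some q then t == q else false.

Definition dstep (st : mtree * (seq frame * option sol)) : mtree * (seq frame * option sol) :=
  match st.2.1 with
  | [::] => st
  | fr :: stk =>
    match fr.2.2.2.1 with
    | it :: its =>
        if is_parent fr.2.1 it.2 then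
          (st.1, ((fr.1, (fr.2.1, (fr.2.2.1, (its, pass_parent fr.1 fr.2.2.1 it.1 fr.2.2.2.2)))) :: stk, st.2.2))
        else (st.1, (new_frame it.2 (Some fr.1) (mfind it.2 st.1) :: fr :: stk, st.2.2))
    | [::] =>
        match stk with
        | [::] => (st.1, ([::], Some (finishes fr.1 fr.2.2.1 fr.2.2.2.2).1))
        | fr2 :: stk2 =>
            match fr2.2.2.2.1 with
            | [::] => st
            | it :: its =>
                (st.1, ((fr2.1, (fr2.2.1, (fr2.2.2.1, (its,
                   pass_child fr2.1 fr2.2.2.1 it.1 (finishes fr.1 fr.2.2.1 fr.2.2.2.2) fr2.2.2.2.2)))) :: stk2, st.2.2))
            end
        end
    end
  end.

Section Run.
Variables (M : mtree) (adj : nat -> seq (R * nat)) (len : nat -> R) (D : nat -> Prop).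
Hypothesis M_find : forall s, D s -> mfind s M = (len s, adj s).
Hypothesis D_adj : forall s it, D s -> it \in adj s -> D it.2.
Hypothesis adj_uniq : forall s, D s -> uniq [seq it.2 | it <- adj s].

Local Notation solve := (solve adj len).
Local Notation nodes := (nodes adj).
Local Notation good := (good adj).

Lemma is_parentE p t : is_parent p t = (Some t == p).
Proof. by case: p. Qed.

(** The first premise is [run_child] for fuel n. Stating it as a premise lets the scan of one list
    be proved apart from the induction on the fuel. *)
Lemma run_items n s p (its : seq (R * nat)) a stk :
  (forall t res fr it its', good n t (Some s) -> D t -> fr.2.2.2.1 = it :: its' -> it.2 = t -> fr.1 = s ->
     exists2 k, k.+1 <= 3 * size (nodes n t (Some s)) &
     iter k dstep (M, (new_frame t (Some s) (len t, adj t) :: fr :: stk, res)) =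
     (M, ((s, (fr.2.1, (fr.2.2.1, (its', pass_child s fr.2.2.1 it.1 (solve n t (Some s)) fr.2.2.2.2)))) :: stk, res))) ->
  (forall it, it \in its -> D it.2 /\ (Some it.2 != p -> good n it.2 (Some s))) ->
  forall res, exists2 k,
  k <= count (fun it => Some it.2 == p) its +
       3 * size (flatten [seq if Some it.2 == p then [::] else nodes n it.2 (Some s) | it <- its]) &
  iter k dstep (M, ((s, (p, (len s, (its, a)))) :: stk, res)) =
  (M, ((s, (p, (len s, ([::], foldl (fun a it =>
      if Some it.2 == p then pass_parent s (len s) it.1 a
      else pass_child s (len s) it.1 (solve n it.2 (Some s)) a) a its)))) :: stk, res)).
Proof.
move=> H; elim: its a => [|it its IH] a hits res; first by exists 0.
have [Dit git_] := hits it (mem_head _ _).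
have hits' : forall it, it \in its -> D it.2 /\ (Some it.2 != p -> good n it.2 (Some s)).
  by move=> it' h; apply: hits; rewrite inE h orbT.
case ep : (Some it.2 == p).
  have [k k1 k2] := IH (pass_parent s (len s) it.1 a) hits' res.
  exists k.+1; first by rewrite /= ep add1n addSn ltnS.
  by rewrite iterSr /dstep /= is_parentE ep k2.
have [k k1 k2] := IH (pass_child s (len s) it.1 (solve n it.2 (Some s)) a) hits' res.
have [k' k1' k2'] := H it.2 res (s, (p, (len s, (it :: its, a)))) it its (git_ (negbT ep)) Dit erefl erefl erefl.
exists (k + k'.+1).
  by rewrite /= ep size_cat mulnDr add0n addnCA [k + _]addnC; apply: leq_add.
have ip : is_parent p it.2 = false by rewrite is_parentE.
by rewrite iterD iterSr [dstep _]/dstep /= ip M_find // k2' k2 ep.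
Qed.

(** Three steps per edge: one to enter it, one for the crossing with its parent and one to
    return. *)
Lemma run_child n : forall s t res fr it its' stk, good n t (Some s) -> D t ->
  fr.2.2.2.1 = it :: its' -> it.2 = t -> fr.1 = s ->
  exists2 k, k.+1 <= 3 * size (nodes n t (Some s)) &
  iter k dstep (M, (new_frame t (Some s) (len t, adj t) :: fr :: stk, res)) =
  (M, ((s, (fr.2.1, (fr.2.2.1, (its', pass_child s fr.2.2.1 it.1 (solve n t (Some s)) fr.2.2.2.2)))) :: stk, res)).
Proof.
elim: n => // n IH s t res fr it its' stk g Dt efr eit es.
have [|it' h|k k1 k2] := @run_items n t (Some s) (adj t) (acc0 R, acc0 R) (fr :: stk) _ _ res.
- by move=> t' res' fr' it' its'' *; apply: IH.
- by split; [exact: D_adj h | exact: g].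
have cnt : count (fun it => Some it.2 == Some s) (adj t) <= 1.
  have -> : count (fun it => Some it.2 == Some s) (adj t) = count_mem s [seq it.2 | it <- adj t].
    by rewrite count_map; apply: eq_count => x /=.
  by rewrite count_uniq_mem ?adj_uniq //; case: (_ \in _).
exists k.+1.
  have k3 := leq_trans k1 (leq_add cnt (leqnn _)).
  by rewrite /= mulnS; exact: (leq_add (isT : 2 <= 2) k3).
by rewrite iterS k2 /dstep /= efr -es.
Qed.

Lemma run_root n s : good n s None -> D s ->
  exists2 k, k <= 3 * size (nodes n s None) &
  iter k dstep (M, ([:: new_frame s None (mfind s M)], None)) = (M, ([::], Some (solve n s None).1)).
Proof.
case: n => // n g Ds; rewrite M_find //.
have [|it' h|k k1 k2] := @run_items n s None (adj s) (acc0 R, acc0 R) [::] _ _ None.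
- by move=> t' res' fr' it' its'' *; apply: run_child.
- by split; [exact: D_adj h | exact: g].
have cnt : count (fun it : R * nat => Some it.2 == None) (adj s) = 0.
  by apply/eqP; rewrite -leqn0 leqNgt -has_count; apply/hasPn.
exists k.+1; last by rewrite iterS k2.
rewrite cnt add0n in k1; rewrite /= mulnS; exact: (leq_add (isT : 1 <= 3) k1).
Qed.

Lemma run_fuel n s N : good n s None -> D s -> 3 * size (nodes n s None) <= N ->
  iter N dstep (M, ([:: new_frame s None (mfind s M)], None)) = (M, ([::], Some (solve n s None).1)).
Proof.
move=> g Ds hN; have [k k1 k2] := run_root g Ds.
have -> : N = (N - k) + k by lia.
rewrite iterD k2; elim: (N - k) => //= j ->; by [].
Qed.

End Run.
End Machine.

(** * Walks in trees *)

Section Walks.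
Variables (T : eqType) (E : rel T).
Hypothesis E_sym : symmetric E.
Hypothesis E_irr : irreflexive E.
Hypothesis E_acyclic : forall c : seq T, ucycle E c -> size c < 3.

(* A walk from x without immediate returns, coming from p. *)
Fixpoint nbw (p : option T) (x : T) (s : seq T) : bool :=
  if s is y :: s' then [&& E x y, Some y != p & nbw (Some x) y s'] else true.

Lemma nbw_path p x s : nbw p x s -> path E x s.
Proof. by elim: s p x => //= y s IH p x /and3P[-> _ /IH]. Qed.

(** By induction the tail is a simple path, so the return to x would close a simple cycle. It has at
    least three vertices, since the walk does not turn back at once. *)
Lemma nbw_uniq p x s : nbw p x s -> uniq (x :: s).
Proof.
elim: s p x => //= y s IH p x /and3P[xy _ w]; have u := IH _ _ w; rewrite u andbT.
rewrite inE negb_or; apply/andP; split.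
  by apply: contraTneq xy => ->; rewrite E_irr.
apply/negP => xs.
case: s w u xs {IH} => // z s /= /and3P[yz zx w] u.
rewrite inE => /orP[/eqP e|xs]; first by rewrite e eqxx in zx.
case/splitPr: xs w u => a b w u.
have [] : ~ size (x :: y :: z :: a) < 3 by [].
apply: E_acyclic; apply/andP; split.
  have := nbw_path w; rewrite cat_path /= => /and3P[h1 h2 _].
  by rewrite xy yz rcons_path h1 h2.
move: u; rewrite /= inE !mem_cat !inE !negb_or cat_uniq /=.
move=> /and3P[/and4P[yz' ya yx _] /and3P[za zx' _] /and3P[ua /norP[xa _] _]].
by rewrite yz' ya za ua xa [x == y]eq_sym yx [x == z]eq_sym zx'.
Qed.

(** The first walk reversed, the edge xy and the second walk form one walk without immediate
    returns. It does not repeat a vertex, so its two ends differ. The induction moves one edge at a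
    time from the first walk to the second. *)
Lemma nbw_turn s1 x y s2 : E x y -> nbw (Some y) x s1 -> nbw (Some x) y s2 ->
  last x s1 != last y s2.
Proof.
suff H : E x y -> nbw (Some y) x s1 -> nbw (Some x) y s2 ->
    exists w, [/\ nbw None (last x s1) w, last (last x s1) w = last y s2 & w != [::]].
  move=> xy h1 h2; have [w [w1 w2 w3]] := H xy h1 h2; rewrite -w2.
  have := nbw_uniq w1; case/lastP: w w3 {w1 w2} => // w z _.
  rewrite last_rcons cons_uniq mem_rcons inE negb_or => /andP[/andP[]] //.
elim: s1 x y s2 => [|z s1 IH] x y s2 xy h1 h2.
  by exists (y :: s2); rewrite /= xy.
move: h1 => /= /and3P[xz zy h1].
have [||w [w1 w2 w3]] := IH z x (y :: s2) _ h1; first by rewrite E_sym.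
  by rewrite /= xy h2 andbT; apply: contra zy => /eqP[->].
by exists w.
Qed.

Lemma path_nbw p x s : path E x s -> uniq (x :: s) -> (forall q, p = Some q -> q \notin s) -> nbw p x s.
Proof.
elim: s p x => //= y s IH p x /andP[xy pa] /andP[xs u] hp.
rewrite xy /=; apply/andP; split.
  by apply/eqP => e; have := hp y (esym e); rewrite mem_head.
by apply: IH => // q [<-]; move: xs; rewrite inE negb_or => /andP[].
Qed.

End Walks.

(** * Vertices and degrees met by the recursion *)

Section TreeNodes.
Variables (R : Type) (m : nat) (E : rel nat) (adj : nat -> seq (R * nat)).
Hypothesis E_sym : symmetric E.
Hypothesis E_irr : irreflexive E.
Hypothesis E_acyclic : forall c : seq nat, ucycle E c -> size c < 3.
Hypothesis E_lt : forall s t, E s t -> (s < m) && (t < m).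
Hypothesis E_conn : forall s t, s < m -> t < m -> exists2 w, path E s w & last s w = t.
Hypothesis adjE : forall s t, (t \in [seq it.2 | it <- adj s]) = E s t.
Hypothesis adj_uniq : forall s, uniq [seq it.2 | it <- adj s].

(** Copies of [nodes] and [good] that look at neighbours only, so that they also apply to adjacency
    lists whose entries carry something other than real positions. *)
Fixpoint tnodes (n : nat) (s : nat) (p : option nat) : seq nat :=
  if n is n'.+1 then
    s :: flatten [seq if Some t == p then [::] else tnodes n' t (Some s) | t <- [seq it.2 | it <- adj s]]
  else [::].

Fixpoint tgood (n : nat) (s : nat) (p : option nat) : Prop :=
  if n is n'.+1 then forall t, t \in [seq it.2 | it <- adj s] -> Some t != p -> tgood n' t (Some s)
  else False.

Lemma tnodesP n s p v : reflect (exists w, [/\ nbw E p s w, last s w = v & size w < n]) (v \in tnodes n s p).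
Proof.
elim: n s p => [|n IH] s p /=; first by apply: ReflectF => -[w []].
rewrite inE; apply: (iffP orP) => [[/eqP->|]|[w []]].
- by exists [::].
- case/flattenP => l /mapP[t tin ->]; case: eqP => // /eqP ne /IH[w [w1 w2 w3]].
  by exists (t :: w); rewrite /= -adjE tin ne.
- case: w => [|t w] /= h1 h2 h3; first by left; rewrite h2.
  right; case/and3P: h1 => st tp w1; apply/flattenP; exists (tnodes n t (Some s)); last by apply/IH; exists w.
  by apply/mapP; exists t; rewrite ?adjE // (negbTE tp).
Qed.

Lemma nbw_size p s w : s < m -> nbw E p s w -> size w < m.
Proof.
move=> sm h; have u := nbw_uniq E_irr E_acyclic h.
rewrite -ltnS -[m in _ < m.+1](size_iota 0 m); apply: (uniq_leq_size u) => v.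
rewrite inE mem_iota add0n => /orP[/eqP->//|].
elim: w p s sm h {u} => //= t w IH p s _ /and3P[st _ h]; have /andP[_ tm] := E_lt st.
by rewrite inE => /orP[/eqP->//|]; exact: IH h.
Qed.

Lemma tgood_size n s p : (forall w, nbw E p s w -> size w < n) -> tgood n s p.
Proof.
elim: n s p => [|n IH] s p h; first by have := h [::] isT.
move=> t tin ne; apply: IH => w hw.
by apply: (h (t :: w)); rewrite /= -adjE tin ne.
Qed.

Lemma tgood_root s : s < m -> tgood m s None.
Proof. by move=> sm; apply: tgood_size => w; exact: nbw_size. Qed.

(** A vertex that occurs twice would be the end of two walks leaving s in different directions,
    against [nbw_turn]. *)
Lemma tnodes_uniq n s p : uniq (tnodes n s p).
Proof.
elim: n s p => //= n IH s p; apply/andP; split.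
  apply/negP => /flattenP[l /mapP[t tin ->]]; case: eqP => // _ /tnodesP[w [w1 w2 _]].
  rewrite adjE E_sym in tin.
  by have := nbw_turn E_sym E_irr E_acyclic tin w1 (isT : nbw E (Some t) s [::]); rewrite w2 eqxx.
have := adj_uniq s; have : {subset [seq it.2 | it <- adj s] <= [seq it.2 | it <- adj s]} by [].
elim: {1 3 4}[seq it.2 | it <- adj s] => //= t ts IHt sub /andP[tts uts].
rewrite cat_uniq; apply/and3P; split; first by case: ifP.
  apply/hasPn => v /flattenP[l /mapP[t' t'in ->]]; case: eqP => // /eqP ne' /tnodesP[w' [w1' w2' _]].
  case: eqP => // /eqP ne; apply/negP => /tnodesP[w [w1 w2 _]].
  have ts_ : E t s by rewrite E_sym -adjE; apply: sub; rewrite mem_head.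
  have st' : E s t' by rewrite -adjE; apply: sub; rewrite inE t'in orbT.
  have h : nbw E (Some t) s (t' :: w').
    by rewrite /= st' w1' andbT; apply: contraNneq tts => -[<-].
  by have := nbw_turn E_sym E_irr E_acyclic ts_ w1 h; rewrite /= w2 w2' eqxx.
by apply: IHt => // x h; apply: sub; rewrite inE h orbT.
Qed.

Lemma tnodes_perm s : s < m -> perm_eq (tnodes m s None) (iota 0 m).
Proof.
move=> sm; apply: uniq_perm; [exact: tnodes_uniq | exact: iota_uniq |] => v.
rewrite mem_iota add0n; apply/idP/idP => [/tnodesP[w [w1 <- _]]|vm].
  case/lastP: w w1 => // w z /nbw_path; rewrite rcons_path last_rcons => /andP[_ /E_lt/andP[]] //.
have [w pw lw] := E_conn sm vm.
case/shortenP: pw lw => w' pw' uw' _ lw'.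
have nb : nbw E None s w' by apply: path_nbw.
by apply/tnodesP; exists w'; split=> //; apply: nbw_size nb.
Qed.

(** The handshake lemma for a tree, which has one edge less than vertices. A part with a parent has
    one further edge end, the one towards the parent. *)
Lemma tdegree n s p : tgood n s p -> (forall q, p = Some q -> E s q) ->
  \sum_(v <- tnodes n s p) size (adj v) + 2 = 2 * size (tnodes n s p) + (p != None).
Proof.
elim: n s p => //= n IH s p g hp.
rewrite big_cons big_flatten /= big_map.
have h : \sum_(t <- [seq it.2 | it <- adj s]) \sum_(v <- (if Some t == p then [::] else tnodes n t (Some s))) size (adj v)
   + size (adj s) = \sum_(t <- [seq it.2 | it <- adj s])
     2 * size (if Some t == p then [::] else tnodes n t (Some s)) + (p != None).
  have cnt : count (fun t => Some t == p) [seq it.2 | it <- adj s] = (p != None).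
    case: p {g} hp => [q|] hp.
      rewrite (eq_count (a2 := pred1 q)); last by move=> t /=.
      by rewrite count_uniq_mem // adjE hp.
    by apply/eqP; rewrite -leqn0 leqNgt -has_count; apply/hasPn.
  rewrite -cnt -(size_map snd (adj s)) -[map snd _]/([seq it.2 | it <- adj s]).
  have : {subset [seq it.2 | it <- adj s] <= [seq it.2 | it <- adj s]} by [].
  elim: {1 3 4 5 6}[seq it.2 | it <- adj s] => [|t ts IHt] sub; first by rewrite !big_nil.
  have tin := sub t (mem_head _ _).
  rewrite !big_cons /=.
  have {}IHt := IHt (fun x h => sub x (mem_behead (h : x \in behead (t :: ts)))).
  case: eqP => [e|/eqP ne] /=; first by rewrite big_nil muln0 !add0n addnS IHt add1n addnS.
  have := IH t (Some s) (g t tin ne); rewrite /= => H1.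
  have {}H1 : (\sum_(v <- tnodes n t (Some s)) size (adj v)).+1 = 2 * size (tnodes n t (Some s)).
    have : \sum_(v <- tnodes n t (Some s)) size (adj v) + 2 = 2 * size (tnodes n t (Some s)) + 1.
      by apply: H1 => q [<-]; rewrite E_sym -adjE.
    by rewrite addn2 addn1 => -[].
  by rewrite addnS -addnA IHt -addSn H1 add0n addnA.
rewrite size_flatten /shape -map_comp sumnE big_map mulnS big_distrr /=.
rewrite !big_map in h *.
by rewrite [X in X + 2]addnC h addnC addnA.
Qed.

End TreeNodes.

(** * Drawings *)

Section Drawing.
Variable R : realType.
Local Open Scope ring_scope.
Notation pt := (R * R)%type.
Notation seg := (nat * (pt * pt))%type.

Variables (n m : nat) (G : sgraph n m) (pos : 'I_n -> pt).
Hypothesis drawing : is_drawing G pos.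

Definition sg (i : 'I_m) : seg := (nat_of_ord i, (pos (src G i), pos (dst G i))).

Let pos_inj : injective pos := proj1 drawing.

Lemma sg_nondeg i : (sg i).2.1 != (sg i).2.2.
Proof. by rewrite /= (inj_eq pos_inj) sgraph_loopless. Qed.

Lemma along_inj (P Q : pt) t u : P != Q -> along P Q t = along P Q u -> t = u.
Proof.
case: P Q => [a b] [c d]; rewrite xpair_eqE negb_and /along /= => h [/addrI e1 /addrI e2].
by case/orP: h => h; [apply: (mulIf _ e1) | apply: (mulIf _ e2)]; rewrite subr_eq0 eq_sym.
Qed.

Lemma along0 (P Q : pt) : along P Q 0 = P.
Proof. by case: P => a b; rewrite /along /= !mul0r !addr0. Qed.
Lemma along1 (P Q : pt) : along P Q 1 = Q.
Proof. by case: P Q => [a b] [c d]; rewrite /along /=; congr (_, _); ring. Qed.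

Lemma no_vertex_inside v i u : 0 < u < 1 -> pos v <> along (sg i).2.1 (sg i).2.2 u.
Proof.
move=> u01 e; have [vi|vi] := boolP (v \in ends G i); last first.
  by apply: (proj2 drawing v i vi); exists u.
have {}e : along (sg i).2.1 (sg i).2.2 u = pos v by [].
move: u01; rewrite !inE in vi; case/orP: vi => /eqP ev; subst v.
  by rewrite -(along0 (pos (src G i)) (pos (dst G i))) in e; rewrite (along_inj (sg_nondeg i) e) ltxx.
by rewrite -(along1 (pos (src G i)) (pos (dst G i))) in e; rewrite (along_inj (sg_nondeg i) e) ltxx andbF.
Qed.

Definition common_end i j p := exists v, [/\ v \in ends G i, v \in ends G j & pos v = p].

(** If p were an end of i, this vertex would lie on j, hence be an end of j because no vertex is
    inside an edge, and so be a common end. *)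
Lemma meet_inside i j p a : ~ common_end i j p -> onseg (sg j) p -> 0 <= a <= 1 ->
  p = along (sg i).2.1 (sg i).2.2 a -> 0 < a < 1.
Proof.
move=> nc [b b01 eb] /andP[a0 a1] ea.
have key v : v \in ends G i -> pos v = p -> False.
  move=> vi ev.
  have [b0|b0] := eqVneq b 0.
    have ep : pos (src G j) = p by rewrite eb b0 along0.
    apply: nc; exists v; split=> //.
    have -> : v = src G j by apply: pos_inj; rewrite ev ep.
    by rewrite !inE eqxx.
  have [b1|b1] := eqVneq b 1.
    have ep : pos (dst G j) = p by rewrite eb b1 along1.
    apply: nc; exists v; split=> //.
    have -> : v = dst G j by apply: pos_inj; rewrite ev ep.
    by rewrite !inE eqxx orbT.
  apply: (@no_vertex_inside v j b); last by rewrite ev.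
  by rewrite !lt_neqAle eq_sym b0 b1.
apply/andP; split; rewrite lt_neqAle ?a0 ?a1 andbT; apply/eqP => e.
  by apply: (key (src G i)); rewrite ?inE ?eqxx // ea -e along0.
by apply: (key (dst G i)); rewrite ?inE ?eqxx ?orbT // ea e along1.
Qed.

Lemma along_shift (P Q A B p : pt) a b c x : p = along P Q a -> p = along A B b ->
  B.1 - A.1 = c * (Q.1 - P.1) -> B.2 - A.2 = c * (Q.2 - P.2) ->
  along A B (b + x) = along P Q (a + x * c).
Proof.
move=> e1 e2 h1 h2; rewrite /along h1 h2; move: e1; rewrite e2 /along h1 h2 => -[h3 h4].
by congr (_, _); rewrite !mulrDl !addrA ?h3 ?h4 mulrA.
Qed.

(** Parallel segments with a common inner point overlap. As no vertex is inside an edge, neither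
    segment can stop within the other, so they have the same ends, and the graph would not be
    simple. *)
Lemma not_parallel i j p : i != j -> ~ common_end i j p -> onseg (sg i) p -> onseg (sg j) p ->
  segdet (sg i) (sg j) != 0.
Proof.
move=> ij nc [a a01 ea] [b b01 eb].
have nc' : ~ common_end j i p by move=> [v [h1 h2 h3]]; apply: nc; exists v.
have oi : onseg (sg i) p by exists a.
have oj : onseg (sg j) p by exists b.
have {}a01 := meet_inside nc oj a01 ea; have {}b01 := meet_inside nc' oi b01 eb.
apply/eqP => d0.
pose dx := segdx (sg i); pose dy := segdy (sg i).
have ds0 : 0 < dx ^+ 2 + dy ^+ 2.
  have := sg_nondeg i; rewrite /dx /dy /segdx /segdy; case: (sg i) => k [[x y] [z w]] /=.
  rewrite xpair_eqE negb_and => /orP[h|h].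
    by apply: ltr_pwDl; rewrite ?sqr_ge0 // exprn_even_gt0 //= subr_eq0 eq_sym.
  by apply: ltr_wpDl; rewrite ?sqr_ge0 // exprn_even_gt0 //= subr_eq0 eq_sym.
(* The direction of j is c times that of i; c is their inner product divided by a squared length. *)
pose c := (segdx (sg j) * dx + segdy (sg j) * dy) / (dx ^+ 2 + dy ^+ 2).
have ds1 : dx ^+ 2 + dy ^+ 2 != 0 by rewrite gt_eqF.
have d0' : dx * segdy (sg j) = dy * segdx (sg j) by apply/eqP; rewrite -subr_eq0; apply/eqP.
have cx : segdx (sg j) = c * dx.
  apply: (mulIf ds1); rewrite /c mulrAC divfK //.
  have : dx * segdy (sg j) * dy = dy * segdx (sg j) * dy by rewrite d0'.
  lra.
have cy : segdy (sg j) = c * dy.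
  apply: (mulIf ds1); rewrite /c mulrAC divfK //.
  have : dx * segdy (sg j) * dx = dy * segdx (sg j) * dx by rewrite d0'.
  lra.
have c0 : c != 0.
  apply/eqP => c0; have := sg_nondeg j; rewrite c0 !mul0r in cx cy.
  rewrite /segdx in cx; rewrite /segdy in cy; move: cx cy; case: (sg j) => k [[x y] [z w]] /=.
  move=> /eqP; rewrite subr_eq0 => /eqP -> /eqP; rewrite subr_eq0 => /eqP ->.
  by rewrite eqxx.
have shift_j x : along (sg j).2.1 (sg j).2.2 (b + x) = along (sg i).2.1 (sg i).2.2 (a + x * c).
  exact: along_shift ea eb cx cy.
have shift_i x : along (sg i).2.1 (sg i).2.2 (a + x) = along (sg j).2.1 (sg j).2.2 (b + x / c).
  by rewrite shift_j divfK.
have inj_ v u : pos v = along (sg j).2.1 (sg j).2.2 u -> ~ (0 < u < 1) by move=> e h; exact: (no_vertex_inside h e).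
have ini_ v u : pos v = along (sg i).2.1 (sg i).2.2 u -> ~ (0 < u < 1) by move=> e h; exact: (no_vertex_inside h e).
have Asj : pos (src G j) = along (sg i).2.1 (sg i).2.2 (a - b * c).
  by rewrite -mulNr -shift_j subrr along0.
have Adj : pos (dst G j) = along (sg i).2.1 (sg i).2.2 (a + (1 - b) * c).
  by rewrite -shift_j addrCA subrr addr0 along1.
have Asi : pos (src G i) = along (sg j).2.1 (sg j).2.2 (b - a / c).
  by rewrite -mulNr -shift_i subrr along0.
have Adi : pos (dst G i) = along (sg j).2.1 (sg j).2.2 (b + (1 - a) / c).
  by rewrite -shift_i addrCA subrr addr0 along1.
have h1 := ini_ _ _ Asj; have h2 := ini_ _ _ Adj; have h3 := inj_ _ _ Asi; have h4 := inj_ _ _ Adi.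
case/andP: a01 => a0 a1; case/andP: b01 => b0 b1.
have done_ : ends G i = ends G j -> False.
  by move=> e; have := sgraph_simple e => /eqP; rewrite (negbTE ij).
(* For c > 0 the segments point the same way and have equal sources and equal targets; for c < 0 the
   source of one is the target of the other. *)
have [cp|cn] : 0 < c \/ c < 0 by move: c0; rewrite neq_lt => /orP[]; auto.
  have k1 : a - b * c <= 0.
    rewrite leNgt; apply/negP => h; apply: h1; rewrite h /=.
    have : 0 < b * c by apply: mulr_gt0. lra.
  have k2 : 1 <= a + (1 - b) * c.
    rewrite leNgt; apply/negP => h; apply: h2; rewrite h andbT.
    have : 0 < (1 - b) * c by apply: mulr_gt0; lra. lra.
  have k3 : a / c <= b by rewrite ler_pdivrMr //; lra.
  have k4 : (1 - a) / c <= 1 - b by rewrite ler_pdivrMr //; lra.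
  have p1 : 0 < a / c by apply: divr_gt0.
  have p2 : 0 < (1 - a) / c by apply: divr_gt0 => //; lra.
  have e1 : b - a / c = 0.
    apply/eqP; rewrite eq_le; apply/andP; split; last by lra.
    by rewrite leNgt; apply/negP => h; apply: h3; rewrite h /=; lra.
  have e2 : b + (1 - a) / c = 1.
    apply/eqP; rewrite eq_le; apply/andP; split; first by lra.
    by rewrite leNgt; apply/negP => h; apply: h4; rewrite h andbT; lra.
  rewrite e1 along0 in Asi; rewrite e2 along1 in Adi.
  by apply: done_; rewrite /ends (pos_inj Asi) (pos_inj Adi).
have cp : 0 < - c by rewrite oppr_gt0.
have k1 : 1 <= a - b * c.
  rewrite leNgt; apply/negP => h; apply: h1; rewrite h andbT.
  have : 0 < b * - c by apply: mulr_gt0. lra.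
have k2 : a + (1 - b) * c <= 0.
  rewrite leNgt; apply/negP => h; apply: h2; rewrite h /=.
  have : 0 < (1 - b) * - c by apply: mulr_gt0; lra. lra.
have q1 : a / c = - (a / - c) by rewrite invrN mulrN opprK.
have q2 : (1 - a) / c = - ((1 - a) / - c) by rewrite invrN mulrN opprK.
have k3 : a / - c <= 1 - b by rewrite ler_pdivrMr //; lra.
have k4 : (1 - a) / - c <= b by rewrite ler_pdivrMr //; lra.
have p1 : 0 < a / - c by apply: divr_gt0.
have p2 : 0 < (1 - a) / - c by apply: divr_gt0 => //; lra.
have e1 : b - a / c = 1.
  apply/eqP; rewrite eq_le; apply/andP; split; first by lra.
  by rewrite leNgt; apply/negP => h; apply: h3; rewrite h andbT; lra.
have e2 : b + (1 - a) / c = 0.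
  apply/eqP; rewrite eq_le; apply/andP; split; last by lra.
  by rewrite leNgt; apply/negP => h; apply: h4; rewrite h /=; lra.
rewrite e1 along1 in Asi; rewrite e2 along0 in Adi.
by apply: done_; rewrite /ends (pos_inj Asi) (pos_inj Adi) finset.setUC.
Qed.

Lemma along_tau (s t : seg) a b : along s.2.1 s.2.2 a = along t.2.1 t.2.2 b -> segdet s t != 0 -> a = tau s t.
Proof.
case: s t => [i [[x y] [z w]]] [j [[x' y'] [z' w']]]; rewrite /along /tau /segdet /segdx /segdy /= => -[h1 h2] d0.
apply: (mulIf d0); rewrite divfK //.
have e1 : a * (z - x) = x' - x + b * (z' - x') by rewrite addrAC -h1; ring.
have e2 : a * (w - y) = y' - y + b * (w' - y') by rewrite addrAC -h2; ring.
have -> : a * ((z - x) * (w' - y') - (w - y) * (z' - x')) =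
  (a * (z - x)) * (w' - y') - (a * (w - y)) * (z' - x') by ring.
by rewrite e1 e2; ring.
Qed.

Lemma meet_xing i j p : i != j -> ~ common_end i j p -> onseg (sg i) p -> onseg (sg j) p ->
  xing (sg i) (sg j) /\ p = xpt (sg i) (sg j).
Proof.
move=> ij nc oi oj; have d0 := not_parallel ij nc oi oj.
have nc' : ~ common_end j i p by move=> [v [h1 h2 h3]]; apply: nc; exists v.
have [a a01 ea] := oi; have [b b01 eb] := oj.
have {}a01 := meet_inside nc oj a01 ea; have {}b01 := meet_inside nc' oi b01 eb.
have d0' : segdet (sg j) (sg i) != 0 by rewrite segdetC oppr_eq0.
have e1 : a = tau (sg i) (sg j) by apply: (along_tau (b := b) _ d0); rewrite -ea -eb.
have e2 : b = tau (sg j) (sg i) by apply: (along_tau (b := a) _ d0'); rewrite -ea -eb.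
case/andP: a01 => a0 a1; case/andP: b01 => b0 b1.
by rewrite /xing d0 -e1 -e2 a0 a1 b0 b1 /xpt -e1.
Qed.

Lemma xing_onseg (s t : seg) : xing s t -> onseg s (xpt s t) /\ onseg t (xpt s t).
Proof.
move=> h; have ht : xing t s by rewrite xing_sym.
have aux (u v : seg) : xing u v -> onseg u (xpt u v).
  by case/and5P => _ h1 h2 _ _; exists (tau u v); rewrite // !ltW.
by split; [exact: aux | rewrite xpt_sym; [exact: aux | case/and5P: h]].
Qed.

Lemma xpt_no_vertex i j v : xing (sg i) (sg j) -> pos v <> xpt (sg i) (sg j).
Proof. by case/and5P => _ h1 h2 _ _; apply: no_vertex_inside; rewrite h1. Qed.

Lemma intersection_xing i j : intersection_graph G pos i j = xing (sg i) (sg j).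
Proof.
rewrite /intersection_graph; apply/andP/idP => [[ij /asboolP[p [si sj nc]]]|h].
  by have [] := meet_xing ij nc si sj.
split; first by apply: contraTneq h => ->; rewrite xing_irr.
apply/asboolP; exists (xpt (sg i) (sg j)); have [h1 h2] := xing_onseg h; split=> //.
by move=> [v [_ _]]; exact: xpt_no_vertex h.
Qed.

Definition segs : seq seg := [seq sg i | i <- enum 'I_m].

Lemma sg_inj : injective sg.
Proof. by move=> i j /(congr1 fst) /= /val_inj. Qed.

Lemma size_segs : size segs = m.
Proof. by rewrite size_map size_enum_ord. Qed.
Lemma uniq_segs : uniq segs.
Proof. by rewrite map_inj_uniq ?enum_uniq //; exact: sg_inj. Qed.
Lemma segsP s : reflect (exists i, s = sg i) (s \in segs).
Proof.
apply: (iffP mapP) => [[i _ ->]|[i ->]]; first by exists i.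
by exists i; rewrite ?mem_enum.
Qed.
Lemma sg_segs i : sg i \in segs. Proof. by apply/segsP; exists i. Qed.

Lemma segs_nondeg s : s \in segs -> s.2.1 != s.2.2.
Proof. by case/segsP => i ->; exact: sg_nondeg. Qed.

Lemma end_vertex i p : (exists2 v, v \in ends G i & pos v = p) -> p \in [:: (sg i).2.1; (sg i).2.2].
Proof. by move=> [v + <-]; rewrite !inE !(inj_eq pos_inj). Qed.

Lemma segs_meet s t P : s \in segs -> t \in segs -> s != t -> onseg s P -> onseg t P ->
  (P \in [:: s.2.1; s.2.2] /\ P \in [:: t.2.1; t.2.2]) \/ (xing s t /\ P = xpt s t).
Proof.
case/segsP => i -> /segsP[j ->]; rewrite (inj_eq sg_inj) => ij oi oj.
have [[v [vi vj ev]]|nc] := pselect (common_end i j P).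
  by left; split; apply: end_vertex; exists v.
by right; apply: meet_xing.
Qed.

End Drawing.

(** * From the drawing to an optimal choice of stubs *)

Section Pipeline.
Variable R : realType.
Local Open Scope ring_scope.
Notation pt := (R * R)%type.
Notation seg := (nat * (pt * pt))%type.
Notation record := (R * (nat * nat))%type.
Notation entry := (nat * (R * seq (R * nat)))%type.
Notation mtree := (tree entry (option entry)).

Definition seglen (s : seg) : R := Num.sqrt (segdx s * segdx s + segdy s * segdy s).

Definition records (out : seq (seg * seg)) : seq record :=
  foldl (fun l p => (tau p.1 p.2, (p.1.1, p.2.1)) :: (tau p.2 p.1, (p.2.1, p.1.1)) :: l) [::] out.
(** Decreasing order: the records are pushed to the front one by one, which leaves every adjacency
    list increasing. *)
Definition rlt (a b : record) : bool := b.1 < a.1.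

Definition insert_query (s : seg) := (s.1, (seglen s, None : option (R * nat))).
Definition push_query (r : record) := (r.2.1, (0 : R, Some (r.1, r.2.2))).
Definition adj_tree (S : seq seg) (L : seq record) : mtree :=
  foldl (fun t q => mupd q t) (foldl (fun t q => mupd q t) (Leaf None) [seq insert_query s | s <- S])
    [seq push_query r | r <- L].

Definition solution (S : seq seg) : tree (nat * (R * R)) unit :=
  let M := adj_tree S (tsort rlt (records (sweep S))) in
  let st := iter (3 * size S) (@dstep R) (M, ([:: new_frame 0 None (mfind 0 M)], None)) in
  if st.2.2 is Some x then x.2 else Leaf None.
Definition maxped (S : seq seg) : seq (nat * (R * R)) := elems (solution S).

Definition adj_of (L : seq record) (s : nat) : seq (R * nat) :=
  rev [seq (r.1, r.2.2) | r <- L & r.2.1 == s].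

Lemma minv_inserts (S : seq seg) : uniq [seq s.1 | s <- S] ->
  exists2 g, minv (foldl (fun t q => mupd q t) (Leaf None) [seq insert_query s | s <- S]) g &
    forall s, (s \in S -> g s.1 = Some (seglen s, [::])) /\ (s.1 \notin [seq s.1 | s <- S] -> g s.1 = None).
Proof.
elim/last_ind: S => [_|S a IH]; first by exists (fun=> None).
rewrite map_rcons rcons_uniq => /andP[aS u]; have [g gi gS] := IH u.
rewrite map_rcons foldl_rcons; eexists.
  by apply: (minv_insert (seglen a) gi); have [_] := gS a; apply.
move=> s; rewrite !mem_rcons !inE /=; split.
  case/orP => [/eqP->|sS]; first by rewrite eqxx.
  case: eqP => [e|_]; last by have [h _] := gS s; apply: h.
  by move: aS; rewrite -e map_f.
by case/norP => /negbTE -> h; have [_] := gS s; apply.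
Qed.

Lemma minv_pushes (t : mtree) g (L : seq record) : minv t g -> (forall r, r \in L -> g r.2.1 != None) ->
  exists2 g', minv (foldl (fun t q => mupd q t) t [seq push_query r | r <- L]) g' &
    forall s, g' s = omap (fun v => (v.1, adj_of L s ++ v.2)) (g s).
Proof.
elim/last_ind: L => [gi _|L r IH gi gL].
  by exists g => // s; case: (g s) => // -[].
have [|g' gi' gE] := IH gi; first by move=> r' h; apply: gL; rewrite mem_rcons inE h orbT.
have := gL r; rewrite mem_rcons mem_head => /(_ isT).
case er : (g r.2.1) => [[l a]|] // _.
have e' : g' r.2.1 = Some (l, adj_of L r.2.1 ++ a) by rewrite gE er.
rewrite map_rcons foldl_rcons; eexists; first exact: (minv_push (r.1, r.2.2) gi' e').
move=> s /=; rewrite /adj_of filter_rcons [r.2.1 == s]eq_sym; have [->|ne] := eqVneq s r.2.1; last by rewrite gE.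
by rewrite er /= map_rcons rev_rcons.
Qed.

Variables (n m : nat) (G : sgraph n m) (pos : 'I_n -> pt).
Hypothesis drawing : is_drawing G pos.
Hypothesis tree_ : is_tree (intersection_graph G pos).
Local Notation sg := (sg G pos).
Local Notation segs := (segs G pos).

Let m_gt0 : (0 < m)%N. Proof. by have [] := tree_; rewrite card_ord. Qed.
Let i0 : 'I_m := Ordinal m_gt0.
Definition ith (s : nat) : 'I_m := insubd i0 s.
Lemma ithK s : (s < m)%N -> ith s = s :> nat. Proof. by move=> h; rewrite insubdK. Qed.
Lemma ith_ord (i : 'I_m) : ith i = i. Proof. by apply: val_inj; rewrite /= ithK. Qed.

Definition nE (s t : nat) : bool := [&& (s < m)%N, (t < m)%N & xing (sg (ith s)) (sg (ith t))].

Lemma nE_ord i j : nE (nat_of_ord i) (nat_of_ord j) = intersection_graph G pos i j.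
Proof. by rewrite /nE !ltn_ord !ith_ord (intersection_xing drawing). Qed.
Lemma nE_sym : symmetric nE.
Proof. by move=> s t; rewrite /nE xing_sym andbCA. Qed.
Lemma nE_irr : irreflexive nE.
Proof. by move=> s; rewrite /nE xing_irr !andbF. Qed.
Lemma nE_lt s t : nE s t -> (s < m)%N && (t < m)%N.
Proof. by case/and3P => -> ->. Qed.

Lemma nE_acyclic (c : seq nat) : ucycle nE c -> (size c < 3)%N.
Proof.
case/andP => cy un; have [_ _ ac] := tree_.
case: c cy un => // x c cy un.
have cm : {in x :: c, forall y, nat_of_ord (ith y) = y}.
  move=> y yc; apply: ithK; have := next_cycle cy yc.
  by case/nE_lt/andP.
have ec : x :: c = [seq nat_of_ord i | i <- [seq ith y | y <- x :: c]].
  by rewrite -map_comp -[LHS]map_id; apply/eq_in_map => y yc; rewrite /= cm.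
move: cy un; rewrite ec; move: [seq ith y | y <- x :: c] => d cy un {ec cm x c}.
rewrite size_map; apply: ac; apply/andP; split; last by rewrite -(map_inj_uniq val_inj).
by move: cy; rewrite cycle_map; apply: sub_cycle => a b /=; rewrite nE_ord.
Qed.

Lemma nE_conn s t : (s < m)%N -> (t < m)%N -> exists2 w, path nE s w & last s w = t.
Proof.
move=> sm tm; have [_ co _] := tree_.
have /connectP[w pw lw] := co (Ordinal sm) (Ordinal tm).
exists [seq nat_of_ord i | i <- w]; last first.
  by rewrite -[s]/(nat_of_ord (Ordinal sm)) last_map -lw.
rewrite -[s]/(nat_of_ord (Ordinal sm)) path_map.
by apply: sub_path pw => a b h /=; rewrite nE_ord.
Qed.

Lemma segs_triangle s t u : s \in segs -> t \in segs -> u \in segs ->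
  xing s t -> xing t u -> xing s u -> False.
Proof.
case/segsP => i -> /segsP[j ->] /segsP[k ->] ij jk ik.
have h : ucycle nE [:: nat_of_ord i; nat_of_ord j; nat_of_ord k].
  apply/andP; split.
    by rewrite /= !nE_ord !(intersection_xing drawing) ij jk /= xing_sym ik.
  rewrite /= !inE !(inj_eq val_inj) negb_or andbT; apply/andP; split; first (apply/andP; split).
  - by apply: contraTneq ij => ->; rewrite xing_irr.
  - by apply: contraTneq ik => ->; rewrite xing_irr.
  - by apply: contraTneq jk => ->; rewrite xing_irr.
by have := nE_acyclic h.
Qed.

Lemma count_crossings : (size (crossings segs) <= (size segs).*2)%N.
Proof.
pose adj s := [seq (tt, t) | t <- iota 0 m & nE s t].
have adj2 s : [seq it.2 | it <- adj s] = [seq t <- iota 0 m | nE s t].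
  by rewrite /adj -map_comp map_id.
have adjE s t : (t \in [seq it.2 | it <- adj s]) = nE s t.
  rewrite adj2 mem_filter mem_iota add0n andbC; case h : (nE s t); rewrite ?andbF // andbT.
  by case/andP: (nE_lt h).
have adj_uniq s : uniq [seq it.2 | it <- adj s] by rewrite adj2 filter_uniq ?iota_uniq.
have g := tgood_root nE_irr nE_acyclic nE_lt adjE m_gt0.
have := tdegree nE_sym adjE adj_uniq g (fun q (h : None = Some q) => ltac:(discriminate h)).
have pe := tnodes_perm nE_sym nE_irr nE_acyclic nE_lt nE_conn adjE adj_uniq m_gt0.
rewrite (perm_big _ pe) /= (perm_size pe) size_iota addn0 size_segs => h.
suff -> : size (crossings segs) = (\sum_(v <- iota 0 m) size (adj v))%N by lia.
rewrite /crossings size_filter count_flatten sumnE !big_map.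
rewrite -[iota 0 m]val_enum_ord big_map enumT; apply: eq_bigr => i _.
rewrite count_map /segs count_map /adj size_map size_filter -[iota 0 m]val_enum_ord count_map.
by apply: eq_count => j /=; rewrite nE_ord (intersection_xing drawing).
Qed.

Let out := sweep segs.
Lemma sweep_segs : uniq (sym out) /\
  forall u v, ((u, v) \in sym out) = [&& u \in segs, v \in segs & xing u v].
Proof.
apply: sweep_correct; [exact: uniq_segs | exact: segs_nondeg | exact: segs_meet |
  exact: segs_triangle | exact: count_crossings].
Qed.

Let L := tsort rlt (records out).
Let adj := adj_of L.
Let len (s : nat) := seglen (sg (ith s)).
Let ntau (s t : nat) := tau (sg (ith s)) (sg (ith t)).
Definition rec_of (p : seg * seg) : record := (tau p.1 p.2, (p.1.1, p.2.1)).

Lemma rle_total (x y : record) : ~~ rlt y x || ~~ rlt x y.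
Proof. by rewrite /rlt -!leNgt; exact: le_total. Qed.
Lemma rle_trans : transitive (fun x y : record => ~~ rlt y x).
Proof. by move=> y x z; rewrite /rlt -!leNgt => h1 h2; apply: le_trans h2 h1. Qed.

Lemma perm_records : perm_eq L [seq rec_of p | p <- sym out].
Proof.
have [_ [_ h]] := sort_tree_ok rle_total rle_trans (records out).
apply: perm_trans h _; rewrite /records /sym map_cat -map_comp -[X in perm_eq _ X]cats0 -catA.
elim: out [::] => [|p o IH] l /=; first by rewrite perm_refl.
apply: perm_trans (IH _) _.
rewrite perm_sym; apply/permP => q; do 4!rewrite ?count_cat /=.
rewrite /rec_of /=; move: (count _ _) (count _ _) (count _ l) (q _ : nat) (q _ : nat) => *; lia.
Qed.

Lemma mem_L r : (r \in L) = nE r.2.1 r.2.2 && (r.1 == ntau r.2.1 r.2.2).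
Proof.
rewrite (perm_mem perm_records); have [_ ms] := sweep_segs.
apply/mapP/andP => [[[u v] + ->]|[]].
  rewrite ms => /and3P[/segsP[i ->] /segsP[j ->] x].
  by rewrite /rec_of /= nE_ord (intersection_xing drawing) x /ntau !ith_ord.
case: r => t [a b] /= /and3P[am bm x] /eqP ->; exists (sg (ith a), sg (ith b)).
  by rewrite ms !sg_segs x.
by rewrite /rec_of /= !ithK.
Qed.

Lemma mem_adj s it : (it \in adj s) = nE s it.2 && (it.1 == ntau s it.2).
Proof.
rewrite /adj /adj_of mem_rev; apply/mapP/andP => [[r + ->]|[h /eqP e]].
  by rewrite mem_filter mem_L => /andP[/eqP <- /andP[]].
exists (it.1, (s, it.2)); last by case: it {h e}.
by rewrite mem_filter mem_L /= eqxx h e eqxx.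
Qed.

Lemma adj_ids s t : (t \in [seq it.2 | it <- adj s]) = nE s t.
Proof.
apply/mapP/idP => [[it + ->]|h]; first by rewrite mem_adj => /andP[].
by exists (ntau s t, t); rewrite // mem_adj h eqxx.
Qed.

Lemma uniq_adj s : uniq [seq it.2 | it <- adj s].
Proof.
rewrite /adj /adj_of map_rev rev_uniq -map_comp.
have [us ms] := sweep_segs.
have : uniq [seq r.2 | r <- L].
  rewrite (perm_uniq (perm_map _ perm_records)) -map_comp map_inj_in_uniq //.
  move=> [u v] [u' v']; rewrite !ms => /and3P[/segsP[i ->] /segsP[j ->] _] /and3P[/segsP[i' ->] /segsP[j' ->] _].
  by move=> /= [/val_inj -> /val_inj ->].
rewrite -/(tsort rlt (records out)) -/L.
elim: (L) => //= r l IH /andP[rl ul]; case: eqP => [e|_]; last exact: IH.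
rewrite /= IH // andbT; apply: contra rl => /mapP[r' + h].
rewrite mem_filter => /andP[/eqP e' r'l]; apply/mapP; exists r' => //.
by rewrite [r.2]surjective_pairing e -e' [X in (_, X)]h -surjective_pairing.
Qed.

(** Two edges that cross s in one point meet there away from all vertices, so they cross each other
    and form a triangle with s. *)
Lemma ntau_inj s t u : nE s t -> nE s u -> ntau s t = ntau s u -> t = u.
Proof.
move=> /and3P[sm tm st] /and3P[_ um su] e; apply/eqP; apply: contraT => ne.
have ne' : sg (ith t) != sg (ith u).
  by rewrite (inj_eq (@sg_inj _ _ _ G pos)) -(inj_eq val_inj) /= !ithK.
have [_ o1] := xing_onseg st; have [_ o2] := xing_onseg su.
have ex : xpt (sg (ith s)) (sg (ith t)) = xpt (sg (ith s)) (sg (ith u)) by rewrite /xpt -/(ntau s t) e.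
rewrite -ex in o2.
case: (segs_meet drawing (sg_segs _ _ _) (sg_segs _ _ _) ne' o1 o2) => [[h _]|[tu _]].
  have [v _ ev] : exists2 v, v \in ends G (ith t) & pos v = xpt (sg (ith s)) (sg (ith t)).
    by move: h; rewrite !inE => /orP[]/eqP->; [exists (src G (ith t)) | exists (dst G (ith t))];
       rewrite ?inE ?eqxx ?orbT.
  by have := xpt_no_vertex drawing st ev.
by case: (segs_triangle (sg_segs _ _ _) (sg_segs _ _ _) (sg_segs _ _ _) st tu su).
Qed.

Lemma sorted_adj s : sorted <%R [seq it.1 | it <- adj s].
Proof.
rewrite lt_sorted_uniq_le; apply/andP; split.
  have -> : [seq it.1 | it <- adj s] = [seq ntau s t | t <- [seq it.2 | it <- adj s]].
    by rewrite -map_comp; apply/eq_in_map => it; rewrite mem_adj => /andP[_ /eqP].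
  rewrite map_inj_in_uniq ?uniq_adj // => t u; rewrite !adj_ids; exact: ntau_inj.
have [_ [so _]] := sort_tree_ok rle_total rle_trans (records out).
rewrite -/L in so.
rewrite /adj /adj_of map_rev -map_comp rev_sorted sorted_map.
apply: sorted_filter; last by apply: sub_sorted so => x y /=; rewrite /rlt -leNgt.
by move=> y x z /= h1 h2; apply: le_trans h2 h1.
Qed.

Lemma adj_facts s it : it \in adj s -> it.1 = ntau s it.2 /\ 0 < it.1 < 1.
Proof.
rewrite mem_adj => /andP[/and3P[_ _ /and5P[_ h1 h2 _ _]] /eqP->].
by rewrite /ntau h1 h2.
Qed.

Lemma adj_sym_ s it : it \in adj s -> exists2 it', it' \in adj it.2 & it'.2 = s.
Proof.
rewrite mem_adj => /andP[h _]; exists (ntau it.2 s, s) => //.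
by rewrite mem_adj nE_sym h eqxx.
Qed.

Lemma len_ge0 s : 0 <= len s. Proof. exact: sqrtr_ge0. Qed.

Lemma nodesE k s p : nodes adj k s p = tnodes adj k s p.
Proof.
elim: k s p => //= k IH s p; congr (_ :: flatten _); rewrite -map_comp.
by apply: eq_map => it /=; rewrite IH.
Qed.
Lemma good_tgood k s p : tgood adj k s p -> good adj k s p.
Proof. by elim: k s p => //= k IH s p h it itin ne; apply: IH; apply: h; rewrite ?map_f. Qed.

Lemma good_root : good adj m 0 None.
Proof. by apply: good_tgood; apply: (tgood_root nE_irr nE_acyclic nE_lt adj_ids). Qed.
Lemma nodes_perm : perm_eq (nodes adj m 0 None) (iota 0 m).
Proof. by rewrite nodesE; apply: (tnodes_perm nE_sym nE_irr nE_acyclic nE_lt nE_conn adj_ids uniq_adj). Qed.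

Lemma mfind_adj s : (s < m)%N -> mfind s (adj_tree segs L) = (len s, adj s).
Proof.
have ui : uniq [seq s.1 | s <- segs].
  by rewrite /segs -map_comp map_inj_uniq ?enum_uniq // => i j /val_inj.
have [g gi gS] := minv_inserts ui.
have gs i : g (nat_of_ord i) = Some (seglen (sg i), [::]).
  by have [h _] := gS (sg i); apply: h; exact: sg_segs.
have [|g' gi' g'E] := minv_pushes (L := L) gi.
  move=> r; rewrite mem_L => /andP[/and3P[h _ _] _].
  by rewrite -(ithK h) gs.
move=> sm; apply: (mfindP gi'); have := gs (ith s); rewrite ithK // => e.
by rewrite g'E e /= cats0.
Qed.

Definition best := (solve adj len m 0 None).1.

Lemma solutionE : solution segs = best.2.
Proof.
rewrite /solution -/out -/L size_segs.
rewrite (@run_fuel _ _ adj len (fun s => (s < m)%N) mfind_adj _ _ m 0 (3 * m)) //.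
- move=> s it _; rewrite mem_adj => /andP[/nE_lt/andP[]//].
- by move=> s _; exact: uniq_adj.
- exact: good_root.
- by rewrite (perm_size nodes_perm) size_iota.
Qed.

Lemma solution_leaves : (leaves (solution segs) <= 3 * m)%N.
Proof.
have [h _] := solve_leaves len uniq_adj good_root.
by rewrite solutionE; apply: leq_trans h _; rewrite (perm_size nodes_perm) size_iota.
Qed.

Definition ext (f : 'I_m -> R * R) (s : nat) : R * R := f (ith s).
Local Notation stubs f i := (stub_src G pos f i `|` stub_dst G pos f i)%classic.

Lemma along_rev (P Q : pt) t : along P Q t = along Q P (1 - t).
Proof. by case: P Q => [a b] [c d]; rewrite /along /=; congr (_, _); ring. Qed.

Lemma xptC (a b : seg) : xing a b -> xpt a b = xpt b a.
Proof. by case/and5P => d0 _ _ _ _; exact: xpt_sym. Qed.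

Lemma stubs_cov f i j : xing (sg i) (sg j) ->
  stubs f i (xpt (sg i) (sg j)) <-> cov (ext f) i (tau (sg i) (sg j)).
Proof.
move=> x; rewrite /cov /ext ith_ord; case/and5P: x => _ t0 t1 _ _.
have nd := sg_nondeg drawing i.
have ex : xpt (sg i) (sg j) = along (pos (src G i)) (pos (dst G i)) (tau (sg i) (sg j)) by [].
rewrite ex; split.
  case=> -[t /andP[_ tf]]; first by move/(along_inj nd) ->; rewrite tf.
  by rewrite [X in _ = X]along_rev => /(along_inj nd) ->; apply/orP; right; rewrite opprB addrC subrK.
case/orP => h; [left | right].
  by exists (tau (sg i) (sg j)); rewrite // ltW.
exists (1 - tau (sg i) (sg j)); first by rewrite h subr_ge0 ltW.
by rewrite along_rev.
Qed.

Lemma stubs_onseg f i p : okf (f i) -> stubs f i p -> onseg (sg i) p.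
Proof.
case/and3P => h1 h2 h3 [] [t /andP[t0 t1] ->].
  by exists t => //; rewrite t0 /=; lra.
by exists (1 - t); [apply/andP; split; lra | rewrite [LHS]along_rev].
Qed.

(** Stubs lie on their segments, and two segments meet off common ends only in their crossing. So
    disjointness of stubs is a condition on one point per crossing pair. *)
Lemma is_PED_cov f : is_PED G pos f <-> (forall i, okf (f i)) /\
  forall i j, xing (sg i) (sg j) ->
    ~~ (cov (ext f) i (tau (sg i) (sg j)) && cov (ext f) j (tau (sg j) (sg i))).
Proof.
split=> -[h1 h2]; split.
- by move=> i; have [a b c] := h1 i; apply/and3P.
- move=> i j x; apply/negP => /andP[/(stubs_cov _ x) ci /stubs_cov cj].
  have ne : i != j by apply: contraTneq x => ->; rewrite xing_irr.
  apply: (h2 i j ne); exists (xpt (sg i) (sg j)); split=> //.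
    by rewrite (xptC x); apply: cj; rewrite xing_sym.
  by move=> [v [_ _]]; exact: xpt_no_vertex x.
- by move=> i; have /and3P[] := h1 i.
move=> i j ne [p [pi pj nc]].
have [x ep] := meet_xing drawing ne nc (stubs_onseg (h1 i) pi) (stubs_onseg (h1 j) pj).
have /negP := h2 i j x; apply; rewrite ep in pi pj; apply/andP; split; first exact/stubs_cov.
by apply/stubs_cov; rewrite 1?xing_sym // -(xptC x).
Qed.

Lemma is_PED_okT f k s p : is_PED G pos f -> (s < m)%N -> okT adj ntau k s p (ext f).
Proof.
case/is_PED_cov => h1 h2; elim: k s p => //= k IH s p sm; split; first exact: h1.
move=> it; rewrite mem_adj => /andP[e /eqP e1] _; have /andP[_ tm] := nE_lt e; split; first exact: IH.
by have /and3P[_ _ x] := e; have := h2 _ _ x; rewrite !ithK // e1.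
Qed.

(** [okT] tests a crossing from the side of the parent only. By symmetry this settles it from the
    side of the child too, except at the top, whose crossing with its own parent is not tested. *)
Lemma okT_nodes k s p f v : okT adj ntau k s p f -> v \in nodes adj k s p ->
  okf (f v) /\ forall it, it \in adj v -> (Some it.2 = p /\ v = s) \/
    ~~ (cov f v it.1 && cov f it.2 (ntau it.2 v)).
Proof.
elim: k s p => //= k IH s p [h1 h2]; rewrite inE => /orP[/eqP->|].
  by split=> // it itin; case: (Some it.2 =P p) => [->|/eqP ne]; [left | right; have [] := h2 it itin ne].
case/flattenP => l /mapP[it itin ->]; case: eqP => // /eqP ne vin.
have [h3 h4] := h2 it itin ne; have [h5 h6] := IH _ _ h3 vin; split=> // it' it'in; right.
have [[[e1] e2]|//] := h6 it' it'in; subst v; rewrite e1.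
have [-> _] := adj_facts it'in; have [<- _] := adj_facts itin.
by rewrite e1 andbC.
Qed.

Lemma okT_is_PED f : okT adj ntau m 0 None (ext f) -> is_PED G pos f.
Proof.
move=> ok; apply/is_PED_cov.
have all_ (i : 'I_m) : nat_of_ord i \in nodes adj m 0 None.
  by rewrite (perm_mem nodes_perm) mem_iota ltn_ord.
split=> [i|i j x]; first by have [] := okT_nodes ok (all_ i); rewrite /ext ith_ord.
have [_ h] := okT_nodes ok (all_ i).
have := h (ntau i j, nat_of_ord j); rewrite mem_adj nE_ord (intersection_xing drawing) x eqxx.
by case=> // -[] //; rewrite /ntau !ith_ord.
Qed.

Lemma ink_inkT f : ink G pos f = inkT adj len m 0 None (ext f).
Proof.
rewrite /inkT (perm_big _ nodes_perm) /= -[iota 0 m]val_enum_ord big_map big_enum /=.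
by apply: eq_bigr => i _; rewrite /ext /len ith_ord mulrC; congr (_ * _).
Qed.

Lemma maxped_keys : perm_eq [seq e.1 | e <- maxped segs] (iota 0 m).
Proof.
have [[h _] _] := solve_sound len adj_facts sorted_adj adj_sym_ good_root.
by rewrite /maxped solutionE; apply: perm_trans h nodes_perm.
Qed.

Lemma maxped_correct f : (forall e, e \in maxped segs -> ext f e.1 = e.2) -> is_MaxPED G pos f.
Proof.
rewrite /maxped solutionE => ag.
have [[_ /(_ _ ag)[ok e]] _] := solve_sound len adj_facts sorted_adj adj_sym_ good_root.
split=> [|g pg]; first exact: okT_is_PED.
rewrite !ink_inkT e.
by have [] := solve_opt len_ge0 adj_facts sorted_adj adj_sym_ good_root (is_PED_okT m None pg m_gt0).
Qed.

End Pipeline.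

(** * The cost of the algorithm *)

Section Costs.
Variable R : realType.
Local Notation Enc := (Enc R).
Local Notation Cost := (@Cost R _ _ _ _).
Notation pt := (R * R)%type.
Notation seg := (nat * (pt * pt))%type.
Notation query := (pt * (bool * seg))%type.
Notation event := (pt * (seg * seg))%type.
Notation summary := (option ((seg * seg) * option event))%type.
Notation status := (tree seg summary).

Section Fixed.
Context {A : Type} `{EA : Enc A} (T : input R -> A -> nat).

Lemma Cost_lexlt (f g : input R -> A -> pt) : Cost f T -> Cost g T -> Cost (fun i x => lexlt (f i x) (g i x)) T.
Proof. by move=> Hf Hg; rewrite /lexlt; cost. Qed.
Lemma Cost_segdx (f : input R -> A -> seg) : Cost f T -> Cost (fun i x => segdx (f i x)) T.
Proof. by move=> Hf; rewrite /segdx; cost. Qed.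
Lemma Cost_segdy (f : input R -> A -> seg) : Cost f T -> Cost (fun i x => segdy (f i x)) T.
Proof. by move=> Hf; rewrite /segdy; cost. Qed.

Ltac cost_user ::= lazymatch goal with
| |- Cost (fun i x => lexlt (@?f i x) (@?g i x)) _ => eapply Cost_lexlt
| |- Cost (fun i x => segdx (@?f i x)) _ => eapply Cost_segdx
| |- Cost (fun i x => segdy (@?f i x)) _ => eapply Cost_segdy
end.

Lemma Cost_segdet (f g : input R -> A -> seg) : Cost f T -> Cost g T -> Cost (fun i x => segdet (f i x) (g i x)) T.
Proof. by move=> Hf Hg; rewrite /segdet; cost. Qed.
Lemma Cost_lft (f : input R -> A -> seg) : Cost f T -> Cost (fun i x => lft (f i x)) T.
Proof. by move=> Hf; rewrite /lft; cost. Qed.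
Lemma Cost_rgt (f : input R -> A -> seg) : Cost f T -> Cost (fun i x => rgt (f i x)) T.
Proof. by move=> Hf; rewrite /rgt; cost. Qed.

Ltac cost_user ::= lazymatch goal with
| |- Cost (fun i x => segdx (@?f i x)) _ => eapply Cost_segdx
| |- Cost (fun i x => segdy (@?f i x)) _ => eapply Cost_segdy
| |- Cost (fun i x => segdet (@?f i x) (@?g i x)) _ => eapply Cost_segdet
| |- Cost (fun i x => lft (@?f i x)) _ => eapply Cost_lft
| |- Cost (fun i x => rgt (@?f i x)) _ => eapply Cost_rgt
end.

Lemma Cost_tau (f g : input R -> A -> seg) : Cost f T -> Cost g T -> Cost (fun i x => tau (f i x) (g i x)) T.
Proof. by move=> Hf Hg; rewrite /tau; cost. Qed.
Lemma Cost_odet (f g : input R -> A -> seg) : Cost f T -> Cost g T -> Cost (fun i x => odet (f i x) (g i x)) T.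
Proof. by move=> Hf Hg; rewrite /odet; cost. Qed.
Lemma Cost_side (f : input R -> A -> seg) (g : input R -> A -> pt) :
  Cost f T -> Cost g T -> Cost (fun i x => side (f i x) (g i x)) T.
Proof. by move=> Hf Hg; rewrite /side; cost. Qed.
Lemma Cost_seglen (f : input R -> A -> seg) : Cost f T -> Cost (fun i x => seglen (f i x)) T.
Proof. by move=> Hf; rewrite /seglen; cost. Qed.

Ltac cost_user ::= lazymatch goal with
| |- Cost (fun i x => segdx (@?f i x)) _ => eapply Cost_segdx
| |- Cost (fun i x => segdy (@?f i x)) _ => eapply Cost_segdy
| |- Cost (fun i x => segdet (@?f i x) (@?g i x)) _ => eapply Cost_segdet
| |- Cost (fun i x => tau (@?f i x) (@?g i x)) _ => eapply Cost_tau
end.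

Lemma Cost_xing (f g : input R -> A -> seg) : Cost f T -> Cost g T -> Cost (fun i x => xing (f i x) (g i x)) T.
Proof. by move=> Hf Hg; rewrite /xing; cost. Qed.
Lemma Cost_xpt (f g : input R -> A -> seg) : Cost f T -> Cost g T -> Cost (fun i x => xpt (f i x) (g i x)) T.
Proof. by move=> Hf Hg; rewrite /xpt; cost. Qed.

Ltac cost_user ::= lazymatch goal with
| |- Cost (fun i x => xing (@?f i x) (@?g i x)) _ => eapply Cost_xing
| |- Cost (fun i x => xpt (@?f i x) (@?g i x)) _ => eapply Cost_xpt
| |- Cost (fun i x => odet (@?f i x) (@?g i x)) _ => eapply Cost_odet
| |- Cost (fun i x => lexlt (@?f i x) (@?g i x)) _ => eapply Cost_lexlt
end.

Lemma Cost_cand (f g : input R -> A -> seg) : Cost f T -> Cost g T -> Cost (fun i x => cand (f i x) (g i x)) T.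
Proof. by move=> Hf Hg; rewrite /cand; cost. Qed.
Lemma Cost_minc (f g : input R -> A -> option event) : Cost f T -> Cost g T -> Cost (fun i x => minc (f i x) (g i x)) T.
Proof. by move=> Hf Hg; apply: (Cost_app2 (h := @minc R)) Hf Hg; rewrite /minc; cost. Qed.

End Fixed.

Ltac cost_user ::= lazymatch goal with
| |- Cost (fun i x => cand (@?f i x) (@?g i x)) _ => eapply Cost_cand
| |- Cost (fun i x => minc (@?f i x) (@?g i x)) _ => eapply Cost_minc
| |- Cost (fun i x => odet (@?f i x) (@?g i x)) _ => eapply Cost_odet
| |- Cost (fun i x => side (@?f i x) (@?g i x)) _ => eapply Cost_side
| |- Cost (fun i x => lexlt (@?f i x) (@?g i x)) _ => eapply Cost_lexlt
| |- Cost (fun i x => act_insert (@?f i x) (@?g i x) (@?h i x)) _ => eapply Cost_act_insert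
| |- Cost (fun i x => mulL (@?f i x) (@?g i x)) _ => eapply Cost_mulL
| |- Cost (fun i x => Leaf (@?f i x)) _ => eapply Cost_Leaf
| |- Cost (fun i x => Node (@?f i x) (@?g i x) (@?h i x) (@?k i x)) _ => eapply Cost_Node
end.

Let zero {X : Type} : input R -> X -> nat := fun _ _ => 0.

Lemma Cost_slm : Cost (fun=> @slm R) zero.
Proof. by rewrite /slm; cost. Qed.
Lemma Cost_smul : Cost (fun _ p => @smul R p.1 p.2) zero.
Proof. by rewrite /smul; cost. Qed.
Lemma Cost_slst : Cost (fun=> @slst R) zero.
Proof. by rewrite /slst; cost. Qed.
Lemma Cost_sbest : Cost (fun=> @sbest R) zero.
Proof. by rewrite /sbest; cost. Qed.
Lemma Cost_qB : Cost (fun _ p => @qB R p.1 p.2) zero.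
Proof. by rewrite /qB; cost. Qed.
Lemma Cost_qact : Cost (fun _ p => @qact R p.1 p.2) zero.
Proof. by rewrite /qact; cost. Qed.
Lemma Cost_qlt : Cost (fun _ p => @qlt R p.1 p.2) zero.
Proof.
apply: (Cost_ext (f := fun _ p => lexlt p.1.1 p.2.1 ||
  (((p.1.1.1 == p.2.1.1) && (p.1.1.2 == p.2.1.2)) && (~~ p.1.2.1 && p.2.2.1)))) => //.
by cost.
Qed.
Lemma Cost_rlt : Cost (fun _ p => @rlt R p.1 p.2) zero.
Proof. by rewrite /rlt; cost. Qed.

Section Fixed2.
Context {A : Type} `{EA : Enc A} (T : input R -> A -> nat).

Lemma Cost_supd (f : input R -> A -> query) (g : input R -> A -> status) :
  (exists K, forall i x, depth (g i x) <= K * (T i x).+1) -> Cost f T -> Cost g T ->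
  Cost (fun i x => supd (f i x) (g i x)) T.
Proof.
move=> HT Hf Hg.
apply: (Cost_comp (f := fun i x => (f i x, g i x))
  (Cost_upd Cost_slm Cost_smul Cost_slst Cost_qB Cost_qact)) HT.
exact: Cost_pair.
Qed.

Lemma Cost_sbest_aug (f : input R -> A -> status) :
  Cost f T -> Cost (fun i x => sbest (aug (@slm R) (f i x))) T.
Proof.
move=> Hf; apply: (Cost_app (g := fun=> @sbest R)) => //; first exact: Cost_sbest.
apply: (Cost_app (g := fun=> aug (@slm R))) Hf; rewrite /aug.
by eapply Cost_tree; cost; eapply (Cost_app (g := fun=> @slm R)); cost; exact: Cost_slm.
Qed.
End Fixed2.

Ltac cost_user ::= lazymatch goal with
| |- Cost (fun i x => lexlt (@?f i x) (@?g i x)) _ => eapply Cost_lexlt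
| |- Cost (fun i x => supd (@?f i x) (@?g i x)) _ => eapply Cost_supd
| |- Cost (fun i x => sbest (aug _ (@?f i x))) _ => eapply Cost_sbest_aug
end.

Lemma Cost_sstep : Cost (fun=> @sstep R) (fun _ st => depth st.2.1).
Proof.
rewrite /sstep; cost.
all: try by exists 1 => i x; lia.
by exists 2 => i x; have := upd_depth (@slm R) (@smul R) (@slst R) (@qB R) (@qact R) (x.2.1, (false, x.2.2.1)) x.1.1.2.1;
   rewrite /supd; lia.
Qed.

Definition nlogn n := n.+1 * (lg n).+1.

Lemma nlogn_le j m n : m < 2 ^ j * n.+1 -> nlogn m <= (2 ^ j * j.+1) * nlogn n.
Proof.
move=> h; have hl : lg m <= j + lg n.
  rewrite /lg; apply: leq_trans (leq_trunc_log 2 h) _.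
  elim: j {h} => [|j IH]; first by rewrite mul1n.
  by rewrite expnS -mulnA trunc_logMp // muln_gt0 expn_gt0.
rewrite /nlogn; apply: (@leq_trans ((2 ^ j * n.+1) * (j.+1 * (lg n).+1))); last by lia.
by apply: leq_mul => //; nia.
Qed.

(** The invariant is indexed by the number of rounds left: in the sweep the status may grow by two
    leaves per round, and its final size has to bound all of them. *)
Lemma iter_cost_le A (T : A -> nat) (f : A -> A) (I : nat -> A -> Prop) D :
  (forall k a, I k.+1 a -> I k (f a)) -> (forall k a, I k a -> T a <= D) ->
  forall N a, I N a -> iter_cost T f N a <= N.+1 * D.+1.
Proof.
move=> If IT; elim=> [|N IH] a h /=; first by have := IT _ _ h; lia.
by have := IT _ _ h; have := IH _ (If _ _ h); rewrite [N.+2 * _]mulSn; lia.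
Qed.

Lemma sstep_avl (st : seq query * (status * seq (seg * seg))) : avl st.2.1 ->
  [/\ avl (sstep st).2.1, leaves (sstep st).2.1 <= leaves st.2.1 + 2 & size (sstep st).2.2 <= (size st.2.2).+1].
Proof.
move=> av; rewrite /sstep; case: st.1 => [|q rest]; first by split=> //; lia.
pose up := upd (@slm R) (@smul R) (@slst R) (@qB R) (@qact R).
have a q' t := upd_avl (@slm R) (@smul R) (@slst R) (@qB R) (@qact R) q' (t := t).
have l q' t : leaves (up q' t) <= (leaves t).+1 := upd_leaves _ _ _ _ _ q' t.
have one : [/\ avl (supd q st.2.1), leaves (supd q st.2.1) <= leaves st.2.1 + 2 & size st.2.2 <= (size st.2.2).+1].
  by split; [have [] := a q _ av | have := l q st.2.1; rewrite /up /supd; lia | lia].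
case: (sbest _) => [e|] //; case: ifP => _ //=; split=> //.
  by have [a1 _] := a (e.1, (false, e.2.1)) _ av; have [] := a (e.1, (true, e.2.1)) _ a1.
have := l (e.1, (false, e.2.1)) st.2.1; have := l (e.1, (true, e.2.1)) (up (e.1, (false, e.2.1)) st.2.1).
by rewrite /up /supd; lia.
Qed.

(** [Cost] speaks about all inputs, so the count of crossings in a tree is not at hand; here it
    suffices that a round reports at most one pair. *)
Lemma sweep_size (S : seq seg) : size (sweep S) <= 3 * size S.
Proof.
rewrite /sweep; suff : avl (iter (3 * size S) (@sstep R) (entries S, (Leaf None, [::]))).2.1 /\
  size (iter (3 * size S) (@sstep R) (entries S, (Leaf None, [::]))).2.2 <= 3 * size S by case.
elim: (3 * size S) => //= N [IH1 IH2]; have [a1 _ a2] := sstep_avl IH1; split=> //; lia.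
Qed.

Lemma Cost_size A `{EA : Enc A} : Cost (fun _ (s : seq A) => size s) (fun _ s => size s).
Proof.
apply: (Cost_ext (f := fun _ s => foldl (fun n _ => n.+1) 0 s)).
  by move=> _ s; rewrite -[RHS]add0n; elim: s 0 => [|x s IH] n /=; [rewrite addn0 | rewrite IH addnS].
apply: (Cost_comp (f := fun _ (s : seq A) => (0, s)) (Cost_foldl (f := fun _ n _ => n.+1) (T := fun _ _ => 0) _)).
- by cost.
- by cost.
- by exists 1 => i s; rewrite /= foldl_cost0; lia.
Qed.

Lemma Cost_map A B `{EA : Enc A} `{EB : Enc B} (g : A -> B) :
  Cost (fun=> g) (fun _ _ => 0) -> Cost (fun _ s => map g s) (fun _ s => size s).
Proof.
move=> Hg.
have aux C D (EC : Enc C) (ED : Enc D) (h : C -> D) : Cost (fun=> h) (fun _ _ => 0) ->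
    Cost (fun _ s => foldl (fun l x => h x :: l) [::] s) (fun _ s => size s).
  move=> Hh.
  apply: (Cost_comp (f := fun _ (s : seq C) => ([::] : seq D, s))
    (Cost_foldl (f := fun _ l x => h x :: l) (T := fun _ _ => 0) _)).
  - by cost; eapply (Cost_app (g := fun=> h)); cost.
  - by cost.
  - by exists 1 => i s; rewrite /= foldl_cost0; lia.
have rv C D (h : C -> D) s : foldl (fun l x => h x :: l) [::] s = rev (map h s).
  by rewrite -[RHS]cats0; elim: s [::] => //= x s IH l; rewrite IH rev_cons cat_rcons.
have Hid : Cost (fun _ (x : B) => x) (fun _ _ => 0) by cost.
apply: (Cost_ext (f := fun _ s => foldl (fun l x => x :: l) [::] (foldl (fun l x => g x :: l) [::] s))).
  by move=> i s; rewrite rv map_id rv revK.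
apply: (Cost_comp (g := fun _ s => foldl (fun l x => x :: l) [::] s) (aux _ _ _ _ id Hid) (aux _ _ _ _ g Hg)).
by exists 1 => i s; rewrite rv size_rev size_map; lia.
Qed.

Lemma Cost_entries : Cost (fun=> @entries R) (fun _ S => nlogn (size S)).
Proof.
rewrite /entries.
pose F (S : seq seg) := foldl (fun es s => start s :: stop s :: es) [::] S.
have sF S : size (F S) = (size S).*2.
  rewrite /F -[RHS]addn0 -[X in _ + X]/(size ([::] : seq query)).
  by elim: S [::] => //= s S IH es; rewrite IH /=; lia.
apply: (Cost_comp (f := fun=> F) (Cost_tsort Cost_qlt)).
  apply: (Cost_comp (f := fun _ (S : seq seg) => ([::] : seq query, S))
    (Cost_foldl (f := fun _ es (s : seg) => start s :: stop s :: es) (T := fun _ _ => 0) _)).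
  - rewrite /start /stop; cost; first [eapply Cost_lft | eapply Cost_rgt]; cost.
  - by cost.
  - by exists 1 => i S; rewrite /= foldl_cost0 /nlogn; nia.
exists 4 => i S; rewrite sF -/(nlogn _).
have := @nlogn_le 1 (size S).*2 (size S); lia.
Qed.

Lemma Cost_sweep : Cost (fun=> @sweep R) (fun _ S => nlogn (size S)).
Proof.
have H : Cost (fun _ (S : seq seg) => iter (3 * size S) (@sstep R) (entries S, (Leaf None, [::]))) (fun _ S => nlogn (size S)).
  (* The machine cannot multiply natural numbers. *)
  apply: (Cost_ext (f := fun _ S => iter (size S + (size S + size S)) (@sstep R) (entries S, (Leaf None, [::])))).
    by move=> i S; congr iter; lia.
  apply: (Cost_comp (f := fun _ S => (size S + (size S + size S), (entries S, (Leaf None : status, [::])))) (Cost_iter Cost_sstep)).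
    have Hs : Cost (fun _ (S : seq seg) => size S) (fun _ S => nlogn (size S)).
      by apply: Cost_le (@Cost_size seg _) => i S; rewrite /nlogn; instantiate (1 := 1); nia.
    apply: Cost_pair; first by cost.
    apply: Cost_pair; first exact: Cost_entries.
    by cost; eapply Cost_Leaf; cost.
  (* From a single leaf, 3 n rounds with at most two new leaves each lead to at most 6 n + 1
     leaves. *)
  exists 200 => i S /=; set n := size S.
  apply: leq_trans (@iter_cost_le _ _ _ (fun k st => avl st.2.1 /\ leaves st.2.1 + 2 * k <= (6 * n).+1) (lg (6 * n)).*2.+1 _ _ _ _ _) _.
  - by move=> k a [h1 h2]; have [a1 a2 _] := sstep_avl h1; split=> //; lia.
  - by move=> k a [h1 h2]; apply: avl_depth_lg => //; lia.
  - by split=> //=; lia.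
  have := @nlogn_le 3 (6 * n) n; rewrite /nlogn; nia.
rewrite /sweep; cost; exact: H.
Qed.

Notation record := (R * (nat * nat))%type.
Notation rope := (tree (nat * (R * R)) unit).
Notation sol := (R * rope)%type.
Notation psol := (R * (rope * R))%type.
Notation acc := (option sol * (option psol * option sol))%type.
Notation entry := (nat * (R * seq (R * nat)))%type.
Notation mtree := (tree entry (option entry)).
Notation mquery := (nat * (R * option (R * nat)))%type.
Notation frame := (nat * (option nat * (R * (seq (R * nat) * (acc * acc)))))%type.

Lemma size_records (out : seq (seg * seg)) : size (records out) = (size out).*2.
Proof.
rewrite /records -[RHS]addn0 -[X in _ + X]/(size ([::] : seq record)).
by elim: out [::] => //= p out IH l; rewrite IH /=; lia.
Qed.

Lemma size_sorted (out : seq (seg * seg)) : size (tsort (@rlt R) (records out)) = (size out).*2.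
Proof. by have [_ [_ /perm_size ->]] := sort_tree_ok (@rle_total R) (@rle_trans R) (records out); exact: size_records. Qed.

Ltac cost_user ::= lazymatch goal with
| |- Cost (fun i x => tau (@?f i x) (@?g i x)) _ => eapply Cost_tau
| |- Cost (fun i x => seglen (@?f i x)) _ => eapply Cost_seglen
end.

Lemma Cost_sorted_records :
  Cost (fun _ (S : seq seg) => tsort (@rlt R) (records (sweep S))) (fun _ S => nlogn (size S)).
Proof.
apply: (Cost_comp (f := fun _ S => records (sweep S)) (Cost_tsort Cost_rlt)).
  apply: (Cost_comp (g := fun=> @records R) (Tg := fun _ out => size out) _ Cost_sweep).
    apply: (Cost_comp (f := fun _ (S : seq (seg * seg)) => ([::] : seq record, S))
      (Cost_foldl (f := fun _ l (p : seg * seg) =>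
         (tau p.1 p.2, (p.1.1, p.2.1)) :: (tau p.2 p.1, (p.2.1, p.1.1)) :: l) (T := fun _ _ => 0) _)).
    - by cost.
    - by cost.
    - by exists 1 => i S; rewrite /= foldl_cost0; lia.
  exists 3 => i S; have := sweep_size S; rewrite /nlogn; nia.
exists 100 => i S; rewrite -/(nlogn _) size_records.
have := sweep_size S => h; have := @nlogn_le 3 (size (sweep S)).*2 (size S); lia.
Qed.

Lemma Cost_mB : Cost (fun _ p => @mB R p.1 p.2) zero.
Proof. by rewrite /mB; cost. Qed.
Ltac cost_user ::= lazymatch goal with
| |- Cost (fun i x => act_insert (@?f i x) (@?g i x) (@?h i x)) _ => eapply Cost_act_insert
end.
Lemma Cost_mact : Cost (fun _ p => @mact R p.1 p.2) zero.
Proof. by rewrite /mact /mB; cost. Qed.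
Lemma Cost_optid : Cost (fun _ (o : option entry) => o) zero.
Proof. by cost. Qed.
Lemma Cost_optmul : Cost (fun _ p => @mulL entry p.1 p.2) zero.
Proof. by apply: Cost_mulL; cost. Qed.

Lemma Cost_mfind : Cost (fun _ p => @mfind R p.1 p.2) (fun _ p => depth p.2).
Proof.
have H : Cost (fun _ (p : nat * mtree) => find (id : option entry -> option entry) id (@mB R) (p.1, (0%R, None)) p.2)
    (fun _ p => depth p.2).
  apply: (Cost_comp (f := fun _ (p : nat * mtree) => ((p.1, (0%R, None)) : mquery, p.2))
    (Cost_find Cost_optid Cost_optid Cost_mB)); first by cost.
  by exists 1 => i p /=; lia.
by rewrite /mfind; cost.
Qed.

Lemma adj_tree_avl S L : avl (@adj_tree R S L) /\ leaves (@adj_tree R S L) <= (size S + size L).+1.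
Proof.
have [a1 l1] := foldl_upd_avl (id : option entry -> option entry) (@mulL entry) id (@mB R) (@mact R)
  [seq insert_query s | s <- S] (isT : avl (Leaf None)).
have [a2 l2] := foldl_upd_avl (id : option entry -> option entry) (@mulL entry) id (@mB R) (@mact R)
  [seq push_query r | r <- L] a1.
by split; [exact: a2 | apply: leq_trans l2 _; move: l1; rewrite !size_map /=; lia].
Qed.

Lemma Cost_adj_tree : Cost (fun _ p => @adj_tree R p.1 p.2) (fun _ p => nlogn (size p.1 + size p.2)).
Proof.
have Hu := Cost_foldl_upd Cost_optid Cost_optmul Cost_optid Cost_mB Cost_mact.
pose t1 (S : seq seg) : mtree := foldl (fun t q => mupd q t) (Leaf None) [seq insert_query s | s <- S].
have H1 : Cost (fun _ p => t1 p.1) (fun _ (p : seq seg * seq record) => nlogn (size p.1 + size p.2)).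
  apply: (Cost_comp (f := fun _ (p : seq seg * seq record) => (Leaf None : mtree, [seq insert_query s | s <- p.1])) Hu).
    apply: Cost_pair; first by eapply Cost_Leaf; cost.
    apply: (Cost_comp (f := fun _ p => p.1) (Cost_map (g := @insert_query R) _)).
    - by rewrite /insert_query; cost; eapply Cost_seglen; cost.
    - by cost.
    - by exists 1 => i p /=; rewrite /nlogn; nia.
  exists 2 => i p.
  have := @foldl_upd_cost _ _ _ (id : option entry -> option entry) (@mulL entry) id (@mB R) (@mact R)
    (Leaf None) [seq insert_query s | s <- p.1] (size p.1 + size p.2) isT.
  by rewrite size_map /nlogn => h; apply: leq_trans (h _) _; [rewrite /=; lia | nia].
apply: (Cost_comp (f := fun _ (p : seq seg * seq record) => (t1 p.1, [seq push_query r | r <- p.2])) Hu).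
  apply: Cost_pair => //.
  apply: (Cost_comp (f := fun _ p => p.2) (Cost_map (g := @push_query R) _)).
  - by rewrite /push_query; cost.
  - by cost.
  - by exists 1 => i p /=; rewrite /nlogn; nia.
exists 2 => i p.
have [a1 l1] := adj_tree_avl p.1 [::].
have := @foldl_upd_cost _ _ _ (id : option entry -> option entry) (@mulL entry) id (@mB R) (@mact R)
  (t1 p.1) [seq push_query r | r <- p.2] (size p.1 + size p.2) a1.
rewrite size_map /nlogn => h; apply: leq_trans (h _) _; last by nia.
by move: l1; rewrite /adj_tree /= -/(t1 _); lia.
Qed.

Section Fixed3.
Context {A : Type} `{EA : Enc A} (T : input R -> A -> nat).

Lemma Cost_join (f g : input R -> A -> rope) : Cost f T -> Cost g T -> Cost (fun i x => join (f i x) (g i x)) T.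
Proof. by move=> Hf Hg; rewrite /join; eapply Cost_Node; cost. Qed.
Lemma Cost_sol0 : Cost (fun _ _ => sol0 R) T.
Proof. by rewrite /sol0; cost; eapply Cost_Leaf; cost. Qed.

Ltac cost_user ::= lazymatch goal with
| |- Cost (fun i x => join (@?f i x) (@?g i x)) _ => eapply Cost_join
| |- Cost (fun i x => Leaf (@?f i x)) _ => eapply Cost_Leaf
end.

Lemma Cost_addsol (f g : input R -> A -> sol) : Cost f T -> Cost g T -> Cost (fun i x => addsol (f i x) (g i x)) T.
Proof. by move=> Hf Hg; rewrite /addsol; cost. Qed.
Lemma Cost_maxsol (f g : input R -> A -> option sol) : Cost f T -> Cost g T -> Cost (fun i x => maxsol (f i x) (g i x)) T.
Proof. by move=> Hf Hg; apply: (Cost_app2 (h := @maxsol R)) Hf Hg; rewrite /maxsol; cost. Qed.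
Lemma Cost_maxpsol (f g : input R -> A -> option psol) : Cost f T -> Cost g T -> Cost (fun i x => maxpsol (f i x) (g i x)) T.
Proof. by move=> Hf Hg; apply: (Cost_app2 (h := @maxpsol R)) Hf Hg; rewrite /maxpsol; cost. Qed.
End Fixed3.

Ltac cost_user ::= lazymatch goal with
| |- Cost (fun i x => join (@?f i x) (@?g i x)) _ => eapply Cost_join
| |- Cost (fun i x => addsol (@?f i x) (@?g i x)) _ => eapply Cost_addsol
| |- Cost (fun i x => maxsol (@?f i x) (@?g i x)) _ => eapply Cost_maxsol
| |- Cost (fun i x => maxpsol (@?f i x) (@?g i x)) _ => eapply Cost_maxpsol
| |- Cost (fun i x => sol0 _) _ => eapply Cost_sol0
| |- Cost (fun i x => Leaf (@?f i x)) _ => eapply Cost_Leaf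
end.

Lemma Cost_pass : Cost (fun _ (p : nat * (R * (R * (sol * (option sol * acc))))) =>
  pass p.1 p.2.1 p.2.2.1 p.2.2.2.1 p.2.2.2.2.1 p.2.2.2.2.2) zero.
Proof. by rewrite /pass /close /cover /advance /open_gap; cost. Qed.

Lemma Cost_finish : Cost (fun _ (p : nat * (R * acc)) => finish p.1 p.2.1 p.2.2) zero.
Proof.
rewrite /finish; cost; exact: (Cost_const_real _ 2).
Qed.

Section Fixed4.
Context {A : Type} `{EA : Enc A} (T : input R -> A -> nat).
Variables (s : input R -> A -> nat) (len tau : input R -> A -> R).
Hypotheses (Hs : Cost s T) (Hl : Cost len T) (Ht : Cost tau T).

Lemma Cost_pass_app (F : input R -> A -> sol) (U : input R -> A -> option sol) (a : input R -> A -> acc) :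
  Cost F T -> Cost U T -> Cost a T ->
  Cost (fun i x => pass (s i x) (len i x) (tau i x) (F i x) (U i x) (a i x)) T.
Proof.
move=> HF HU Ha.
by apply: (Cost_app (f := fun i x => (s i x, (len i x, (tau i x, (F i x, (U i x, a i x)))))) Cost_pass); cost.
Qed.

Ltac cost_user ::= lazymatch goal with
| |- Cost (fun i x => pass _ _ _ _ _ _) _ => eapply Cost_pass_app
| |- Cost (fun i x => sol0 _) _ => eapply Cost_sol0
end.

Lemma Cost_pass_parent (a : input R -> A -> acc * acc) :
  Cost a T -> Cost (fun i x => pass_parent (s i x) (len i x) (tau i x) (a i x)) T.
Proof. by move=> Ha; rewrite /pass_parent; cost. Qed.

Lemma Cost_pass_child (r : input R -> A -> sol * sol) (a : input R -> A -> acc * acc) :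
  Cost r T -> Cost a T -> Cost (fun i x => pass_child (s i x) (len i x) (tau i x) (r i x) (a i x)) T.
Proof. by move=> Hr Ha; rewrite /pass_child; cost. Qed.

Lemma Cost_finish_app (a : input R -> A -> acc) :
  Cost a T -> Cost (fun i x => finish (s i x) (len i x) (a i x)) T.
Proof. by move=> Ha; apply: (Cost_app (f := fun i x => (s i x, (len i x, a i x))) Cost_finish); cost. Qed.

Lemma Cost_finishes (a : input R -> A -> acc * acc) :
  Cost a T -> Cost (fun i x => finishes (s i x) (len i x) (a i x)) T.
Proof. by move=> Ha; rewrite /finishes; eapply Cost_pair; eapply Cost_finish_app; cost. Qed.

Lemma Cost_acc0 : Cost (fun _ _ => acc0 R) T.
Proof. by rewrite /acc0; cost. Qed.

Lemma Cost_new_frame (p : input R -> A -> option nat) (v : input R -> A -> R * seq (R * nat)) :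
  Cost p T -> Cost v T -> Cost (fun i x => new_frame (s i x) (p i x) (v i x)) T.
Proof. by move=> Hp Hv; rewrite /new_frame; cost; exact: Cost_acc0. Qed.

Lemma Cost_is_parent (p : input R -> A -> option nat) :
  Cost p T -> Cost (fun i x => is_parent (p i x) (s i x)) T.
Proof. by move=> Hp; apply: (Cost_app2 (h := is_parent)) Hp Hs; rewrite /is_parent; cost. Qed.
End Fixed4.

Ltac cost_user ::= lazymatch goal with
| |- Cost (fun i x => pass_parent _ _ _ _) _ => eapply Cost_pass_parent
| |- Cost (fun i x => pass_child _ _ _ _ _) _ => eapply Cost_pass_child
| |- Cost (fun i x => finishes _ _ _) _ => eapply Cost_finishes
| |- Cost (fun i x => new_frame _ _ _) _ => eapply Cost_new_frame
| |- Cost (fun i x => is_parent _ _) _ => eapply Cost_is_parent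
| |- Cost (fun i x => mfind (@?f i x) (@?g i x)) _ =>
    eapply (Cost_comp (f := fun i x => (f i x, g i x)) Cost_mfind); [| exists 1 => ? ? /=; lia]
end.

Lemma Cost_dstep : Cost (fun=> @dstep R) (fun _ st => depth st.1).
Proof. by rewrite /dstep; cost. Qed.

Lemma dstep_tree (st : mtree * (seq frame * option sol)) : (dstep st).1 = st.1.
Proof.
by rewrite /dstep; case: st.2.1 => // fr [|fr2 stk]; case: fr.2.2.2.1 => [|it its] //; try case: ifP => //;
  case: fr2.2.2.2.1.
Qed.

Lemma Cost_solution : Cost (fun=> @solution R) (fun _ S => nlogn (size S)).
Proof.
pose M S := adj_tree S (tsort (@rlt R) (records (sweep S))).
(* One insertion for each of the n segments and one for each of at most 6 n records, two per
   reported pair. *)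
have lM S : avl (M S) /\ leaves (M S) <= (7 * size S).+1.
  have [a l] := adj_tree_avl S (tsort (@rlt R) (records (sweep S))); split=> //.
  by apply: leq_trans l _; have := sweep_size S; rewrite size_sorted; lia.
have dM S : depth (M S) <= (lg (7 * size S)).*2.+1 by have [a l] := lM S; apply: avl_depth_lg.
have HM : Cost (fun=> M) (fun _ S => nlogn (size S)).
  apply: (Cost_comp (f := fun _ S => (S, tsort (@rlt R) (records (sweep S)))) Cost_adj_tree).
    by apply: Cost_pair; [cost | exact: Cost_sorted_records].
  exists 100 => i S /=; rewrite size_sorted; have := sweep_size S => h.
  have := @nlogn_le 3 (size S + (size (sweep S)).*2) (size S); lia.
have nl7 n : nlogn (7 * n) <= 32 * nlogn n by have := @nlogn_le 3 (7 * n) n; lia.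
have Hs : Cost (fun _ (S : seq seg) => size S) (fun _ S => nlogn (size S)).
  by apply: Cost_le (@Cost_size seg _) => i S; rewrite /nlogn; instantiate (1 := 1); nia.
have Hst : Cost (fun _ S => iter (3 * size S) (@dstep R) (M S, ([:: new_frame 0 None (mfind 0 (M S))], None)))
    (fun _ S => nlogn (size S)).
  apply: (Cost_ext (f := fun _ S => iter (size S + (size S + size S)) (@dstep R)
     (M S, ([:: new_frame 0 None (mfind 0 (M S))], None)))).
    by move=> i S; congr iter; lia.
  apply: (Cost_comp (f := fun _ S => (size S + (size S + size S),
     (M S, ([:: new_frame 0 None (mfind 0 (M S))], None : option sol)))) (Cost_iter Cost_dstep)).
    apply: Cost_pair; first by cost.
    apply: Cost_pair => //.
    apply: Cost_pair; last by cost.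
    apply: Cost_cons; last by cost.
    eapply Cost_new_frame; try by cost.
    apply: (Cost_comp (f := fun i S => (0, M S)) Cost_mfind); first by cost.
    exists 100 => i S /=; have := dM S; have := nl7 (size S); rewrite /nlogn; nia.
  exists 500 => i S /=; set n := size S.
  apply: leq_trans (@iter_cost_le _ _ _ (fun k st => st.1 = M S) (lg (7 * n)).*2.+1 _ _ _ _ _) _ => //.
  - by move=> k a <-; exact: dstep_tree.
  - by move=> k a ->; exact: dM.
  by have := nl7 n; rewrite /nlogn; nia.
rewrite /solution; eapply Cost_option; [eapply Cost_snd, Cost_snd; exact: Hst | by cost | by eapply Cost_Leaf; cost].
Qed.

Definition load (inp : input R) : seq seg :=
  [seq (i, ((in_x inp (in_src inp i), in_y inp (in_src inp i)),
            (in_x inp (in_dst inp i), in_y inp (in_dst inp i)))) | i <- iota 0 (in_edges inp)].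

(** The argument is a dummy, since [Cost] expects a current value; the program will start with the
    number 0. *)
Lemma Cost_load : Cost (fun inp (_ : nat) => load inp) (fun inp _ => in_edges inp).
Proof.
pose sg (inp : input R) i : seg := (i, ((in_x inp (in_src inp i), in_y inp (in_src inp i)),
            (in_x inp (in_dst inp i), in_y inp (in_dst inp i)))).
pose f inp (st : nat * seq seg) := (st.1.-1, sg inp st.1.-1 :: st.2).
have Hf : Cost f (fun _ _ => 0) by rewrite /f /sg; cost.
apply: (Cost_ext (f := fun inp (_ : nat) => (iter (in_edges inp) (f inp) (in_edges inp, [::])).2)).
  move=> inp _; rewrite /load -/(sg inp).
  have H k n l : iter k (f inp) (k + n, l) = (n, [seq sg inp i | i <- iota n k] ++ l).
    elim: k n l => //= k IH n l; rewrite addSnnS IH /f /=.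
    by [].
  by have := H (in_edges inp) 0 [::]; rewrite addn0 => ->; rewrite cats0.
eapply Cost_snd.
apply: (Cost_comp (f := fun inp (_ : nat) => (in_edges inp, (in_edges inp, [::]))) (Cost_iter Hf)).
  by cost.
exists 2 => inp _ /=.
have := @iter_cost_le _ (fun=> 0) (f inp) (fun _ _ => True) 0 (fun _ _ _ => I) (fun _ _ _ => leqnn _)
  (in_edges inp) (in_edges inp, [::]) I; lia.
Qed.

(** The number of leaves remains in the cost, because it is shown to be linear only for drawings
    whose intersection graph is a tree. *)
Lemma Cost_main : Cost (fun inp (_ : nat) => maxped (load inp))
  (fun inp _ => nlogn (in_edges inp) + leaves (solution (load inp))).
Proof.
apply: (Cost_comp (f := fun inp (_ : nat) => solution (load inp)) (@Cost_elems R _ _ _ _)).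
  apply: (Cost_comp (f := fun inp (_ : nat) => load inp) Cost_solution).
    by apply: Cost_le Cost_load => inp _; rewrite /nlogn; instantiate (1 := 1); nia.
  by exists 1 => inp _; rewrite /load size_map size_iota; lia.
by exists 1 => inp _; lia.
Qed.

End Costs.

(** * Writing the result, and the total bound *)

Section Output.
Variable R : realType.
Variable inp : input R.

(* The current value is a list of triples (s, (a, b)). *)
Definition item := IGet 1 (IGet 2 (IVar 0)).
Definition item_id := IGet 0 (IGet 1 item).
Definition output_cmd : cmd :=
  While (BILt (IConst 0) (IGet 0 (IGet 1 (IVar 0))))
    (Seq (RPut 0 item_id (RGet 2 (IGet 1 (IGet 2 item))))
    (Seq (RPut 1 item_id (RGet 2 (IGet 2 (IGet 2 item))))
         (ISet 0 (IGet 2 (IGet 2 (IVar 0)))))).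

Lemma run_output (l : seq (nat * (R * R))) S st :
  holds st (enc l) -> (forall e, e \in l -> e.1 < S) -> uniq [seq e.1 | e <- l] ->
  exists t st', [/\ exec inp S output_cmd st t st', t <= 60 * (size l).+1,
    forall e, e \in l -> (rarr st' 0 e.1, rarr st' 1 e.1) = e.2 &
    forall A s, A < 2 -> s \notin [seq e.1 | e <- l] -> rarr st' A s = rarr st A s].
Proof.
elim: l st => [|[s [a b]] l IH] st hst lt_S.
  move=> _; exists 6, st; split=> //.
  by apply: ExecWhileFalse; case: hst => _ [[_ /= ->] _].
rewrite [map _ _]/= cons_uniq => /andP[sl ul].
case: hst => h0 [[h1 /= e1] [h2 [[h3 [[h4 e4] [h5 [[h6 e6] [h7 e7]]]]] h8]]].
pose st1 := State (ivar st) (rvar st) (iarr st) (Defs.upd (rarr st) 0 (Defs.upd (rarr st 0) s a)).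
pose st2 := State (ivar st) (rvar st) (iarr st) (Defs.upd (rarr st1) 1 (Defs.upd (rarr st 1) s b)).
pose st3 := State (Defs.upd (ivar st) 0 (ieval inp st2 (IGet 2 (IGet 2 (IVar 0))))) (rvar st) (iarr st) (rarr st2).
have sS : s < S := lt_S _ (mem_head _ _).
(* Values keep their reals in real array 2, so writing to arrays 0 and 1 leaves the rest of the list
   intact. *)
have hst3 : holds st3 (enc l) by apply: rep_mono h8.
have [|t [st' [x1 x2 x3 x4]]] := IH st3 hst3 _ ul; first by move=> e el; apply: lt_S; rewrite inE el orbT.
do 2!eexists; split.
- apply: ExecWhileTrue; [by rewrite /= e1 | | exact: x1].
  apply: ExecSeq; first by apply: ExecRPut; rewrite /= e4.
  rewrite /= e4 e6 -/st1; apply: ExecSeq; first by apply: ExecRPut; rewrite /= e4.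
  have id1 : ieval inp st1 item_id = s := e4.
  have b1 : reval inp st1 (RGet 2 (IGet 2 (IGet 2 item))) = b := e7.
  by rewrite id1 b1; exact: ExecISet.
- by rewrite /=; move: x2; lia.
- move=> e; rewrite inE => /orP[/eqP->|]; last exact: x3.
  by rewrite /= !x4 // /st3 /st2 /st1 /= /Defs.upd /= !eqxx.
- move=> A i A2; rewrite inE negb_or => /andP[/negbTE is_ il].
  rewrite x4 // /st3 /st2 /st1 /= /Defs.upd.
  by case: A A2 => [|[|A]] // _ /=; rewrite is_.
Qed.

End Output.

Lemma load_encode (R : realType) n m (G : sgraph n m) (pos : 'I_n -> R * R) :
  load (encode G pos) = segs G pos.
Proof.
rewrite /load /segs /= -val_enum_ord -map_comp; apply: eq_map => i /=.
have ins p T (h : 'I_p -> T) x0 (j : 'I_p) : oapp h x0 (insub (nat_of_ord j)) = h j.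
  by case: insubP => [u _ /val_inj ->|] //; rewrite ltn_ord.
by rewrite /sg !ins -!surjective_pairing.
Qed.

Lemma nlogn_cost_bound m k : 0 < m -> nlogn m <= 6 * cost_bound m k /\ m <= cost_bound m k.
Proof.
move=> m0; rewrite /nlogn /cost_bound.
have h : lg m <= (trunc_log 2 m).+1.
  by rewrite -(trunc_logMp (isT : 1 < 2) m0) /lg; apply: leq_trunc_log; lia.
(* For m = 1 the logarithm vanishes, and the successor in [cost_bound] has to carry the bound. *)
have [m1|m1] := leqP m 1.
  have -> : m = 1 by lia.
  by rewrite /lg trunc_lognn // trunc_log1 mul1n muln0 addn0; split; lia.
have : 0 < trunc_log 2 m by rewrite trunc_log_gt0.
move: (trunc_log 2 m) (lg m) h => x y h x0; split; nia.
Qed.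

Theorem corollary2 (R : realType) :
  exists (P : cmd) (c : nat),
    forall (n m k : nat) (G : sgraph n m) (pos : 'I_n -> R * R),
      is_drawing G pos ->
      is_tree (intersection_graph G pos) ->
      max_degree (intersection_graph G pos) = k ->
      exists (t : nat) (st : state R),
        [/\ exec (encode G pos) (c * cost_bound m k) P (init_state R) t st,
            (t <= c * cost_bound m k)%N
          & is_MaxPED G pos (output (m := m) st)].
Proof.
have [main [K runs_main]] := Cost_runs (Cost_main R).
(* Declaring cell 0, which reads 0, to be occupied makes it the dummy argument. With C the cost
   bound, the main program takes at most K (6 C + 3 C + C), where 6 C bounds [nlogn], 3 C the leaves
   and C the successor; the rest needs at most 150 C, so the constants leave room. *)
exists (Seq (ISet 1 (IConst 1)) (Seq main output_cmd)), (20 * K + 200) => n m k G pos drawing tree_ _.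
have m0 : 0 < m by have [] := tree_; rewrite card_ord.
have := runs_main (encode G pos) 0.
rewrite load_encode; set l := maxped _; set T := K * _ => runs_l.
have lm := maxped_keys drawing tree_.
have size_l : size l = m by rewrite -(size_map fst) (perm_size lm) size_iota.
have [b1 b2] := nlogn_cost_bound k m0.
set S := (20 * K + 200) * cost_bound m k.
have leT : T + 70 * m.+1 + 10 <= S.
  have := solution_leaves drawing tree_; rewrite /T /S /= => h3.
  have : K * (nlogn m + leaves (solution (segs G pos))).+1 <= K * (20 * cost_bound m k).
    by rewrite leq_mul2l; apply/orP; right; move: (cost_bound m k) b1 b2; lia.
  by move: (cost_bound m k) b1 b2 => C b1 b2; rewrite mulnDl mulnCA; lia.
pose st0 : state R := State (Defs.upd (fun=> 0) 1 1) (fun=> 0%R) (fun _ _ => 0) (fun _ _ => 0%R).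
have [||t1 [st1 [x1 x2 x3 _ _]]] := runs_l S st0 (conj isT erefl); try by rewrite /= /Defs.upd /=; lia.
have [||t2 [st2 [y1 y2 y3 _]]] := run_output (encode G pos) (S := S) x3.
- move=> e el; have : e.1 \in [seq e.1 | e <- l] by apply: map_f.
  by rewrite (perm_mem lm) mem_iota; lia.
- by rewrite (perm_uniq lm) iota_uniq.
exists (2 + (t1 + t2)), st2; split.
- apply: ExecSeq; first exact: ExecISet.
  exact: ExecSeq x1 y1.
- by rewrite -/S; move: y2; rewrite size_l; lia.
apply: (maxped_correct drawing (tree_ := tree_)) => e el; rewrite /ext /output ithK ?y3 //.
have : e.1 \in [seq e.1 | e <- l] by apply: map_f.
by rewrite (perm_mem lm) mem_iota.
Qed.
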